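(* Weak amenability, the weak Haagerup property, the approximation property (AP), and the Haagerup property are invariants of von Neumann equivalence. That is, let $\Gamma$ and $\Lambda$ be countable discrete groups that are von Neumann equivalent. Then: (1) $\Gamma$ is weakly amenable if and only if $\Lambda$ is weakly amenable; (2) $\Gamma$ has the weak Haagerup property if and only if $\Lambda$ has the weak Haagerup property; (3) $\Gamma$ has the approximation property (AP) if and only if $\Lambda$ has (AP); (4) $\Gamma$ has the Haagerup property if and only if $\Lambda$ has the Haagerup property.
   Context: Von Neumann equivalence. For an action $\sigma$ of a discrete group $\Lambda$ on a von Neumann algebra $\mathcal M$ (by $*$-automorphisms), a fundamental domain is a projection $p\in\mathcal M$ such that $\{\sigma_s(p)\}_{s\in\Lambda}$ is a partition of unity, i.e. $\sum_{s\in\Lambda}\sigma_s(p)=\mathbf 1$ in the strong operator topology. Two countable discrete groups $\Gamma,\Lambda$ are von Neumann equivalent if there exist a (nonzero) semi-finite von Neumann algebra $\mathcal M$ with a faithful normal semi-finite trace $\operatorname{Tr}$ and a trace-preserving action of $\Gamma\times\Lambda$ on $\mathcal M$ (equivalently, commuting trace-preserving actions of $\Gamma$ and $\Lambda$) such that the action of $\Gamma$ and the action of $\Lambda$ each admit a finite-trace fundamental domain. Multipliers. For a countable discrete group $\Gamma$, $c_0(\Gamma)$ denotes the complex-valued functions on $\Gamma$ vanishing at infinity. A Herz-Schur multiplier on $\Gamma$ is a function $\varphi:\Gamma\to\mathbb C$ for which there exist a Hilbert space $\mathcal H$ and bounded functions $\xi,\eta:\Gamma\to\mathcal H$ with $\varphi(t^{-1}s)=\langle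 \xi(s),\eta(t)\rangle$ for all $s,t\in\Gamma$. The set of these is denoted $B_2(\Gamma)$, with norm $\|\varphi\|_{B_2}=\inf\|\xi\|_\infty\|\eta\|_\infty$, the infimum over all such representations. $B_2(\Gamma)$ is the dual Banach space of $Q(\Gamma)$, the completion of $\ell^1\Gamma$ in the norm $\|f\|_Q=\sup\{|\sum_{s\in\Gamma}f(s)u(s)| : u\in B_2(\Gamma),\ \|u\|_{B_2}\le 1\}$, with the duality extending $\langle f,u\rangle=\sum_{s}f(s)u(s)$ for $f\in\ell^1\Gamma$. Properties of a countable discrete group $\Gamma$: - Haagerup property: there is a net $\{\varphi_i\}$ of positive definite functions on $\Gamma$ with $\varphi_i(e)=1$ and $\varphi_i\in c_0(\Gamma)$ for every $i$, and $\varphi_i\to 1$ pointwise. - Weakly amenable: there are a constant $C<\infty$ and a net $\{\varphi_i\}$ of finitely supported functions on $\Gamma$ converging pointwise to $1$ with $\sup_i\|\varphi_i\|_{B_2}\le C$. - Weak Haagerup property: there are a constant $C<\infty$ and a net $\{\varphi_i\}$ in $B_2(\Gamma)\cap c_0(\Gamma)$ converging pointwise to $1$ with $\sup_i\|\varphi_i\|_{B_2}\le C$. - Approximation property (AP): there is a net $\{\varphi_i\}$ of finitely supported functions on $\Gamma$ with $\varphi_i\to 1$ in the $\sigma(B_2(\Gamma),Q(\Gamma))$-topology (the weak$^*$ topology). *)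

(* Defs.v *)
From HB Require Import structures.
From mathcomp Require Import all_boot all_order all_algebra finmap.
From mathcomp Require Import all_classical all_reals.
From mathcomp Require Import ereal topology normedtype sequences esum.
From mathcomp Require Import complex.
From mathcomp.analysis.showcase Require Import summability.

Set Implicit Arguments.
Unset Strict Implicit.
Unset Printing Implicit Defensive.
Import Order.TTheory GRing.Theory Num.Theory.
Import numFieldNormedType.Exports.
Local Open Scope classical_set_scope.
Local Open Scope complex_scope.
Local Open Scope ring_scope.

(** * Hilbert spaces and bounded operators *)

(* The norm of a normed module over R[i] takes its values in R[i]; [rnorm] is
   the same norm as an element of R. *)
Definition rnorm (R : realType) (V : normedModType R[i]) (x : V) : R :=
  complex.Re `|x|.

(* [inner] is linear in the first argument and conjugate-linear in the second
   one. *)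
HB.mixin Record isInnerProduct (R : realType) V of NormedModule R[i] V := {
  inner : {dot V for (@Num.conj R[i])};
  inner_norm : forall x : V, `|x| ^+ 2 = inner x x
}.

#[short(type="hilbertType")]
HB.structure Definition Hilbert (R : realType) :=
  {V of CompleteNormedModule R[i] V & isInnerProduct R V}.

(* Operators are plain functions [H -> H], so that equality of operators is
   equality of functions. *)
Section Operators.
Context {R : realType} {H : hilbertType R}.
Implicit Types (S T x y : H -> H) (M : set (H -> H)).

Definition bounded_operator T : Prop :=
  linear T /\ exists c : R, forall v, rnorm (T v) <= c * rnorm v.

Definition is_adjoint T S : Prop :=
  forall u v, inner (T u) v = inner u (S v).

(* The order of R[i] is such that [0 <= z] holds iff z is real and
   nonnegative. *)
Definition positive_operator T : Prop := forall v, 0 <= inner (T v) v.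

Definition commutant M : set (H -> H) :=
  [set T | bounded_operator T /\ forall S, M S -> T \o S = S \o T].

Record von_neumann_algebra M : Prop := {
  vna_bounded : M `<=` bounded_operator;
  vna_id : M idfun;
  vna_add : forall x y, M x -> M y -> M (x \+ y);
  vna_scale : forall (a : R[i]) x, M x -> M (a \*: x);
  vna_mul : forall x y, M x -> M y -> M (x \o y);
  vna_adjoint : forall x, M x -> exists2 y, M y & is_adjoint x y;
  vna_bicommutant : commutant (commutant M) = M
}.

Definition positive_part M : set (H -> H) :=
  [set x | M x /\ positive_operator x].

Definition projection T : Prop := T \o T = T /\ is_adjoint T T.

Record star_automorphism M (f : (H -> H) -> (H -> H)) : Prop := {
  staut_bij : set_bij M M f;
  staut_add : forall x y, M x -> M y -> f (x \+ y) = f x \+ f y;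
  staut_scale : forall (a : R[i]) x, M x -> f (a \*: x) = a \*: f x;
  staut_mul : forall x y, M x -> M y -> f (x \o y) = f x \o f y;
  staut_adjoint : forall x y, M x -> M y ->
    is_adjoint x y -> is_adjoint (f x) (f y)
}.

End Operators.

(** * Nets *)

Record directedSet := DirectedSet {
  dir_sort :> Type;
  dir_le : dir_sort -> dir_sort -> Prop;
  dir_inhabited : inhabited dir_sort;
  dir_refl : forall i, dir_le i i;
  dir_trans : forall i j k, dir_le i j -> dir_le j k -> dir_le i k;
  dir_upper : forall i j, exists k, dir_le i k /\ dir_le j k
}.

(* The filter of tails: a net [x : I -> T] converges to [l] iff
   [x @ tails I --> l]. *)
Definition tails (I : directedSet) : set_system I :=
  filter_from [set: I] (fun i => [set j | dir_le i j]).
Arguments tails : clear implicits.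

(** * Traces *)

Section Traces.
Context {R : realType} {H : hilbertType R}.
Implicit Types (x y : H -> H) (M : set (H -> H)).

(* A trace is a function on the positive part of M; the values of [Tr]
   elsewhere are irrelevant. Recall that [0 * +oo = 0] in [\bar R]. *)
Record faithful_normal_semifinite_trace M (Tr : (H -> H) -> \bar R) : Prop := {
  trace_ge0 : forall x, positive_part M x -> (0 <= Tr x)%E;
  trace_add : forall x y, positive_part M x -> positive_part M y ->
    Tr (x \+ y) = (Tr x + Tr y)%E;
  trace_scale : forall (r : R) x, 0 <= r -> positive_part M x ->
    Tr (r%:C \*: x) = (r%:E * Tr x)%E;
  trace_tracial : forall x y, M x -> M y -> is_adjoint x y ->
    Tr (y \o x) = Tr (x \o y);
  trace_faithful : forall x, positive_part M x -> Tr x = 0%E -> x = cst 0;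
  (* The supremum of a bounded increasing net is taken in the order of the
     positive part of M: [y] below is a least upper bound of the net [x]. *)
  trace_normal : forall (I : directedSet) (x : I -> H -> H) y,
    (forall i, positive_part M (x i)) ->
    (forall i j, dir_le i j -> positive_operator (x j \- x i)) ->
    positive_part M y ->
    (forall i, positive_operator (y \- x i)) ->
    (forall z, positive_part M z ->
       (forall i, positive_operator (z \- x i)) -> positive_operator (z \- y)) ->
    Tr y = ereal_sup (range (fun i => Tr (x i)));
  trace_semifinite : forall x, positive_part M x -> x <> cst 0 ->
    exists y, [/\ positive_part M y, y <> cst 0,
                  positive_operator (x \- y) & (Tr y < +oo)%E]
}.

End Traces.

(** * Actions and von Neumann equivalence *)

Section Actions.
Context {R : realType} {H : hilbertType R} {G : groupType}.
Implicit Types (M : set (H -> H)) (sigma : G -> (H -> H) -> (H -> H)).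

Record action_on M sigma : Prop := {
  action_aut : forall s, star_automorphism M (sigma s);
  action_one : forall x, M x -> sigma 1%g x = x;
  action_mul : forall s t x, M x -> sigma (s * t)%g x = sigma s (sigma t x)
}.

Definition trace_preserving M (Tr : (H -> H) -> \bar R) sigma : Prop :=
  forall s x, positive_part M x -> Tr (sigma s x) = Tr x.

(* [totally] is the filter of finite subsets directed by inclusion; the last
   conjunct says that the family (sigma s p)_s sums to 1 in the strong operator
   topology. *)
Definition fundamental_domain M sigma (p : H -> H) : Prop :=
  [/\ M p, projection p
    & forall v : H, partial_sum (fun s => sigma s p v) @ totally --> v].

End Actions.

(* [exists v : H, v != 0] says that M is nonzero, as M contains the identity. *)
Definition von_neumann_equivalent (R : realType) (Gam Lam : groupType) : Prop :=
  exists (H : hilbertType R) (M : set (H -> H)) (Tr : (H -> H) -> \bar R)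
         (sigma : Gam * Lam -> (H -> H) -> (H -> H)),
    [/\ von_neumann_algebra M /\ (exists v : H, v != 0),
        faithful_normal_semifinite_trace M Tr,
        action_on M sigma /\ trace_preserving M Tr sigma,
        exists2 p, fundamental_domain M (fun s => sigma (s, 1%g)) p
                 & (Tr p < +oo)%E
      & exists2 q, fundamental_domain M (fun t => sigma (1%g, t)) q
                 & (Tr q < +oo)%E].

(** * Herz-Schur multipliers *)

Section Multipliers.
Context {R : realType} {G : groupType}.
Implicit Types (phi u f : G -> R[i]).

Definition sup_norm (H : hilbertType R) (xi : G -> H) : \bar R :=
  ereal_sup (range (fun s => (rnorm (xi s))%:E)).

Definition herz_schur_rep phi (H : hilbertType R) (xi eta : G -> H) : Prop :=
  [/\ (sup_norm xi < +oo)%E, (sup_norm eta < +oo)%E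
    & forall s t, phi (t^-1 * s)%g = inner (xi s) (eta t)].

Definition B2 : set (G -> R[i]) :=
  [set phi | exists (H : hilbertType R) (xi eta : G -> H),
     herz_schur_rep phi xi eta].

(* [+oo] outside of B2. *)
Definition B2_norm phi : \bar R :=
  ereal_inf [set c | exists (H : hilbertType R) (xi eta : G -> H),
    herz_schur_rep phi xi eta /\ c = (sup_norm xi * sup_norm eta)%E].

Definition l1 : set (G -> R[i]) :=
  [set f | (\esum_(s in [set: G]) (complex.Re `|f s|)%:E < +oo)%E].

(* The unordered sum of f(s)u(s) over s; R[i]^o is R[i] as a normed module over
   itself. *)
Definition pairing f u : R[i] := sum (fun s => f s * u s : R[i]^o).

Definition Q_norm f : \bar R :=
  ereal_sup [set (complex.Re `|pairing f u|)%:E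
            | u in [set u | B2 u /\ (B2_norm u <= 1)%E]].

(* The completion Q(G) of l1 is represented by the Q_norm-Cauchy sequences of
   elements of l1. Two sequences with the same limit in Q(G) have the same
   [Q_pairing] with every element of B2, so no quotient is needed to define the
   topology sigma(B2, Q). *)
Definition Q_cauchy (f : nat -> G -> R[i]) : Prop :=
  (forall n, l1 (f n)) /\
  forall e : R, 0 < e -> exists N : nat, forall m n : nat,
    (N <= m)%N -> (N <= n)%N -> (Q_norm (f m \- f n)%R <= e%:E)%E.

Definition Q_pairing (f : nat -> G -> R[i]) u : R[i] :=
  lim ((fun n => pairing (f n) u : R[i]^o) @ \oo).

Definition weak_star_cvg (I : directedSet) (phi : I -> G -> R[i]) u : Prop :=
  forall f : nat -> G -> R[i], Q_cauchy f ->
    (fun i => Q_pairing f (phi i) : R[i]^o) @ tails I --> (Q_pairing f u : R[i]^o).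

Definition pointwise_cvg (I : directedSet) (phi : I -> G -> R[i]) u : Prop :=
  forall s, (fun i => phi i s : R[i]^o) @ tails I --> (u s : R[i]^o).

Definition c0 : set (G -> R[i]) :=
  [set phi | forall e : R, 0 < e ->
     finite_set [set s | e <= complex.Re `|phi s|]].

Definition finitely_supported phi : Prop := finite_set [set s | phi s != 0].

Definition positive_definite phi : Prop :=
  forall (n : nat) (s : 'I_n -> G) (c : 'I_n -> R[i]),
    0 <= \sum_(i < n) \sum_(j < n) c i * Num.conj (c j) * phi ((s j)^-1 * s i)%g.

End Multipliers.

(** * Approximation properties *)

Section Properties.
Context (R : realType) (G : groupType).

Definition haagerup : Prop :=
  exists (I : directedSet) (phi : I -> G -> R[i]),
    (forall i, [/\ positive_definite (phi i), phi i 1%g = 1 & c0 (phi i)]) /\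
    pointwise_cvg phi (cst 1).

Definition weakly_amenable : Prop :=
  exists (C : R) (I : directedSet) (phi : I -> G -> R[i]),
    [/\ forall i, finitely_supported (phi i),
        pointwise_cvg phi (cst 1)
      & forall i, (B2_norm (phi i) <= C%:E)%E].

Definition weak_haagerup : Prop :=
  exists (C : R) (I : directedSet) (phi : I -> G -> R[i]),
    [/\ forall i, B2 (phi i) /\ c0 (phi i),
        pointwise_cvg phi (cst 1)
      & forall i, (B2_norm (phi i) <= C%:E)%E].

Definition approximation_property : Prop :=
  exists (I : directedSet) (phi : I -> G -> R[i]),
    (forall i, finitely_supported (phi i)) /\ weak_star_cvg phi (cst 1).

End Properties.

(* Main.v *)
(** Let q be the fundamental domain of Lam, p that of Gam, and T = Tr q. For
    phi : Lam -> C put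

      hat phi (s) = T^-1 * sum_(u in Lam) phi(u) Tr(sigma_s(q) sigma_u(q)).

    As the translates of q form a partition of unity, this is the average of phi
    against a probability measure m_s on Lam. If phi(r^-1 t) = <xi(t), eta(r)>,
    then hat phi (s'^-1 s) = <Xi(s), Eta(s')> where

      Xi(s) = T^(-1/2) sum_t sigma_(s,t)(q) q (x) xi(t) in L^2(M, Tr) (x) K

    is an orthogonal sum of norm at most sup |xi|. Hence phi |-> hat phi preserves
    positive definiteness, does not increase the B2 norm, preserves pointwise
    convergence of bounded nets to 1, and is weak* continuous, being the adjoint
    of f |-> sum_s f(s) m_s. For phi = delta_t, hat phi is the coefficient
    s |-> T^-1 <sigma_s(sigma_t(q)), q> of a unitary representation of Gam; as
    the translates of p also form a partition of unity, both vectors are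
    approximated in L^2(M, Tr) by their compressions to finitely many translates
    of p, and the compressed coefficient is finitely supported. So hat phi is a
    B2-limit of finitely supported functions when phi is finitely supported, and
    is in c0 when phi is. This gives each property for Gam from the one for Lam,
    and the situation is symmetric.

    Instead of completing L^2(M, Tr) and forming tensor products, all Hilbert
    space vectors are produced in l^2(nat) by a Cholesky factorization of the
    positive definite kernel of their inner products. *)

Require Import Defs.
From HB Require Import structures.
From mathcomp Require Import all_boot all_order all_algebra finmap.
From mathcomp Require Import all_classical all_reals.
From mathcomp Require Import ereal topology normedtype sequences esum.
From mathcomp Require Import complex.
From mathcomp.analysis.showcase Require Import summability.
From mathcomp Require Import ring lra.

Set Implicit Arguments.
Unset Strict Implicit.
Unset Printing Implicit Defensive.
Import Order.TTheory GRing.Theory Num.Theory.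
Import numFieldNormedType.Exports.
Local Open Scope classical_set_scope.
Local Open Scope complex_scope.
Local Open Scope ring_scope.

(** * Complex numbers and semi-inner products *)

(** The Gram matrix of the vectors [Xi(s)] has to depend on [s'^-1 s] only, although [M] need not be
    commutative. Put [k = (s', r)^-1] and [(h, u) = k (s, t)]. Invariance of the trace turns the
    [(t, r)] term into [Tr(sigma_k(q) q sigma_(h,u)(q) sigma_k(q))]; the trace property merges the
    two outer factors into one [sigma_k(q)], and these sum to 1 over [r], which leaves
    [Tr(q sigma_(h,u)(q))]. The two sums are taken one after the other: the one over [t] gives a
    bounded linear functional, which is then passed through the partition of unity.

    The B2 norm is an infimum, so a bound on it yields an actual kernel only after some slack;
    constants such as [c + 1] absorb it, and where an exact bound is needed the slack [e] is
    arbitrary. Weak amenability and (AP) also ask for finite support, which is reached by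
    approximants of [hat phi] within [1/(n+1)], indexed by the product of the given net with the
    natural numbers. For (AP) this error is harmless since each element of Q is a bounded functional
    on B2. *)

Definition cabs (R : realType) (z : R[i]) : R := complex.Re `|z|.

Section ComplexModulus.
Context {R : realType}.
Implicit Types (z w : R[i]) (r : R).

Lemma cabsE z : `|z| = (cabs z)%:C.
Proof. by rewrite /cabs RRe_real //; exact: normr_real. Qed.

Lemma cabs_ge0 z : 0 <= cabs z.
Proof. by rewrite -ler0c -cabsE; exact: normr_ge0. Qed.

Lemma cabs0 : cabs (0 : R[i]) = 0.
Proof. by rewrite /cabs normr0. Qed.

Lemma cabs1 : cabs (1 : R[i]) = 1.
Proof. by rewrite /cabs normr1. Qed.

Lemma cabsM z w : cabs (z * w) = cabs z * cabs w.
Proof. by apply: complexI; rewrite rmorphM /= -!cabsE normrM. Qed.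

Lemma cabsN z : cabs (- z) = cabs z.
Proof. by rewrite /cabs normrN. Qed.

Lemma cabsB z w : cabs (z - w) = cabs (w - z).
Proof. by rewrite /cabs distrC. Qed.

Lemma cabsD z w : cabs (z + w) <= cabs z + cabs w.
Proof. by rewrite -lecR rmorphD /= -!cabsE ler_normD. Qed.

Lemma cabs_sum (I : Type) (s : seq I) (P : pred I) (F : I -> R[i]) :
  cabs (\sum_(i <- s | P i) F i) <= \sum_(i <- s | P i) cabs (F i).
Proof.
elim/big_rec2: _ => [|i x y _ le_xy]; first by rewrite cabs0.
by apply: le_trans (cabsD _ _) _; rewrite lerD2l.
Qed.

Lemma cabs_eq0 z : (cabs z == 0) = (z == 0).
Proof.
by rewrite -(inj_eq (@complexI _)) -cabsE normr_eq0.
Qed.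

Lemma cabs_real r : 0 <= r -> cabs r%:C = r.
Proof. by move=> r0; apply: complexI; rewrite -cabsE ger0_norm // ler0c. Qed.

Lemma cabs_realE r : cabs r%:C = `|r|.
Proof. by rewrite /cabs normc_def /= expr0n addr0 sqrtr_sqr. Qed.

Lemma cabs_conj z : cabs z^* = cabs z.
Proof. by rewrite /cabs norm_conjC. Qed.

Lemma cabs_sqr z : (cabs z ^+ 2)%:C = z * z^*.
Proof. by rewrite rmorphXn /= -cabsE normCK. Qed.

Lemma cabs_sqrE z : cabs z ^+ 2 = complex.Re z ^+ 2 + complex.Im z ^+ 2.
Proof. by apply: complexI; rewrite rmorphXn /= -cabsE add_Re2_Im2. Qed.

Lemma Re_le_cabs z : complex.Re z <= cabs z.
Proof.
apply: le_trans (ler_norm _) _.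
by rewrite -lecR -cabsE normc_ge_Re.
Qed.

Lemma cabs_le_ReIm z : cabs z <= `|complex.Re z| + `|complex.Im z|.
Proof.
rewrite -(@ler_pXn2r _ 2) ?nnegrE ?cabs_ge0 ?addr_ge0 //.
rewrite cabs_sqrE sqrrD !real_normK ?num_real //.
by rewrite -addrA lerD2l lerDr mulrn_wge0 // mulr_ge0.
Qed.

Lemma ge0_complexE z : 0 <= z -> z = (complex.Re z)%:C.
Proof. by move=> z0; rewrite RRe_real // ger0_real. Qed.

Lemma ge0_Re z : 0 <= z -> 0 <= complex.Re z.
Proof. by move=> z0; rewrite -ler0c -ge0_complexE. Qed.

Lemma ReD z w : complex.Re (z + w) = complex.Re z + complex.Re w.
Proof. by case: z w => [a b] [c d]. Qed.

Lemma ReN z : complex.Re (- z) = - complex.Re z.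
Proof. by case: z. Qed.

Lemma ReB z w : complex.Re (z - w) = complex.Re z - complex.Re w.
Proof. by rewrite ReD ReN. Qed.

Lemma Re_realM r z : complex.Re (r%:C * z) = r * complex.Re z.
Proof. by case: z => a b /=; rewrite mul0r subr0. Qed.

Lemma Re_sum (I : Type) (s : seq I) (P : pred I) (F : I -> R[i]) :
  complex.Re (\sum_(i <- s | P i) F i) = \sum_(i <- s | P i) complex.Re (F i).
Proof. exact: (big_morph _ ReD). Qed.

Lemma Re_conj z : complex.Re z^* = complex.Re z.
Proof. by case: z. Qed.

Lemma realcD r r' : (r + r')%:C = r%:C + r'%:C.
Proof. exact: rmorphD. Qed.

Lemma realcN r : (- r)%:C = - r%:C.
Proof. exact: rmorphN. Qed.

Lemma realcB r r' : (r - r')%:C = r%:C - r'%:C.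
Proof. exact: rmorphB. Qed.

Lemma realcM r r' : (r * r')%:C = r%:C * r'%:C.
Proof. exact: rmorphM. Qed.

Lemma realcV r : (r^-1)%:C = (r%:C)^-1.
Proof. exact: fmorphV. Qed.

Lemma realc_sum (I : Type) (s : seq I) (P : pred I) (F : I -> R) :
  (\sum_(i <- s | P i) F i)%:C = \sum_(i <- s | P i) (F i)%:C.
Proof. exact: rmorph_sum. Qed.

Lemma Re_mulconj z : complex.Re (z * z^*) = cabs z ^+ 2.
Proof. by rewrite -cabs_sqr. Qed.

Lemma conj_real r : (r%:C)^* = r%:C.
Proof. by apply: conj_Creal; apply/complex_realP; exists r. Qed.

End ComplexModulus.

Section RealNorm.
Context {R : realType} {V : normedModType R[i]}.
Implicit Types (x y : V).

Lemma rnormE x : `|x| = (rnorm x)%:C.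
Proof. by rewrite /rnorm RRe_real //; exact: normr_real. Qed.

Lemma rnorm_ge0 x : 0 <= rnorm x.
Proof. by rewrite -ler0c -rnormE; exact: normr_ge0. Qed.

Lemma rnormD x y : rnorm (x + y) <= rnorm x + rnorm y.
Proof. by rewrite -lecR rmorphD /= -!rnormE ler_normD. Qed.

Lemma rnormN x : rnorm (- x) = rnorm x.
Proof. by rewrite /rnorm normrN. Qed.

Lemma rnormB x y : rnorm (x - y) = rnorm (y - x).
Proof. by rewrite /rnorm distrC. Qed.

Lemma rnormZ a x : rnorm (a *: x) = cabs a * rnorm x.
Proof. by apply: complexI; rewrite rmorphM /= -cabsE -!rnormE normrZ. Qed.

End RealNorm.

(** Neither definiteness nor a topology is required: the square-integrable operators are used as a
    bare module with such a form, without completion. *)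
Record semi_inner (R : realType) (V : lmodType R[i]) (f : V -> V -> R[i]) :
    Prop := {
  ipD : forall x y z, f (x + y) z = f x z + f y z;
  ipZ : forall a x z, f (a *: x) z = a * f x z;
  ipC : forall x y, f y x = (f x y)^*;
  ip_ge0 : forall x, 0 <= f x x }.

Definition sqn (R : realType) (V : lmodType R[i]) (f : V -> V -> R[i]) x : R :=
  complex.Re (f x x).

Definition ipnorm (R : realType) (V : lmodType R[i]) (f : V -> V -> R[i]) x : R :=
  Num.sqrt (sqn f x).

Section SemiInner.
Context {R : realType} {V : lmodType R[i]} {f : V -> V -> R[i]}.
Hypothesis fP : semi_inner f.
Implicit Types (x y z : V) (a : R[i]).
Local Notation n2 := (sqn f).

Lemma ipDr x y z : f x (y + z) = f x y + f x z.
Proof. by rewrite (ipC fP) (ipD fP) rmorphD /= -!(ipC fP). Qed.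

Lemma ipZr a x y : f x (a *: y) = a^* * f x y.
Proof. by rewrite (ipC fP) (ipZ fP) rmorphM /= -(ipC fP). Qed.

Lemma ip0l y : f 0 y = 0.
Proof. by rewrite -(scale0r 0) (ipZ fP) mul0r. Qed.

Lemma ip0r y : f y 0 = 0.
Proof. by rewrite (ipC fP) ip0l rmorph0. Qed.

Lemma ipN x y : f (- x) y = - f x y.
Proof. by rewrite -scaleN1r (ipZ fP) mulN1r. Qed.

Lemma ipNr x y : f x (- y) = - f x y.
Proof. by rewrite (ipC fP) ipN rmorphN /= -(ipC fP). Qed.

Lemma ipB x y z : f (x - y) z = f x z - f y z.
Proof. by rewrite (ipD fP) ipN. Qed.

Lemma ipBr x y z : f x (y - z) = f x y - f x z.
Proof. by rewrite ipDr ipNr. Qed.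

Lemma ip_suml (I : Type) (s : seq I) (P : pred I) (F : I -> V) y :
  f (\sum_(i <- s | P i) F i) y = \sum_(i <- s | P i) f (F i) y.
Proof. by apply: (big_morph (f ^~ y)) => [u v|]; rewrite ?(ipD fP) ?ip0l. Qed.

Lemma ip_sumr (I : Type) (s : seq I) (P : pred I) (F : I -> V) y :
  f y (\sum_(i <- s | P i) F i) = \sum_(i <- s | P i) f y (F i).
Proof. by apply: (big_morph (f y)) => [u v|]; rewrite ?ipDr ?ip0r. Qed.

Lemma sqnE x : f x x = (n2 x)%:C.
Proof. exact: ge0_complexE (ip_ge0 fP x). Qed.

Lemma sqn_ge0 x : 0 <= n2 x.
Proof. exact: ge0_Re (ip_ge0 fP x). Qed.

Lemma sqnZ a x : n2 (a *: x) = cabs a ^+ 2 * n2 x.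
Proof.
apply: complexI; rewrite rmorphM /= cabs_sqr -!sqnE (ipZ fP) ipZr; ring.
Qed.

Lemma sqnD x y : n2 (x + y) = n2 x + n2 y + 2 * complex.Re (f x y).
Proof.
rewrite {1}/sqn !(ipD fP) !ipDr !ReD (ipC fP x y) Re_conj /sqn; ring.
Qed.

(** Positivity is tested on [x - s f(x, y) y] with [s] real. Null vectors [y] may be nonzero, so
    they form a separate case. *)
Lemma cauchy_schwarz_sqr x y : cabs (f x y) ^+ 2 <= n2 x * n2 y.
Proof.
set A := cabs (f x y) ^+ 2.
have key s : 0 <= n2 x - 2 * s * A + s ^+ 2 * A * n2 y.
  have := sqn_ge0 (x + (- s%:C * f x y) *: y).
  have -> : n2 (x + (- s%:C * f x y) *: y)
      = n2 x - 2 * s * A + s ^+ 2 * A * n2 y.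
    rewrite sqnD sqnZ ipZr.
    have -> : (- s%:C * f x y)^* * f x y = (- (s * A))%:C.
      rewrite realcN realcM /A cabs_sqr rmorphM rmorphN /= conj_real; ring.
    have -> : cabs (- s%:C * f x y) ^+ 2 = s ^+ 2 * A.
      rewrite cabsM cabsN exprMn -/A; congr (_ * _).
      by rewrite cabs_sqrE /= expr0n addr0.
    rewrite /=; ring.
  by [].
have A0 : 0 <= A by rewrite /A sqr_ge0.
have [Y0|Yn0] := eqVneq (n2 y) 0.
  rewrite Y0 mulr0 leNgt; apply/negP => Ap.
  (* For [n2 y = 0] the expression in [key] is affine in [s]; this [s] gives it the value [-1]. *)
  have := key ((n2 x + 1) / (2 * A)); rewrite Y0 mulr0 addr0.
  have -> : 2 * ((n2 x + 1) / (2 * A)) * A = n2 x + 1.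
    by field; rewrite gt_eqF.
  lra.
have Yp : 0 < n2 y by rewrite lt_neqAle eq_sym Yn0 sqn_ge0.
(* The minimizer of the quadratic polynomial in [s]. *)
have := key (n2 y)^-1.
have -> : n2 x - 2 * (n2 y)^-1 * A + (n2 y)^-1 ^+ 2 * A * n2 y
   = (n2 x * n2 y - A) / n2 y by field.
by rewrite pmulr_lge0 ?invr_gt0 // subr_ge0.
Qed.

Local Notation ipnorm := (ipnorm f).

Lemma ipnorm_ge0 x : 0 <= ipnorm x.
Proof. exact: sqrtr_ge0. Qed.

Lemma ipnorm_sqr x : ipnorm x ^+ 2 = n2 x.
Proof. by rewrite sqr_sqrtr ?sqn_ge0. Qed.

Lemma cauchy_schwarz x y : cabs (f x y) <= ipnorm x * ipnorm y.
Proof.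
rewrite -(@ler_pXn2r _ 2) ?nnegrE ?cabs_ge0 ?mulr_ge0 ?ipnorm_ge0 //.
by rewrite exprMn !ipnorm_sqr cauchy_schwarz_sqr.
Qed.

Lemma ipnormD x y : ipnorm (x + y) <= ipnorm x + ipnorm y.
Proof.
rewrite -(@ler_pXn2r _ 2) ?nnegrE ?addr_ge0 ?ipnorm_ge0 //.
rewrite sqrrD !ipnorm_sqr sqnD.
have := le_trans (Re_le_cabs _) (cauchy_schwarz x y).
lra.
Qed.

Lemma ipnormZ a x : ipnorm (a *: x) = cabs a * ipnorm x.
Proof. by rewrite /ipnorm sqnZ sqrtrM ?sqr_ge0 // sqrtr_sqr ger0_norm ?cabs_ge0. Qed.

Lemma ip_sqn0 x y : n2 y = 0 -> f x y = 0.
Proof.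
move=> y0; apply/eqP; rewrite -cabs_eq0 -sqrf_eq0 eq_le sqr_ge0 andbT.
by have := cauchy_schwarz_sqr x y; rewrite y0 mulr0.
Qed.

End SemiInner.

(** * Positive definite kernels *)

Definition pd_kernel (R : realType) (T : Type) (K : T -> T -> R[i]) : Prop :=
  forall (n : nat) (s : 'I_n -> T) (c : 'I_n -> R[i]),
    0 <= \sum_(i < n) \sum_(j < n) c i * (c j)^* * K (s i) (s j).

Section PositiveDefiniteKernels.
Context {R : realType}.
Local Notation C := R[i].

(** A list of weighted points, rather than a family over an ordinal, so that one more point can be
    consed on, as the Schur complement requires. *)
Definition kernel_form (T : Type) (K : T -> T -> C) (l : seq (C * T)) : C :=
  \sum_(a <- l) \sum_(b <- l) a.1 * (b.1)^* * K a.2 b.2.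

Lemma pd_kernel_form (T : Type) (K : T -> T -> C) l :
  pd_kernel K -> 0 <= kernel_form K l.
Proof.
move=> /(_ (size l) (fun i => (tnth (in_tuple l) i).2)
  (fun i => (tnth (in_tuple l) i).1)); congr (_ <= _).
rewrite /kernel_form [in RHS]big_tnth; apply: eq_bigr => i _.
by rewrite [RHS]big_tnth.
Qed.

Lemma form_pd_kernel (T : Type) (K : T -> T -> C) :
  (forall l, 0 <= kernel_form K l) -> pd_kernel K.
Proof.
move=> h n s c; have := h [seq (c i, s i) | i <- enum 'I_n].
rewrite /kernel_form big_map big_enum /=.
by under eq_bigr do rewrite big_map big_enum /=.
Qed.

Lemma gram_pd (T : Type) (V : lmodType C) (f : V -> V -> C) (v : T -> V) :
  semi_inner f -> pd_kernel (fun x y => f (v x) (v y)).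
Proof.
move=> fP n s c; have := ip_ge0 fP (\sum_(i < n) c i *: v (s i)).
rewrite (ip_suml fP); under eq_bigr do rewrite (ip_sumr fP).
under eq_bigr do under eq_bigr do rewrite (ipZ fP) (ipZr fP) mulrA.
by [].
Qed.

Lemma pd_kernelD (T : Type) (K K' : T -> T -> C) :
  pd_kernel K -> pd_kernel K' -> pd_kernel (fun x y => K x y + K' x y).
Proof.
move=> hK hK' n s c; have := addr_ge0 (hK n s c) (hK' n s c).
rewrite -big_split /=; under eq_bigr do rewrite -big_split /=.
by under eq_bigr do under eq_bigr do rewrite -mulrDr.
Qed.

Lemma pd_kernel_comp (T U : Type) (g : U -> T) (K : T -> T -> C) :
  pd_kernel K -> pd_kernel (fun x y => K (g x) (g y)).
Proof. by move=> hK n s c; exact: (hK n (g \o s) c). Qed.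

Lemma pd_kernel_diag (T : Type) (K : T -> T -> C) x : pd_kernel K -> 0 <= K x x.
Proof.
move=> hK; have := pd_kernel_form [:: (1, x)] hK.
by rewrite /kernel_form !big_seq1 /= rmorph1 !mul1r.
Qed.

Lemma kernel_form2 (T : Type) (K : T -> T -> C) a x b y :
  kernel_form K [:: (a, x); (b, y)] =
  a * a^* * K x x + b * b^* * K y y + (a * b^* * K x y + b * a^* * K y x).
Proof. rewrite /kernel_form !big_cons !big_nil /=; ring. Qed.

(** Over the complex numbers positivity forces symmetry: the form at coefficients [(1, 1)] must be
    real, which makes the imaginary parts opposite, and at [(1, i)], which makes the real parts
    equal. *)
Lemma pd_kernel_herm (T : Type) (K : T -> T -> C) x y :
  pd_kernel K -> K y x = (K x y)^*.
Proof.
move=> hK.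
have hx := ge0_complexE (pd_kernel_diag x hK).
have hy := ge0_complexE (pd_kernel_diag y hK).
have := pd_kernel_form [:: (1, x); (1, y)] hK.
have := pd_kernel_form [:: (1, x); ('i%C, y)] hK.
rewrite !kernel_form2 hx hy.
case: (K x y) (K y x) => [a b] [c d].
rewrite !lecE /= => /andP[/eqP h1 _] /andP[/eqP h2 _].
apply/eqP; rewrite eq_complex /=; apply/andP; split; apply/eqP; lra.
Qed.

(** The null case of Cauchy-Schwarz again, now for a kernel without underlying vectors: the form
    would be affine in a real parameter [s], hence negative somewhere. *)
Lemma pd_kernel_null (T : Type) (K : T -> T -> C) x y :
  pd_kernel K -> K x x = 0 -> K x y = 0.
Proof.
move=> hK xx0; apply/eqP; rewrite -cabs_eq0 -sqrf_eq0 eq_le sqr_ge0 andbT.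
set A := cabs _ ^+ 2; rewrite leNgt; apply/negP => A0.
set Y := complex.Re (K y y).
have key (s : R) : 0 <= Y - 2 * s * A.
  have := pd_kernel_form [:: (- s%:C * (K x y)^*, x); (1, y)] hK.
  rewrite kernel_form2 xx0 mulr0 rmorph1 add0r !mul1r mulr1.
  rewrite (pd_kernel_herm x y hK) (ge0_complexE (pd_kernel_diag y hK)) -/Y.
  have -> : Y%:C + (- s%:C * (K x y)^* * K x y
      + (- s%:C * (K x y)^*)^* * (K x y)^*) = (Y - 2 * s * A)%:C.
    rewrite realcB realcM /A cabs_sqr realcM rmorphM rmorphN /= conj_real conjCK.
    by rewrite (_ : 2%:C = 2%:R) ?rmorph_nat //; ring.
  by rewrite ler0c.
have := key ((Y + 1) / (2 * A)).
have -> : 2 * ((Y + 1) / (2 * A)) * A = Y + 1 by field; rewrite gt_eqF.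
lra.
Qed.

(* Equal to K when K k k = 0, since x / 0 = 0. *)
Definition schur_complement (T : Type) (K : T -> T -> C) k : T -> T -> C :=
  fun x y => K x y - K x k * K k y / K k k.

(** The form of the complement at [l] equals the form of [K] at [l] enlarged by the point [k] with a
    suitable coefficient. *)
Lemma schur_complement_pd (T : Type) (K : T -> T -> C) k :
  pd_kernel K -> pd_kernel (schur_complement K k).
Proof.
move=> hK; apply: form_pd_kernel => l.
have [k0|kn0] := eqVneq (K k k) 0.
  have -> : kernel_form (schur_complement K k) l = kernel_form K l.
    apply: eq_bigr => a _; apply: eq_bigr => b _.
    by rewrite /schur_complement k0 invr0 mulr0 subr0.
  exact: pd_kernel_form.
pose S := \sum_(a <- l) a.1 * K a.2 k.
have SJ : \sum_(b <- l) (b.1)^* * K k b.2 = S^*.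
  rewrite rmorph_sum; apply: eq_bigr => b _.
  by rewrite rmorphM /= -(pd_kernel_herm _ _ hK).
have kJ : (K k k)^* = K k k by rewrite -(pd_kernel_herm _ _ hK).
(* This coefficient minimizes the enlarged form; completing the square leaves the form at [l] minus
   [|S|^2 / K k k]. *)
have := pd_kernel_form ((- S / K k k, k) :: l) hK.
rewrite /kernel_form big_cons /= big_cons /=.
under [X in _ + _ + X]eq_bigr do rewrite big_cons /=.
rewrite big_split /=.
have -> : \sum_(b <- l) - S / K k k * (b.1)^* * K k b.2
    = - S / K k k * S^*.
  by rewrite -SJ mulr_sumr; apply: eq_bigr => b _; rewrite mulrA.
have -> : \sum_(a <- l) a.1 * (- S / K k k)^* * K a.2 k
    = (- S / K k k)^* * S.
  by rewrite mulr_sumr; apply: eq_bigr => b _; rewrite mulrCA mulrA.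
have -> : \sum_(a <- l) \sum_(b <- l) a.1 * (b.1)^* * schur_complement K k a.2 b.2
   = \sum_(a <- l) \sum_(b <- l) a.1 * (b.1)^* * K a.2 b.2 - S * S^* / K k k.
  rewrite -SJ mulr_suml mulr_suml -sumrB; apply: eq_bigr => a _.
  rewrite mulr_sumr mulr_suml -sumrB; apply: eq_bigr => b _.
  rewrite /schur_complement; field.
  by [].
rewrite rmorphM rmorphN fmorphV /= kJ => h; apply: le_trans h _.
by rewrite le_eqVlt; apply/orP; left; apply/eqP; field.
Qed.

Lemma schur_complement_pivot (T : Type) (K : T -> T -> C) k x :
  pd_kernel K -> schur_complement K k k x = 0.
Proof.
move=> hK; rewrite /schur_complement.
have [k0|kn0] := eqVneq (K k k) 0; last by field.
by rewrite (pd_kernel_null x hK k0) mulr0 mul0r subrr.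
Qed.

(** * Cholesky factorization of a kernel on the natural numbers *)

Section Cholesky.
Variable K : nat -> nat -> C.
Hypothesis hK : pd_kernel K.

Fixpoint schur_iter n : nat -> nat -> C :=
  if n is m.+1 then schur_complement (schur_iter m) m else K.

(** A vanishing pivot produces a zero column, since [x / 0 = 0]; this is consistent because a null
    pivot has a null row. *)
Definition cholesky n j : C :=
  schur_iter j n j / (Num.sqrt (complex.Re (schur_iter j j j)))%:C.

Lemma schur_iter_pd n : pd_kernel (schur_iter n).
Proof. by elim: n => //= n; exact: schur_complement_pd. Qed.

Lemma schur_iter0 n m x : (m < n)%N -> schur_iter n m x = 0.
Proof.
elim: n x => // n IHn x; rewrite ltnS leq_eqVlt => /orP[/eqP ->|mn] /=.
  by rewrite schur_complement_pivot //; exact: schur_iter_pd.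
by rewrite /schur_complement !IHn // !mul0r subrr.
Qed.

Lemma cholesky0 n j : (n < j)%N -> cholesky n j = 0.
Proof. by move=> nj; rewrite /cholesky schur_iter0 // mul0r. Qed.

(** The elimination steps telescope, and the remainder [schur_iter N m n] vanishes because row
    [m < N] has already been eliminated. The factorization therefore needs no limit although [K] is
    infinite. *)
Lemma choleskyE m n N : (m < N)%N ->
  K m n = \sum_(j < N) cholesky m j * (cholesky n j)^*.
Proof.
move=> mN.
suff -> : K m n = \sum_(j < N) cholesky m j * (cholesky n j)^* + schur_iter N m n.
  by rewrite schur_iter0 // addr0.
elim: N {mN} => [|N ->]; first by rewrite big_ord0 add0r.
rewrite big_ord_recr /= -addrA; congr (_ + _).
rewrite /schur_complement addrC.
have hN := schur_iter_pd N.
have dN := pd_kernel_diag N hN.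
suff -> : cholesky m N * (cholesky n N)^*
   = schur_iter N m N * schur_iter N N n / schur_iter N N N by rewrite subrK.
rewrite /cholesky rmorphM fmorphV /= conj_real -(pd_kernel_herm _ _ hN).
rewrite [X in _ = _ / X](ge0_complexE dN).
rewrite -[in RHS](sqr_sqrtr (ge0_Re dN)) expr2 realcM invfM; ring.
Qed.

End Cholesky.
End PositiveDefiniteKernels.

(** * Convergence *)

Section Convergence.
Context {R : realType}.

Lemma cvg_rnormP {V : normedModType R[i]} {T : Type} {F : set_system T}
    {FF : Filter F} (f : T -> V) (l : V) :
  f @ F --> l <-> forall e : R, 0 < e -> \forall x \near F, rnorm (l - f x) < e.
Proof.
split=> [/cvgrPdist_lt h e e0|h].
  have /h : 0 < e%:C by rewrite ltcR.
  by apply: filterS => x; rewrite rnormE ltcR.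
apply/cvgrPdist_lt => e e0.
have eR := ge0_complexE (ltW e0).
have /h : 0 < complex.Re e by rewrite -ltcR -eR.
by apply: filterS => x; rewrite -ltcR -rnormE -eR.
Qed.

Lemma rnormo (z : R[i]) : rnorm (z : R[i]^o) = cabs z.
Proof. by []. Qed.

Lemma cvg_cabsP {T : Type} {F : set_system T} {FF : Filter F} (f : T -> R[i]) l :
  (f : T -> R[i]^o) @ F --> (l : R[i]^o) <->
  forall e : R, 0 < e -> \forall x \near F, cabs (l - f x) < e.
Proof. exact: cvg_rnormP. Qed.

Lemma complex_cauchy_cvg {T : Type} {F : set_system T} {FF : ProperFilter F}
    (f : T -> R[i]) :
  (forall e : R, 0 < e -> exists2 A, F A &
     forall x y, A x -> A y -> cabs (f x - f y) < e) ->
  exists l, (f : T -> R[i]^o) @ F --> (l : R[i]^o).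
Proof.
move=> h.
have real_part (g : R[i] -> R) : (forall z w, `|g z - g w| <= cabs (z - w)) ->
    exists l : R, (g \o f) @ F --> l.
  move=> hg; apply/cvg_ex; apply: cauchy_cvg; apply/cauchy_ballP => e e0.
  have [A FA hA] := h e e0.
  exists (g @` (f @` A), g @` (f @` A)) => /=.
    suff FA' : F (fun x => (g @` (f @` A)) (g (f x))) by split.
    by apply: filterS FA => x Ax /=; exists (f x) => //; exists x.
  move=> [a b] /= [[_ [x Ax <-] <-] [_ [y Ay <-] <-]].
  rewrite /ball /= /ball_ /=.
  by apply: le_lt_trans (hg _ _) _; apply: hA.
have [|a ha] := real_part (@complex.Re R).
  move=> z w; rewrite -ReB -(@ler_pXn2r _ 2) ?nnegrE ?cabs_ge0 //.
  by rewrite cabs_sqrE real_normK ?num_real // lerDl sqr_ge0.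
have [|b hb] := real_part (@complex.Im R).
  move=> z w; rewrite (_ : complex.Im z - complex.Im w = complex.Im (z - w)).
    rewrite -(@ler_pXn2r _ 2) ?nnegrE ?cabs_ge0 //.
    by rewrite cabs_sqrE real_normK ?num_real // lerDr sqr_ge0.
  by case: z w => [? ?] [? ?].
exists (a +i* b)%C; apply/cvg_cabsP => e e0.
have e2 : 0 < e / 2 by rewrite divr_gt0.
move/cvgrPdist_lt : ha => /(_ _ e2) ha; move/cvgrPdist_lt : hb => /(_ _ e2) hb.
near=> x; apply: le_lt_trans (cabs_le_ReIm _) _.
have xa : `|a - complex.Re (f x)| < e / 2 by near: x.
have xb : `|b - complex.Im (f x)| < e / 2 by near: x.
rewrite [e]splitr ltrD //.
  by move: xa => /=; case: (f x).
by move: xb => /=; case: (f x).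
Unshelve. all: by end_near. Qed.

Lemma cvg_le_rnorm {V : normedModType R[i]} {T : Type} {F : set_system T}
    {FF : ProperFilter F} (f : T -> V) (l : V) (c : R) :
  f @ F --> l -> (\forall x \near F, rnorm (f x) <= c) -> rnorm l <= c.
Proof.
move=> /cvg_rnormP fl fc; apply/ler_addgt0Pr => e e0.
near F => x.
rewrite -[l](subrK (f x)); apply: le_trans (rnormD _ _) _.
rewrite addrC lerD //; first by near: x.
by apply/ltW; near: x; exact: fl.
Unshelve. all: by end_near. Qed.

Lemma cvg_rnorm {V : normedModType R[i]} {T : Type} {F : set_system T}
    {FF : Filter F} (f : T -> V) (l : V) :
  f @ F --> l -> (fun x => rnorm (f x)) @ F --> rnorm l.
Proof.
move=> /cvg_rnormP fl; apply/cvgrPdist_lt => e e0.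
have := fl e e0; apply: filterS => x; apply: le_lt_trans.
rewrite ler_distl; apply/andP; split.
  by rewrite lerBlDr; have := rnormD (f x - l) l; rewrite subrK rnormB addrC.
by have := rnormD (l - f x) (f x); rewrite subrK addrC.
Qed.

Lemma Re_cvg {T : Type} {F : set_system T} {FF : Filter F} (f : T -> R[i]) l :
  (f : T -> R[i]^o) @ F --> (l : R[i]^o) ->
  (fun x => complex.Re (f x)) @ F --> complex.Re l.
Proof.
move=> /cvg_cabsP fl; apply/cvgrPdist_lt => e e0.
have := fl e e0; apply: filterS => x; apply: le_lt_trans.
by rewrite -ReB -lecR -cabsE normc_ge_Re.
Qed.

Lemma real_cvg {T : Type} {F : set_system T} {FF : Filter F} (f : T -> R)
    (l : R) : f @ F --> l ->
  (fun x => (f x)%:C : R[i]^o) @ F --> (l%:C : R[i]^o).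
Proof.
move=> /cvgrPdist_lt fl; apply/cvg_cabsP => e e0.
have := fl e e0; apply: filterS => x.
by rewrite -realcB cabs_realE.
Qed.

Lemma cvg_ext {U : topologicalType} {T : Type} {F : set_system T}
    {FF : Filter F} (f g : T -> U) (l : U) :
  f =1 g -> f @ F --> l -> g @ F --> l.
Proof. by move=> /funext ->. Qed.

Lemma cvg_extc {T : Type} {F : set_system T} {FF : Filter F}
    (f g : T -> R[i]) (l : R[i]) : f =1 g ->
  (f : T -> R[i]^o) @ F --> (l : R[i]^o) -> (g : T -> R[i]^o) @ F --> (l : R[i]^o).
Proof. by move=> /funext ->. Qed.

Lemma cvg_addf {V : normedModType R[i]} {T : Type} {F : set_system T}
    {FF : Filter F} (f g : T -> V) (a b : V) :
  f @ F --> a -> g @ F --> b -> (fun x => f x + g x) @ F --> a + b.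
Proof. exact: cvgD. Qed.

Lemma cvg_subf {V : normedModType R[i]} {T : Type} {F : set_system T}
    {FF : Filter F} (f g : T -> V) (a b : V) :
  f @ F --> a -> g @ F --> b -> (fun x => f x - g x) @ F --> a - b.
Proof. exact: cvgB. Qed.

Lemma cvg_scalef {V : normedModType R[i]} {T : Type} {F : set_system T}
    {FF : Filter F} (k : R[i]) (f : T -> V) (a : V) :
  f @ F --> a -> (fun x => k *: f x) @ F --> k *: a.
Proof. by move=> fa; apply: cvgZ => //; exact: cvg_cst. Qed.

Lemma cvg_mulf {T : Type} {F : set_system T}
    {FF : Filter F} (k : R[i]) (f : T -> R[i]) (a : R[i]) :
  (f : T -> R[i]^o) @ F --> (a : R[i]^o) ->
  (fun x => k * f x : R[i]^o) @ F --> (k * a : R[i]^o).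
Proof. by move=> fa; apply: (@cvg_scalef R[i]^o). Qed.

Lemma cvg_conjf {T : Type} {F : set_system T}
    {FF : Filter F} (f : T -> R[i]) (a : R[i]) :
  (f : T -> R[i]^o) @ F --> (a : R[i]^o) ->
  (fun x => (f x)^* : R[i]^o) @ F --> (a^* : R[i]^o).
Proof.
move=> /cvg_cabsP fa; apply/cvg_cabsP => e e0.
by have := fa e e0; apply: filterS => x; rewrite -rmorphB cabs_conj.
Qed.

Lemma cvg_sumf {K : numFieldType} {V : normedModType K} {T : Type}
    {F : set_system T} {FF : Filter F} (I : Type) (s : seq I) (f : I -> T -> V)
    (l : I -> V) :
  (forall i, f i @ F --> l i) ->
  (fun x => \sum_(i <- s) f i x) @ F --> \sum_(i <- s) l i.
Proof.
move=> fl; elim: s => [|i s IHs].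
  rewrite big_nil (_ : (fun x => _) = cst 0); first exact: cvg_cst.
  by apply/funext => x; rewrite big_nil.
rewrite big_cons (_ : (fun x => _) = f i \+ (fun x => \sum_(i <- s) f i x)).
  exact: cvgD.
by apply/funext => x; rewrite big_cons.
Qed.

Lemma cvg_uniq {V : normedModType R[i]} {T : Type} {F : set_system T}
    {FF : ProperFilter F} (f : T -> V) (a b : V) :
  f @ F --> a -> f @ F --> b -> a = b.
Proof. exact: (cvg_unique (@norm_hausdorff _ V)). Qed.

End Convergence.

(** * The Hilbert space of square-summable sequences *)

Section SquareSummable.
Variable R : realType.
Local Notation C := R[i].

Definition square_summable : {pred nat -> C^o} :=
  fun a => `[< exists M : R, forall n, \sum_(i < n) cabs (a i) ^+ 2 <= M >].

Lemma square_summable_submod : submod_closed square_summable.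
Proof.
split=> [|c a b].
  apply/asboolP; exists 0 => n; rewrite big1 // => i _.
  by rewrite /= cabs0 expr0n.
move=> /asboolP[A hA] /asboolP[B hB]; apply/asboolP.
exists (2 * (cabs c ^+ 2 * A) + 2 * B) => n.
apply: (@le_trans _ _ (\sum_(i < n) (2 * (cabs c ^+ 2 * cabs (a i) ^+ 2)
    + 2 * cabs (b i) ^+ 2))).
  apply: ler_sum => i _; rewrite -exprMn -cabsM.
  apply: (@le_trans _ _ ((cabs (c * a i) + cabs (b i)) ^+ 2)).
    rewrite ler_pXn2r ?nnegrE ?cabs_ge0 ?addr_ge0 ?cabs_ge0 //.
    exact: cabsD.
  have := sqr_ge0 (cabs (c * a i) - cabs (b i)); nra.
rewrite big_split /= -!mulr_sumr.
apply: lerD; rewrite ler_pM2l ?ltr0n //; last exact: hB.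
by apply: ler_wpM2l; [exact: sqr_ge0|exact: hA].
Qed.

HB.instance Definition _ :=
  GRing.isSubmodClosed.Build C (nat -> C^o) square_summable
    square_summable_submod.

Record ell2 := Ell2 {
  ell2_val : nat -> C^o;
  ell2P : ell2_val \in square_summable }.

HB.instance Definition _ := [isSub for ell2_val].
HB.instance Definition _ := [Choice of ell2 by <:].
HB.instance Definition _ := [SubChoice_isSubLmodule of ell2 by <:].

Coercion ell2_val : ell2 >-> Funclass.

Definition ell2_partial (n : nat) (a b : ell2) : C :=
  \sum_(i < n) a i * (b i)^*.

Lemma ell2_bound (a : ell2) :
  exists M : R, forall n, \sum_(i < n) cabs (a i) ^+ 2 <= M.
Proof. exact/asboolP/ell2P. Qed.

Lemma ell2DE (a b : ell2) n : (a + b) n = a n + b n.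
Proof. by []. Qed.

Lemma ell2ZE c (a : ell2) n : (c *: a) n = c * a n.
Proof. by []. Qed.

(** Since [|a b| <= |a|^2 + |b|^2], the increments are dominated by those of [u], which is monotone
    and bounded. *)
Lemma ell2_partial_cvg (a b : ell2) : exists l : C,
  (fun n => ell2_partial n a b : C^o) @ \oo --> (l : C^o).
Proof.
have [A hA] := ell2_bound a; have [B hB] := ell2_bound b.
pose u n : R := \sum_(i < n) (cabs (a i) ^+ 2 + cabs (b i) ^+ 2).
have u_ub n : u n <= A + B by rewrite /u big_split /=; apply: lerD; [exact: hA|exact: hB].
have u_nd : nondecreasing_seq u.
  apply/nondecreasing_seqP => n; rewrite /u big_ord_recr /= lerDl.
  by rewrite addr_ge0 ?sqr_ge0.
have u_cvg : cvgn u.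
  by apply: nondecreasing_is_cvgn => //; exists (A + B) => _ [n _ <-].
have u_lim n : u n <= limn u by exact: nondecreasing_cvgn_le.
have step n k : cabs (ell2_partial (n + k) a b - ell2_partial n a b)
    <= u (n + k)%N - u n.
  elim: k => [|k IHk]; first by rewrite addn0 !subrr cabs0.
  rewrite addnS /ell2_partial /u !big_ord_recr /= -/(ell2_partial _ _ _).
  rewrite -/(u _) ![_ + _ - _]addrAC.
  apply: le_trans (cabsD _ _) _; rewrite lerD //.
  rewrite cabsM cabs_conj.
  have := sqr_ge0 (cabs (a (n + k)%N) - cabs (b (n + k)%N)).
  have := cabs_ge0 (a (n + k)%N); have := cabs_ge0 (b (n + k)%N); nra.
apply: complex_cauchy_cvg => e e0.
have e2 : 0 < e / 2 by rewrite divr_gt0.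
have [N _ hN] : \forall n \near \oo, `|limn u - u n| < e / 2.
  by move/cvgrPdist_lt : u_cvg => /(_ _ e2).
have far n : (N <= n)%N ->
    cabs (ell2_partial n a b - ell2_partial N a b) < e / 2.
  move=> Nn; rewrite -(subnKC Nn); apply: le_lt_trans (step _ _) _.
  apply: le_lt_trans (hN N (leqnn N)).
  by rewrite ger0_norm ?subr_ge0 // lerB.
exists [set n | (N <= n)%N]; first by exists N.
move=> x y /far hx /far hy.
rewrite -[X in cabs X](subrKA (ell2_partial N a b)).
by apply: le_lt_trans (cabsD _ _) _; rewrite [e]splitr ltrD // cabsB.
Qed.

Definition ell2_inner (a b : ell2) : C := sval (cid (ell2_partial_cvg a b)).

Lemma ell2_inner_cvg (a b : ell2) :
  (fun n => ell2_partial n a b : C^o) @ \oo --> (ell2_inner a b : C^o).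
Proof. exact: (svalP (cid (ell2_partial_cvg a b))). Qed.

Lemma ell2_inner_unique (a b : ell2) (l : C) :
  (fun n => ell2_partial n a b : C^o) @ \oo --> (l : C^o) -> ell2_inner a b = l.
Proof. exact: cvg_uniq (@ell2_inner_cvg a b). Qed.

Lemma ell2_Re_cvg (a : ell2) :
  (fun n => complex.Re (ell2_partial n a a)) @ \oo -->
  complex.Re (ell2_inner a a).
Proof. exact: Re_cvg (@ell2_inner_cvg a a). Qed.

Lemma ell2_semi_inner : semi_inner ell2_inner.
Proof.
split.
- move=> a b c; apply: ell2_inner_unique.
  apply: cvg_ext (cvg_addf (@ell2_inner_cvg a c) (@ell2_inner_cvg b c)) => n.
  by rewrite /ell2_partial -big_split; apply: eq_bigr => i _; rewrite ell2DE mulrDl.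
- move=> k a c; apply: ell2_inner_unique.
  apply: (cvg_extc (f := fun n => k * ell2_partial n a c)); last first.
    exact: cvg_mulf (@ell2_inner_cvg a c).
  move=> n.
  by rewrite /ell2_partial mulr_sumr; apply: eq_bigr => i _; rewrite ell2ZE mulrA.
- move=> a b; apply: ell2_inner_unique.
  apply: cvg_ext (cvg_conjf (@ell2_inner_cvg a b)) => n.
  rewrite /ell2_partial rmorph_sum; apply: eq_bigr => i _.
  by rewrite rmorphM /= conjCK mulrC.
- move=> a.
  have hR := @ell2_Re_cvg a.
  have hE n : ell2_partial n a a = (\sum_(i < n) cabs (a i) ^+ 2)%:C.
    by rewrite realc_sum; apply: eq_bigr => i _; rewrite cabs_sqr.
  have -> : ell2_inner a a = (complex.Re (ell2_inner a a))%:C.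
    by apply: ell2_inner_unique; apply: cvg_ext (real_cvg hR) => n; rewrite hE.
  rewrite ler0c -(cvg_lim _ hR) //; apply: limr_ge.
    by apply/cvg_ex; exists (complex.Re (ell2_inner a a)).
  near=> n; rewrite hE /=; apply: sumr_ge0 => i _; exact: sqr_ge0.
Unshelve. all: by end_near. Qed.

Lemma ell2_sqn_ge (a : ell2) n : \sum_(i < n) cabs (a i) ^+ 2 <= sqn ell2_inner a.
Proof.
have hR := @ell2_Re_cvg a.
rewrite /sqn -(cvg_lim _ hR) //; apply: limr_ge.
  by apply/cvg_ex; exists (complex.Re (ell2_inner a a)).
exists n => //= m /= nm; rewrite /ell2_partial Re_sum -(subnKC nm) big_split_ord.
rewrite /=; under [X in _ <= X + _]eq_bigr do rewrite Re_mulconj.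
rewrite lerDl; apply: sumr_ge0 => i _.
by rewrite Re_mulconj sqr_ge0.
Qed.

Lemma ell2_sqn_le (a : ell2) (M : R) :
  (forall n, \sum_(i < n) cabs (a i) ^+ 2 <= M) -> sqn ell2_inner a <= M.
Proof.
move=> hM; have hR := @ell2_Re_cvg a.
rewrite /sqn -(cvg_lim _ hR) //; apply: limr_le.
  by apply/cvg_ex; exists (complex.Re (ell2_inner a a)).
near=> n; rewrite /ell2_partial Re_sum.
by under eq_bigr do rewrite Re_mulconj; exact: hM.
Unshelve. all: by end_near. Qed.

Lemma ell2_sqn_eq0 (a : ell2) : sqn ell2_inner a = 0 -> a = 0.
Proof.
move=> a0; apply: val_inj; apply/funext => n /=.
have := ell2_sqn_ge a n.+1; rewrite a0 big_ord_recr /= => h.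
apply/eqP; rewrite -cabs_eq0 -sqrf_eq0 eq_le sqr_ge0 andbT.
by apply: le_trans h; rewrite lerDr sumr_ge0 // => i _; exact: sqr_ge0.
Qed.

Definition ell2_norm (a : ell2) : C := (ipnorm ell2_inner a)%:C.

Lemma ell2_normD (a b : ell2) : ell2_norm (a + b) <= ell2_norm a + ell2_norm b.
Proof. by rewrite /ell2_norm -realcD lecR; exact: (ipnormD ell2_semi_inner). Qed.

Lemma ell2_normZ k (a : ell2) : ell2_norm (k *: a) = `|k| * ell2_norm a.
Proof. by rewrite /ell2_norm (ipnormZ ell2_semi_inner) realcM cabsE. Qed.

Lemma ell2_norm_eq0 (a : ell2) : ell2_norm a = 0 -> a = 0.
Proof.
move=> /complexI h; apply: ell2_sqn_eq0.
by rewrite -(ipnorm_sqr ell2_semi_inner) h expr0n.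
Qed.

HB.instance Definition _ :=
  Lmodule_isNormed.Build C ell2 ell2_normD ell2_normZ ell2_norm_eq0.

Lemma ell2_rnorm (a : ell2) : rnorm a = ipnorm ell2_inner a.
Proof. by []. Qed.

Lemma ell2_coord_le (a : ell2) n : cabs (a n) <= rnorm a.
Proof.
rewrite -(@ler_pXn2r _ 2) ?nnegrE ?cabs_ge0 ?rnorm_ge0 //.
rewrite ell2_rnorm (ipnorm_sqr ell2_semi_inner).
apply: le_trans (ell2_sqn_ge a n.+1); rewrite big_ord_recr /= lerDr.
by apply: sumr_ge0 => i _; exact: sqr_ge0.
Qed.

(** Limits exist coordinatewise. [key] lets the Cauchy bound pass to the limit in finite sums,
    uniformly in their length; this gives both the square summability of [l] and the convergence in
    norm. *)
Lemma ell2_complete (F : set_system ell2) :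
  ProperFilter F -> cauchy F -> cvg F.
Proof.
move=> FF /cauchy_ballP Fc.
have small (e : R) : 0 < e -> exists2 A, F A &
    forall a b, A a -> A b -> rnorm (a - b) < e.
  move=> e0; have ec0 : 0 < e%:C by rewrite ltcR.
  have [[A B] /= [FA FB] AB] := Fc _ ec0.
  exists (A `&` B); first exact: filterI.
  move=> a b [Aa Ba] [Ab Bb].
  have := AB (a, b) (conj Aa Bb).
  by rewrite -ball_normE /ball_ /= rnormE ltcR.
have coord n : exists l, (fun a : ell2 => a n : C^o) @ F --> (l : C^o).
  apply: complex_cauchy_cvg => e e0; have [A FA hA] := small e e0.
  exists A => // a b Aa Ab; apply: le_lt_trans (hA a b Aa Ab).
  exact: (ell2_coord_le (a - b) n).
pose l n : C^o := sval (cid (coord n)).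
have l_cvg n : (fun a : ell2 => a n : C^o) @ F --> (l n : C^o).
  exact: (svalP (cid (coord n))).
have key (e : R) (A : set ell2) : 0 < e -> F A ->
    (forall a b, A a -> A b -> rnorm (a - b) < e) ->
    forall a, A a -> forall n, \sum_(i < n) cabs (a i - l i) ^+ 2 <= e ^+ 2.
  move=> e0 FA hA a Aa n.
  have h : (fun b : ell2 => \sum_(i < n) cabs (a i - b i) ^+ 2) @ F -->
      \sum_(i < n) cabs (a i - l i) ^+ 2.
    apply: (@cvg_sumf _ R^o) => i; rewrite expr2.
    by under eq_fun do rewrite expr2; apply: cvgM;
      apply: (@cvg_rnorm _ C^o); apply: cvg_subf => //; exact: cvg_cst.
  rewrite -(cvg_lim _ h) //; apply: limr_le; first by apply/cvg_ex; eexists; exact: h.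
  apply: filterS FA => b /(hA a b Aa) ab.
  apply: le_trans (ell2_sqn_ge (a - b) n) _.
  rewrite -(ipnorm_sqr ell2_semi_inner).
  by rewrite ler_pXn2r ?nnegrE ?ipnorm_ge0 ?(ltW e0) ?(ltW ab).
have [A1 FA1 hA1] := small 1 ltr01.
have [a1 A1a1] : exists a, A1 a by exact: filter_ex FA1.
have l_summable : (a1 : nat -> C^o) - l \in square_summable.
  apply/asboolP; exists (1 ^+ 2) => n; exact: (key 1 A1 ltr01 FA1 hA1 a1 A1a1).
have l_ell2 : l \in square_summable.
  (* Only the difference [a1 - l] is controlled directly. *)
  have -> : l = ell2_val a1 - ((a1 : nat -> C^o) - l) by rewrite opprB addrC subrK.
  by apply: rpredB => //; exact: ell2P.
apply/cvg_ex; exists (Ell2 l_ell2).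
apply/(@cvg_rnormP _ ell2 _ _ _ id) => e e0.
have e2 : 0 < e / 2 by rewrite divr_gt0.
have [A FA hA] := small _ e2.
apply: (filterS _ FA) => a Aa; rewrite rnormB.
apply: (@le_lt_trans _ _ (e / 2)); last by rewrite gtr_pMr // invf_lt1 ?ltr1n.
rewrite ell2_rnorm -(@ler_pXn2r _ 2) ?nnegrE ?ipnorm_ge0 ?(ltW e2) //.
rewrite (ipnorm_sqr ell2_semi_inner); apply: ell2_sqn_le => n.
exact: (key _ A e2 FA hA a Aa n).
Qed.

HB.instance Definition _ := Uniform_isComplete.Build ell2 ell2_complete.

Lemma ell2_inner_bilinear : bilinear_for ( *%R ) (Num.conj \; *%R) ell2_inner.
Proof.
split=> a k b c.
  by rewrite (ipD ell2_semi_inner) (ipZ ell2_semi_inner).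
by rewrite (ipDr ell2_semi_inner) (ipZr ell2_semi_inner).
Qed.

HB.instance Definition _ :=
  bilinear_isBilinear.Build C ell2 ell2 C ( *%R ) (Num.conj \; *%R) ell2_inner
    ell2_inner_bilinear.

Lemma ell2_inner_hermitian (a b : ell2) :
  ell2_inner a b = (-1) ^+ false * (ell2_inner b a)^*.
Proof. by rewrite expr0 mul1r -(ipC ell2_semi_inner). Qed.

HB.instance Definition _ :=
  isHermitianSesquilinear.Build C ell2 false Num.conj ell2_inner
    ell2_inner_hermitian.

Lemma ell2_inner_gt0 (a : ell2) : a != 0 -> 0 < ell2_inner a a.
Proof.
move=> a0; rewrite lt_neqAle (ip_ge0 ell2_semi_inner) andbT eq_sym.
apply: contraNneq a0 => a0; apply/eqP/ell2_sqn_eq0.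
by rewrite /sqn a0.
Qed.

HB.instance Definition _ :=
  isDotProduct.Build C ell2 ell2_inner ell2_inner_gt0.

Lemma ell2_inner_norm (a : ell2) : `|a| ^+ 2 = ell2_inner a a.
Proof.
by rewrite rnormE -rmorphXn /= ell2_rnorm (ipnorm_sqr ell2_semi_inner)
  -(sqnE ell2_semi_inner).
Qed.

HB.instance Definition _ := isInnerProduct.Build R ell2 ell2_inner_norm.

End SquareSummable.

Section HilbertSpace.
Context {R : realType} {H : hilbertType R}.
Implicit Types (x y : H).

Lemma hilbert_semi_inner : semi_inner (@inner R H).
Proof.
split.
- by move=> x y z; rewrite linearDl.
- by move=> a x z; rewrite linearZl_LR.
- by move=> x y; rewrite [LHS]hermC expr0 mul1r.
- by move=> x; rewrite -inner_norm exprn_ge0.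
Qed.

Lemma rnorm_inner x : rnorm x = ipnorm (@inner R H) x.
Proof.
rewrite /ipnorm /sqn -inner_norm rnormE -rmorphXn /=.
by rewrite sqrtr_sqr ger0_norm ?rnorm_ge0.
Qed.

Lemma sqr_rnorm x : rnorm x ^+ 2 = sqn (@inner R H) x.
Proof. by rewrite rnorm_inner (ipnorm_sqr hilbert_semi_inner). Qed.

Lemma inner_cvg {T : Type} {F : set_system T} {FF : Filter F} (f : T -> H) x y :
  f @ F --> x ->
  (fun t => inner (f t) y : R[i]^o) @ F --> (inner x y : R[i]^o).
Proof.
move=> /cvg_rnormP fx; apply/cvg_cabsP => e e0.
have y1 : 0 < rnorm y + 1 by rewrite ltr_wpDl ?rnorm_ge0.
have := fx _ (divr_gt0 e0 y1); apply: filterS => t ft.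
rewrite -(ipB hilbert_semi_inner).
apply: le_lt_trans (cauchy_schwarz hilbert_semi_inner _ _) _.
rewrite -!rnorm_inner.
move: ft; rewrite ltr_pdivlMr //; apply: le_lt_trans.
by rewrite ler_wpM2l ?rnorm_ge0 // lerDl.
Qed.

Lemma inner_cvgr {T : Type} {F : set_system T} {FF : Filter F} (f : T -> H) x y :
  f @ F --> x ->
  (fun t => inner y (f t) : R[i]^o) @ F --> (inner y x : R[i]^o).
Proof.
move=> fx; rewrite (ipC hilbert_semi_inner).
apply: (cvg_extc (f := fun t => (inner (f t) y)^*)).
  by move=> t; rewrite -(ipC hilbert_semi_inner).
by apply: (@cvg_conjf _ _ _ _ (fun t => inner (f t) y)); exact: inner_cvg.
Qed.

End HilbertSpace.

(** * Kernels and Herz-Schur multipliers *)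

Section FeatureMap.
Context {R : realType}.
Local Notation C := R[i].

Lemma finite_support_square_summable (a : nat -> C^o) (N : nat) :
  (forall n, (N <= n)%N -> a n = 0) -> a \in @square_summable R.
Proof.
move=> aN; apply/asboolP; exists (\sum_(i < N) cabs (a i) ^+ 2) => n.
have [nN|/ltnW Nn] := leqP n N.
  rewrite -(subnKC nN) big_split_ord /= lerDl.
  by apply: sumr_ge0 => i _; exact: sqr_ge0.
rewrite -(subnKC Nn) big_split_ord /= [X in _ + X]big1 ?addr0 // => i _.
by rewrite aN ?leq_addr // cabs0 expr0n.
Qed.

(** Enumerating [T] reduces to the Cholesky factorization. Finite support of the feature vectors
    makes the Gram identity a finite sum, which the Schur product theorem below exploits. *)
Lemma finite_features (T : choiceType) (x0 : T) (K : T -> T -> C) :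
  countable [set: T] -> pd_kernel K ->
  exists (v : T -> nat -> C) (N : T -> nat),
    (forall x n, (N x <= n)%N -> v x n = 0) /\
    forall x y n, (N x <= n)%N -> K x y = \sum_(j < n) v x j * (v y j)^*.
Proof.
move=> /countable_injP[f finj] hK.
(* A left inverse of the enumeration, with value [x0] off its range; the repeated points this
   creates are harmless for positive definiteness. *)
pose g n := xget x0 [set t | f t = n].
have fK t : g (f t) = t.
  rewrite /g; apply: xget_unique => //= u /finj -> //; exact: in_setT.
have hK' : pd_kernel (fun m n => K (g m) (g n)) by exact: pd_kernel_comp.
exists (fun t => cholesky (fun m n => K (g m) (g n)) (f t)), (fun t => (f t).+1).
split=> [x n xn|x y n xn]; first by rewrite cholesky0.
by rewrite -choleskyE // !fK.
Qed.

Lemma feature_map (T : choiceType) (x0 : T) (K : T -> T -> C) :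
  countable [set: T] -> pd_kernel K ->
  exists v : T -> ell2 R, forall x y, inner (v x) (v y) = K x y.
Proof.
move=> cT hK; have [w [N [wN wE]]] := finite_features x0 cT hK.
have w_fin t : (w t : nat -> C^o) \in @square_summable R.
  by apply: (@finite_support_square_summable _ (N t)) => n; exact: wN.
exists (fun t => Ell2 (w_fin t)) => x y.
apply: ell2_inner_unique; apply/cvg_cabsP => e e0.
exists (N x) => //= n xn.
by rewrite /ell2_partial /= -wE // subrr cabs0.
Qed.

(* Schur product theorem: K' is a sum of rank-one kernels, and multiplying by a
   rank-one kernel is a congruence. *)
Lemma pd_kernelM (T : choiceType) (x0 : T) (K K' : T -> T -> C) :
  countable [set: T] -> pd_kernel K -> pd_kernel K' ->
  pd_kernel (fun x y => K x y * K' x y).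
Proof.
move=> cT hK hK'; have [v [N [vN vE]]] := finite_features x0 cT hK'.
move=> n s c; pose M := (\max_(i < n) N (s i))%N.
have -> : \sum_(i < n) \sum_(j < n) c i * (c j)^* * (K (s i) (s j) * K' (s i) (s j))
  = \sum_(k < M) \sum_(i < n) \sum_(j < n)
      (c i * v (s i) k) * (c j * v (s j) k)^* * K (s i) (s j).
  rewrite [RHS]exchange_big; apply: eq_bigr => i _.
  rewrite [RHS]exchange_big; apply: eq_bigr => j _.
  rewrite (vE _ _ M); last exact: leq_bigmax.
  rewrite !mulr_sumr; apply: eq_bigr => k _.
  rewrite rmorphM /=; ring.
by apply: sumr_ge0 => k _; exact: hK.
Qed.

End FeatureMap.

Section SchurBound.
Context {R : realType} {G : groupType}.
Hypothesis countable_G : countable [set: G].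
Local Notation C := R[i].
Implicit Types (phi psi : G -> C) (c : R).

(* For countable G this says that phi is a Herz-Schur multiplier of norm at most
   c, attained by a single Hilbert space representation; working with 2x2 block
   kernels makes sums, multiples and transfers immediate. *)
Definition schur_le phi c : Prop :=
  exists K : bool * G -> bool * G -> C,
    [/\ pd_kernel K, forall x, complex.Re (K x x) <= c
      & forall s t, K (true, s) (false, t) = phi (t^-1 * s)%g].

Lemma schur_le_ge0 phi c : schur_le phi c -> 0 <= c.
Proof.
case=> K [hK /(_ (true, 1%g)) + _]; apply: le_trans.
exact: ge0_Re (pd_kernel_diag _ hK).
Qed.

Lemma schur_le_trans phi c c' : schur_le phi c -> c <= c' -> schur_le phi c'.
Proof.
case=> K [hK Kc KE] cc'; exists K; split => // x.
exact: le_trans (Kc x) cc'.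
Qed.

Lemma schur_leD phi psi c c' :
  schur_le phi c -> schur_le psi c' -> schur_le (fun s => phi s + psi s) (c + c').
Proof.
case=> K [hK Kc KE] [K' [hK' Kc' KE']].
exists (fun x y => K x y + K' x y); split.
- exact: pd_kernelD.
- by move=> x; rewrite ReD lerD.
- by move=> s t; rewrite KE KE'.
Qed.

Lemma schur_leZ phi c (k : C) :
  schur_le phi c -> schur_le (fun s => k * phi s) (cabs k * c).
Proof.
case=> K [hK Kc KE].
pose q : R := Num.sqrt (cabs k).
have qq : q%:C * q%:C = (cabs k)%:C.
  by rewrite -realcM -expr2 sqr_sqrtr ?cabs_ge0.
(* Both weights have modulus [sqrt |k|], so the diagonal is multiplied by [|k|], while the
   off-diagonal block is multiplied by [k]. *)
pose d (x : bool * G) : C := if x.1 then k / q%:C else q%:C.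
exists (fun x y => d x * (d y)^* * K x y); split.
- move=> n s a; have := hK n s (fun i => a i * d (s i)).
  congr (_ <= _); apply: eq_bigr => i _; apply: eq_bigr => j _.
  rewrite rmorphM /=; ring.
- move=> x.
  have -> : d x * (d x)^* = (cabs k)%:C.
    rewrite /d; case: x.1; last by rewrite conj_real qq.
    rewrite rmorphM fmorphV /= conj_real mulrACA -cabs_sqr -invfM qq.
    have [->|k0] := eqVneq k 0; first by rewrite cabs0 invr0 mulr0.
    have kn0 : (cabs k)%:C != 0.
      by rewrite (inj_eq (@complexI _) _ 0) cabs_eq0.
    by rewrite expr2 realcM; field.
  by rewrite Re_realM ler_wpM2l ?cabs_ge0.
- move=> s t; rewrite KE /d /= conj_real; congr (_ * _).
  have [->|k0] := eqVneq k 0; first by rewrite !mul0r.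
  have qn0 : q%:C != 0.
    rewrite (inj_eq (@complexI _) _ 0) gt_eqF // sqrtr_gt0 lt_neqAle cabs_ge0.
    by rewrite eq_sym cabs_eq0 k0.
  by rewrite divfK.
Qed.

Lemma schur_le_sum (I : Type) (r : seq I) (phi : I -> G -> C) (c : I -> R) :
  (forall i, schur_le (phi i) (c i)) ->
  schur_le (fun s => \sum_(i <- r) phi i s) (\sum_(i <- r) c i).
Proof.
move=> h; elim: r => [|i r IHr].
  rewrite big_nil; exists (fun _ _ => 0); split => //.
  - move=> n s a; rewrite big1 // => i _; rewrite big1 // => j _.
    by rewrite mulr0.
  - by move=> s t; rewrite big_nil.
rewrite big_cons; have := schur_leD (h i) IHr.
by congr schur_le; apply/funext => s; rewrite big_cons.
Qed.

Lemma sup_norm_le (H : hilbertType R) (xi : G -> H) (M : R) :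
  (forall s, rnorm (xi s) <= M) -> (sup_norm xi <= M%:E)%E.
Proof. by move=> h; apply: ge_ereal_sup => _ [s _ <-]; rewrite lee_fin. Qed.

Lemma sup_norm_ge (H : hilbertType R) (xi : G -> H) s :
  ((rnorm (xi s))%:E <= sup_norm xi)%E.
Proof. by apply: ereal_sup_ubound; exists s. Qed.

Lemma sup_norm_ge0 (H : hilbertType R) (xi : G -> H) : (0 <= sup_norm xi)%E.
Proof. by apply: le_trans (sup_norm_ge xi 1%g); rewrite lee_fin rnorm_ge0. Qed.

Lemma schur_le_rep phi c : schur_le phi c ->
  exists xi eta : G -> ell2 R, herz_schur_rep phi xi eta /\
    (sup_norm xi * sup_norm eta <= c%:E)%E.
Proof.
move=> h; have c0 := schur_le_ge0 h; case: h => K [hK Kc KE].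
have countable_bG : countable [set: bool * G].
  by rewrite -setXTT; apply: countableX => //; exact: countableP.
have [v vE] := feature_map (true, 1%g) countable_bG hK.
have vc x : rnorm (v x) <= Num.sqrt c.
  rewrite -(@ler_pXn2r _ 2) ?nnegrE ?rnorm_ge0 ?sqrtr_ge0 //.
  by rewrite sqr_rnorm sqr_sqrtr // /sqn vE.
have xic b : (sup_norm (fun s => v (b, s)) <= (Num.sqrt c)%:E)%E.
  by apply: sup_norm_le => s.
exists (fun s => v (true, s)), (fun s => v (false, s)); split.
  split; [exact: le_lt_trans (xic _) (ltry _)|exact: le_lt_trans (xic _) (ltry _)|].
  by move=> s t; rewrite vE KE.
apply: le_trans (lee_pmul _ _ (xic _) (xic _)) _; try exact: sup_norm_ge0.
by rewrite -EFinM -expr2 sqr_sqrtr.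
Qed.

Lemma schur_le_B2 phi c : schur_le phi c -> B2 phi.
Proof. by move=> /schur_le_rep[xi [eta [h _]]]; exists (ell2 R), xi, eta. Qed.

Lemma schur_le_norm phi c : schur_le phi c -> (B2_norm phi <= c%:E)%E.
Proof.
move=> /schur_le_rep[xi [eta [h hc]]]; apply: le_trans hc.
by apply: ereal_inf_lbound; exists (ell2 R), xi, eta.
Qed.

Lemma schur_le_bound phi c s : schur_le phi c -> cabs (phi s) <= c.
Proof.
move=> /schur_le_rep[xi [eta [[hx hy h] hc]]]; rewrite -lee_fin; apply: le_trans hc.
have -> : phi s = inner (xi s) (eta 1%g) by rewrite -h invg1 mul1g.
apply: (@le_trans _ _ (rnorm (xi s) * rnorm (eta 1%g))%:E).
  by rewrite lee_fin !rnorm_inner; exact: (cauchy_schwarz hilbert_semi_inner).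
rewrite EFinM; apply: lee_pmul; rewrite ?lee_fin ?rnorm_ge0 //; exact: sup_norm_ge.
Qed.

(** [schur_le] bounds both vectors by the same number, so [xi] is multiplied by [q = sqrt c / a] and
    [eta] by [1 / q]: both norms become at most [sqrt c] because [a b < c]. If [a = 0] then
    [phi = 0] and the zero kernel serves. *)
Lemma rep_schur_le phi (H : hilbertType R) (xi eta : G -> H) c :
  herz_schur_rep phi xi eta -> (sup_norm xi * sup_norm eta < c%:E)%E ->
  schur_le phi c.
Proof.
case=> hx hy h.
have [a xa] : exists a : R, sup_norm xi = a%:E.
  by exists (fine (sup_norm xi)); rewrite fineK // ge0_fin_numE ?sup_norm_ge0.
have [b yb] : exists b : R, sup_norm eta = b%:E.
  by exists (fine (sup_norm eta)); rewrite fineK // ge0_fin_numE ?sup_norm_ge0.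
rewrite xa yb -EFinM lte_fin => abc.
have a0 : 0 <= a by rewrite -lee_fin -xa sup_norm_ge0.
have b0 : 0 <= b by rewrite -lee_fin -yb sup_norm_ge0.
have xia s : rnorm (xi s) <= a by rewrite -lee_fin -xa sup_norm_ge.
have etab s : rnorm (eta s) <= b by rewrite -lee_fin -yb sup_norm_ge.
have c0 : 0 < c by apply: le_lt_trans abc; rewrite mulr_ge0.
have [aN|an0] := eqVneq a 0.
  suff phi0 s : phi s = 0.
    exists (fun _ _ => 0); split; last by move=> s t; rewrite phi0.
    - move=> n s d; rewrite big1 // => i _; rewrite big1 // => j _.
      by rewrite mulr0.
    - by move=> _; exact: ltW.
  have -> : phi s = inner (xi s) (eta 1%g) by rewrite -h invg1 mul1g.
  apply/eqP; rewrite -cabs_eq0 eq_le cabs_ge0 andbT.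
  apply: le_trans (cauchy_schwarz hilbert_semi_inner _ _) _.
  rewrite -!rnorm_inner; have := xia s; rewrite aN => hle.
  by rewrite mulr_le0_ge0 // rnorm_ge0.
have ap : 0 < a by rewrite lt_neqAle eq_sym an0.
pose q : R := Num.sqrt c / a.
have q0 : 0 < q by rewrite divr_gt0 // sqrtr_gt0.
pose z (x : bool * G) : H :=
  if x.1 then q%:C *: xi x.2 else (q^-1)%:C *: eta x.2.
have zc x : rnorm (z x) <= Num.sqrt c.
  rewrite /z; case: x.1; rewrite rnormZ cabs_real ?invr_ge0 ?(ltW q0) //.
    by rewrite mulrC -ler_pdivlMr // /q invf_div mulrCA mulfV ?mulr1 // gt_eqF // sqrtr_gt0.
  rewrite ler_pdivrMl //; apply: le_trans (etab _) _.
  rewrite /q mulrAC -expr2 sqr_sqrtr ?(ltW c0) // ler_pdivlMr // mulrC.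
  exact: ltW.
exists (fun x y => inner (z x) (z y)); split.
- exact: gram_pd hilbert_semi_inner.
- move=> x; have := zc x.
  rewrite -(@ler_pXn2r _ 2) ?nnegrE ?rnorm_ge0 ?sqrtr_ge0 //.
  by rewrite sqr_rnorm sqr_sqrtr // ltW.
- move=> s t; rewrite /z /= (ipZ hilbert_semi_inner) (ipZr hilbert_semi_inner).
  rewrite conj_real mulrA -realcM mulfV ?gt_eqF // h.
  by rewrite mul1r.
Qed.

Lemma norm_schur_le phi c : (B2_norm phi < c%:E)%E -> schur_le phi c.
Proof.
move=> /ereal_inf_lt[_ [H [xi [eta [h ->]]]] hc]; exact: rep_schur_le h hc.
Qed.

End SchurBound.

(** * Unordered sums *)

Section ComplexComplete.
Context {R : realType}.

Lemma complex_complete (F : set_system R[i]^o) :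
  ProperFilter F -> cauchy F -> cvg F.
Proof.
move=> FF /cauchy_ballP Fc.
have [|l hl] := @complex_cauchy_cvg R _ F FF id.
  move=> e e0; have ec0 : 0 < e%:C by rewrite ltcR.
  have [[A B] /= [FA FB] AB] := Fc _ ec0.
  exists (A `&` B); first exact: filterI.
  move=> a b [Aa Ba] [Ab Bb]; have := AB (a, b) (conj Aa Bb).
  by rewrite -ball_normE /ball_ /= cabsE ltcR.
by apply/cvg_ex; exists l.
Qed.

End ComplexComplete.

#[export] Existing Instance totally_filter.

Definition hassum (R : realType) (I : choiceType) (V : normedModType R[i])
    (f : I -> V) (l : V) : Prop := partial_sum f @ totally --> l.

Definition bounded_sums (R : realType) (I : choiceType) (a : I -> R) (M : R) :=
  forall F : {fset I}, \sum_(i <- F) a i <= M.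

Section UnorderedSums.
Context {R : realType} {I : choiceType}.
Local Open Scope fset_scope.
Local Open Scope ring_scope.

Lemma partial_sumE (V : zmodType) (f : I -> V) (F : {fset I}) :
  partial_sum f F = \sum_(i <- F) f i.
Proof. by rewrite /partial_sum big_seq_fsetE. Qed.

Lemma fdisjoint_fsetD (F F0 : {fset I}) : [disjoint F `\` F0 & F0].
Proof. by apply/fdisjointP => i; rewrite in_fsetD => /andP[]. Qed.

Lemma fset_sumU (V : zmodType) (f : I -> V) (F F0 : {fset I}) :
  [disjoint F & F0] ->
  \sum_(i <- (F `|` F0)%fset) f i = \sum_(i <- F) f i + \sum_(i <- F0) f i.
Proof.
move=> /fdisjointP dF; rewrite -big_cat; apply: perm_big; apply: uniq_perm.
- exact: fset_uniq.
- rewrite cat_uniq !fset_uniq andbT /=; apply/hasPn => i iF0.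
  by apply/negP => /dF; rewrite iF0.
- by move=> i; rewrite mem_cat in_fsetU.
Qed.

Lemma fset_sum_split (V : zmodType) (f : I -> V) (F F0 : {fset I}) :
  (F0 `<=` F)%fset ->
  \sum_(i <- F) f i = \sum_(i <- F0) f i + \sum_(i <- (F `\` F0)%fset) f i.
Proof.
move=> /fsubsetP F0F; rewrite addrC -fset_sumU ?fdisjoint_fsetD //.
suff -> : (F `\` F0 `|` F0)%fset = F by [].
apply/fsetP => i; rewrite in_fsetU in_fsetD.
by case: (boolP (i \in F0)) => [/F0F ->|] /=; rewrite ?orbF.
Qed.

(** A finite set whose sum is within [e] of the supremum leaves less than [e] to any set disjoint
    from it. *)
Lemma tail_small (a : I -> R) (M : R) : (forall i, 0 <= a i) ->
  bounded_sums a M -> forall e, 0 < e -> exists F0 : {fset I},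
    forall F : {fset I}, [disjoint F & F0] -> \sum_(i <- F) a i < e.
Proof.
move=> a0 aM e e0.
pose E : set R := range (fun F : {fset I} => \sum_(i <- F) a i).
have supE : has_sup E.
  by split; [exists 0; exists fset0 => //; rewrite big_seq_fset0|exists M => _ [F _ <-]].
have [_ [F0 _ <-] hF0] := sup_adherent e0 supE.
exists F0 => F dF; have : \sum_(i <- (F `|` F0)%fset) a i <= sup E.
  by apply: sup_upper_bound => //; exists (F `|` F0)%fset.
rewrite fset_sumU //; lra.
Qed.

Lemma hassum_cauchy (V : normedModType R[i]) (f : I -> V) :
  (forall F : set_system V, ProperFilter F -> cauchy F -> cvg F) ->
  (forall e : R, 0 < e -> exists F0 : {fset I}, forall F : {fset I},
     [disjoint F & F0] -> rnorm (\sum_(i <- F) f i) < e) ->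
  exists l, hassum f l.
Proof.
move=> Vc h; apply/cvg_ex; apply: Vc; apply/cauchy_ballP => e e0.
have eE := ge0_complexE (ltW e0).
have eR : 0 < complex.Re e / 2 by rewrite divr_gt0 // -ltcR -eE.
have [F0 hF0] := h _ eR.
have FA : totally (fun F : {fset I} => F0 `<=` F) by exists F0.
pose A0 : set {fset I} := fun F => F0 `<=` F.
exists ([set partial_sum f F | F in A0]%classic,
  [set partial_sum f F | F in A0]%classic).
  suff FA' : totally (fun F : {fset I} =>
      [set partial_sum f F | F in A0]%classic (partial_sum f F)) by split.
  by apply: filterS FA => F AF; exists F.
move=> [x y] /= [[A /= hA <-] [B /= hB <-]].
rewrite -ball_normE /ball_ /= rnormE eE ltcR !partial_sumE.
rewrite (fset_sum_split f hA) (fset_sum_split f hB) opprD addrACA subrr add0r.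
apply: le_lt_trans (rnormD _ _) _; rewrite rnormN [complex.Re e]splitr.
by rewrite ltrD // hF0 // fdisjoint_fsetD.
Qed.

Lemma rnorm_sum (V : normedModType R[i]) (f : I -> V) (F : {fset I}) :
  rnorm (\sum_(i <- F) f i) <= \sum_(i <- F) rnorm (f i).
Proof.
elim/big_rec2: _ => [|i x y _ le_xy]; first by rewrite /rnorm normr0.
by apply: le_trans (rnormD _ _) _; rewrite lerD2l.
Qed.

Lemma hassum_abs (f : I -> R[i]) (M : R) :
  bounded_sums (fun i => cabs (f i)) M ->
  exists2 l : R[i], hassum (f : I -> R[i]^o) (l : R[i]^o) & cabs l <= M.
Proof.
move=> hM; have [|l hl] := @hassum_cauchy R[i]^o f (@complex_complete R).
  move=> e e0; have [|F0 hF0] := tail_small _ hM e0; first by move=> i; exact: cabs_ge0.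
  by exists F0 => F /hF0; apply: le_lt_trans; exact: rnorm_sum.
exists l => //; rewrite -rnormo; apply: (cvg_le_rnorm hl); near=> F.
rewrite partial_sumE; apply: le_trans (rnorm_sum _ _) _; exact: hM.
Unshelve. all: by end_near. Qed.

Lemma hassum_unique (V : normedModType R[i]) (f : I -> V) (l l' : V) :
  hassum f l -> hassum f l' -> l = l'.
Proof. exact: cvg_uniq. Qed.

Lemma hassum_uniquec (f : I -> R[i]) (l l' : R[i]) :
  hassum (f : I -> R[i]^o) (l : R[i]^o) -> hassum (f : I -> R[i]^o) (l' : R[i]^o) ->
  l = l'.
Proof. exact: hassum_unique. Qed.

Lemma hassum_le (V : normedModType R[i]) (f : I -> V) (l : V) (M : R) :
  hassum f l -> (forall F : {fset I}, rnorm (\sum_(i <- F) f i) <= M) -> rnorm l <= M.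
Proof.
move=> hl hM; apply: (cvg_le_rnorm hl); near=> F.
by rewrite partial_sumE.
Unshelve. all: by end_near. Qed.

Lemma hassum_tail (V : normedModType R[i]) (f : I -> V) (l : V) (F0 : {fset I})
    (d : R) :
  hassum f l -> (forall F : {fset I}, [disjoint F & F0] ->
    rnorm (\sum_(i <- F) f i) <= d) -> rnorm (l - \sum_(i <- F0) f i) <= d.
Proof.
move=> hl hd.
apply: (cvg_le_rnorm (cvg_subf hl (cvg_cst (\sum_(i <- F0) f i)))).
exists F0 => //= F hF; rewrite partial_sumE (fset_sum_split f hF) addrAC subrr.
by rewrite add0r; apply: hd; exact: fdisjoint_fsetD.
Qed.

Lemma hassumD (V : normedModType R[i]) (f g : I -> V) (l l' : V) :
  hassum f l -> hassum g l' -> hassum (fun i => f i + g i) (l + l').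
Proof.
move=> hl hl'; apply: cvg_ext (cvg_addf hl hl') => F.
by rewrite /partial_sum big_split.
Qed.

Lemma hassumZ (V : normedModType R[i]) (k : R[i]) (f : I -> V) (l : V) :
  hassum f l -> hassum (fun i => k *: f i) (k *: l).
Proof.
move=> hl; apply: (cvg_ext (f := fun F => k *: partial_sum f F)); last first.
  exact: cvg_scalef.
move=> F.
by rewrite /partial_sum scaler_sumr.
Qed.

Lemma hassumM (k : R[i]) (f : I -> R[i]) (l : R[i]) :
  hassum (f : I -> R[i]^o) (l : R[i]^o) ->
  hassum (fun i => k * f i : R[i]^o) (k * l : R[i]^o).
Proof. exact: hassumZ. Qed.

Lemma hassum_extc (f g : I -> R[i]) (l : R[i]) : f =1 g ->
  hassum (f : I -> R[i]^o) (l : R[i]^o) -> hassum (g : I -> R[i]^o) (l : R[i]^o).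
Proof. by move=> /funext ->. Qed.

Lemma hassum_finite (V : normedModType R[i]) (f : I -> V) (F0 : {fset I}) :
  (forall i, i \notin F0 -> f i = 0) -> hassum f (\sum_(i <- F0) f i).
Proof.
move=> f0; apply/cvg_rnormP => e e0; exists F0 => //= F hF.
rewrite partial_sumE (fset_sum_split f hF).
have -> : \sum_(i <- F `\` F0) f i = 0.
  by rewrite big_seq big1 // => i; rewrite in_fsetD => /andP[/f0].
by rewrite addr0 subrr /rnorm normr0.
Qed.

(** Dominated convergence along an arbitrary filter: the tails of [a] bound the error uniformly in
    [j], and only finitely many indices remain. *)
Lemma hassum_dominated {J : Type} {Fil : set_system J} {FFil : Filter Fil}
    (phi : J -> I -> R[i]) (psi : I -> R[i]) (a : I -> R[i])
    (c : R) (M : R) (l : J -> R[i]) (k : R[i]) :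
  bounded_sums (fun i => cabs (a i)) M ->
  (forall j i, cabs (phi j i) <= c) -> (forall i, cabs (psi i) <= c) ->
  (forall i, (fun j => phi j i : R[i]^o) @ Fil --> (psi i : R[i]^o)) ->
  (forall j, hassum (fun i => phi j i * a i : R[i]^o) (l j)) ->
  hassum (fun i => psi i * a i : R[i]^o) k ->
  (l : J -> R[i]^o) @ Fil --> (k : R[i]^o).
Proof.
move=> aM phic psic phipsi hl hk; apply/cvg_cabsP => e e0.
have e3 : 0 < e / 3 by rewrite divr_gt0.
(* Makes a tail contribute at most [2 |c| d <= e / 3]; the [+ 1] keeps the denominator positive. *)
pose d := e / 3 / (2 * `|c| + 1).
have d0 : 0 < d by rewrite divr_gt0 // ltr_wpDl // mulr_ge0.
have [|F0 hF0] := tail_small _ aM d0; first by move=> i; exact: cabs_ge0.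
have main : (fun j => \sum_(i <- F0) phi j i * a i : R[i]^o) @ Fil -->
    (\sum_(i <- F0) psi i * a i : R[i]^o).
  apply: (@cvg_sumf _ R[i]^o) => i.
  apply: (cvg_extc (f := fun j => a i * phi j i)); first by move=> j; rewrite mulrC.
  by rewrite mulrC; apply: cvg_mulf.
move/cvg_cabsP : main => /(_ _ e3); apply: filterS => j hj.
rewrite -/(rnorm (_ : R[i]^o)).
pose D i : R[i]^o := (psi i - phi j i) * a i.
have hD : hassum D (k - l j : R[i]^o).
  apply: (cvg_ext _ (cvg_subf hk (hl j))) => F.
  by rewrite /partial_sum -sumrB; apply: eq_bigr => i _; rewrite /D mulrBl.
apply: (@le_lt_trans _ _ (2 * (e / 3))); last by lra.
have small F : [disjoint F & F0] -> rnorm (\sum_(i <- F) D i) <= e / 3.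
  move=> dF; apply: le_trans (rnorm_sum _ _) _.
  apply: (@le_trans _ _ (\sum_(i <- F) (2 * `|c|) * cabs (a i))).
    apply: ler_sum => i _; rewrite /D rnormo cabsM ler_wpM2r ?cabs_ge0 //.
    apply: le_trans (cabsD _ _) _; rewrite cabsN mulr2n mulrDl !mul1r.
    by rewrite lerD // (le_trans _ (ler_norm c)).
  rewrite -mulr_sumr.
  apply: (@le_trans _ _ ((2 * `|c| + 1) * d)).
    apply: ler_pM => //; first by apply: sumr_ge0 => i _; exact: cabs_ge0.
      by rewrite lerDl.
    by apply/ltW/hF0.
  by rewrite /d mulrCA mulfV ?mulr1 // gt_eqF // ltr_wpDl // mulr_ge0.
apply: (cvg_le_rnorm hD); exists F0 => //= F hF.
rewrite partial_sumE (fset_sum_split D hF).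
apply: le_trans (rnormD _ _) _; rewrite mulr2n mulrDl !mul1r lerD //.
  apply: ltW; move: hj; rewrite -sumrB rnormo; congr (cabs _ < _).
  by apply: eq_bigr => i _; rewrite /D mulrBl.
by apply: small; exact: fdisjoint_fsetD.
Qed.

End UnorderedSums.

Arguments hassumM {R I} k {f l} _.
Arguments hassumZ {R I V} k {f l} _.

Lemma hassum_reindex (R : realType) (I J : choiceType) (V : normedModType R[i])
    (g : I -> J) (g' : J -> I) (f : J -> V) (l : V) :
  cancel g g' -> cancel g' g -> hassum f l -> hassum (fun i => f (g i)) l.
Proof.
move=> gK g'K /cvg_rnormP hf; apply/cvg_rnormP => e e0.
have [F0 _ hF0] := hf e e0.
exists [fset g' j | j in F0]%fset => //= F hF.
have := hF0 [fset g i | i in F]%fset.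
rewrite /= !partial_sumE big_imfset /=; last by move=> x y _ _; exact: (can_inj gK).
apply; apply/fsubsetP => j jF0; apply/imfsetP; exists (g' j); last by rewrite g'K.
by apply: (fsubsetP hF); apply/imfsetP; exists j.
Qed.

Arguments hassum_reindex {R I J V} g g' {f l} _ _ _.

Section Fubini.
Context {R : realType} {S T : choiceType}.
Local Open Scope fset_scope.
Local Open Scope ring_scope.

(** Off a finite set [S0] of rows, the domination by [f s * m s t] bounds the total by [e / 4]
    whatever columns are chosen; over [S0] there are finitely many convergent row sums. Three errors
    of size [e / 4] result. *)
Lemma hassum_fubini (A : S -> T -> R[i]) (f : S -> R) (m : S -> T -> R)
    (M : R) (r : S -> R[i]) (c : T -> R[i]) :
  (forall s, 0 <= f s) -> bounded_sums f M ->
  (forall s, bounded_sums (m s) 1) ->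
  (forall s t, cabs (A s t) <= f s * m s t) ->
  (forall s, hassum (fun t => A s t : R[i]^o) (r s)) ->
  (forall t, hassum (fun s => A s t : R[i]^o) (c t)) ->
  exists2 l : R[i]^o, hassum (r : S -> R[i]^o) l & hassum (c : T -> R[i]^o) l.
Proof.
move=> f0 fM m1 Afm hr hc.
have rowb s (F : {fset T}) : \sum_(t <- F) cabs (A s t) <= f s.
  apply: (@le_trans _ _ (\sum_(t <- F) f s * m s t)).
    by apply: ler_sum => t _.
  by rewrite -mulr_sumr -[X in _ <= X]mulr1 ler_wpM2l // m1.
have rf s : cabs (r s) <= f s.
  by apply: (hassum_le (hr s)) => F; apply: le_trans (rnorm_sum _ _) _; exact: rowb.
have [|l hl _] := @hassum_abs R S r M.
  by move=> F; apply: le_trans (fM F); apply: ler_sum => s _; exact: rf.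
exists l => //; apply/cvg_rnormP => e e0.
have e4 : 0 < e / 4 by rewrite divr_gt0.
have [S0 hS0] := tail_small f0 fM e4.
have tailA (F : {fset T}) (S' : {fset S}) : [disjoint S' & S0] ->
    rnorm (\sum_(s <- S') \sum_(t <- F) A s t : R[i]^o) <= e / 4.
  move=> dS'; apply: le_trans (rnorm_sum _ _) _.
  apply: le_trans (ltW (hS0 _ dS')); apply: ler_sum => s _.
  by apply: le_trans (rnorm_sum _ _) _; exact: rowb.
have h1 : rnorm (l - \sum_(s <- S0) r s : R[i]^o) <= e / 4.
  apply: (hassum_tail hl) => F dF; apply: le_trans (rnorm_sum _ _) _.
  by apply: le_trans (ltW (hS0 _ dF)); apply: ler_sum => s _; exact: rf.
have h2 : (fun F => \sum_(s <- S0) partial_sum (A s : T -> R[i]^o) F) @ totally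
    --> (\sum_(s <- S0) r s : R[i]^o).
  by apply: (@cvg_sumf _ R[i]^o) => s; exact: hr.
have h3 (F : {fset T}) :
    rnorm (\sum_(t <- F) c t - \sum_(s <- S0) \sum_(t <- F) A s t : R[i]^o) <= e / 4.
  apply: hassum_tail (tailA F); apply: cvg_ext (@cvg_sumf _ R[i]^o _ _ _ _ F _ _ hc).
  move=> S'; rewrite partial_sumE [RHS]exchange_big; apply: eq_bigr => t _.
  by rewrite partial_sumE.
move/cvg_rnormP : h2 => /(_ _ e4); apply: filterS => F h2.
rewrite partial_sumE -[X in rnorm X](subrKA (\sum_(s <- S0) r s : R[i]^o)).
apply: le_lt_trans (rnormD _ _) _.
rewrite -[X in _ + rnorm X](subrKA (\sum_(s <- S0) \sum_(t <- F) A s t : R[i]^o)).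
have := rnormD (\sum_(s <- S0) r s - \sum_(s <- S0) \sum_(t <- F) A s t : R[i]^o)
  (\sum_(s <- S0) \sum_(t <- F) A s t - \sum_(t <- F) c t : R[i]^o).
have hE : \sum_(s <- S0) \sum_(t <- F) A s t
  = \sum_(s <- S0) partial_sum (A s : T -> R[i]^o) F :> R[i]^o.
  by apply: eq_bigr => s _; rewrite partial_sumE.
have := h3 F; rewrite rnormB hE => h3'.
move: h2 h1 h3'; lra.
Qed.
End Fubini.

(** * Transfer of multipliers *)

(** Completeness of the family is expressed by squared norms, the form in which normality of the
    trace provides it; [pf_approx] recovers the convergence of vectors. *)
Record projection_family (R : realType) (V : lmodType R[i])
    (f : V -> V -> R[i]) (I : choiceType) (P : I -> V -> V) : Prop := {
  pf_idem : forall i x, P i (P i x) = P i x;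
  pf_adj : forall i x y, f (P i x) y = f x (P i y);
  pf_sum : forall x,
    (fun F : {fset I} => \sum_(i <- F) sqn f (P i x)) @ totally --> sqn f x }.

Arguments pf_sum {R V f I P} _ x.

Section ProjectionFamily.
Context {R : realType} {V : lmodType R[i]} {f : V -> V -> R[i]}.
Context {I : choiceType} {P : I -> V -> V}.
Hypothesis fP : semi_inner f.
Hypothesis PP : projection_family f P.
Local Notation n2 := (sqn f).
Local Notation nrm := (ipnorm f).

Lemma pf_sqnE i x : f (P i x) x = (n2 (P i x))%:C.
Proof. by rewrite -(sqnE fP) -[in LHS](pf_idem PP) (pf_adj PP). Qed.

Lemma pf_bounded x : bounded_sums (fun i => n2 (P i x)) (n2 x).
Proof.
move=> F; have h := pf_sum PP x; rewrite -(cvg_lim _ h) //.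
apply: limr_ge; first by apply/cvg_ex; exists (n2 x).
exists F => //= F' FF'; rewrite (fset_sum_split _ FF') lerDl.
by apply: sumr_ge0 => i _; exact: sqn_ge0.
Qed.

(** Bessel's inequality at [P j y] for the two indices [j], [i]: the term of index [j] already
    exhausts the norm, so [P i (P j y)] is null. *)
Lemma pf_orth i j x y : i != j -> f (P i x) (P j y) = 0.
Proof.
move=> ij; rewrite -[P i x](pf_idem PP) (pf_adj PP).
apply: (ip_sqn0 fP); apply/eqP; rewrite eq_le (sqn_ge0 fP) andbT.
have := pf_bounded (P j y) [fset j; i]%fset.
rewrite big_fsetU1 ?inE 1?eq_sym // big_seq_fset1 (pf_idem PP).
by rewrite gerDl.
Qed.

Lemma pf_comb (F : {fset I}) (c : I -> R[i]) (x : V) :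
  n2 (\sum_(i <- F) c i *: P i x) = \sum_(i <- F) cabs (c i) ^+ 2 * n2 (P i x).
Proof.
rewrite /sqn (ip_suml fP) Re_sum; apply: eq_big_seq => i iF.
rewrite (ip_sumr fP) (big_fsetD1 i) //= big_seq big1 ?addr0 => [|j].
  by rewrite -/(sqn f _) (sqnZ fP).
rewrite in_fsetD1 => /andP[ji _].
by rewrite (ipZ fP) (ipZr fP) pf_orth ?mulr0 // eq_sym.
Qed.

Lemma pf_comb_le (F : {fset I}) (c : I -> R[i]) (x : V) (M : R) :
  0 <= M -> (forall i, cabs (c i) <= M) ->
  nrm (\sum_(i <- F) c i *: P i x) <= M * nrm x.
Proof.
move=> M0 cM.
rewrite -(@ler_pXn2r _ 2) // ?nnegrE ?ipnorm_ge0 ?mulr_ge0 ?ipnorm_ge0 //.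
rewrite exprMn !(ipnorm_sqr fP) pf_comb.
apply: (@le_trans _ _ (\sum_(i <- F) M ^+ 2 * n2 (P i x))).
  apply: ler_sum => i _; rewrite ler_wpM2r ?(sqn_ge0 fP) //.
  by rewrite ler_pXn2r ?nnegrE ?cabs_ge0.
by rewrite -mulr_sumr ler_wpM2l ?sqr_ge0 // pf_bounded.
Qed.

Lemma pf_abs (F : {fset I}) x y : \sum_(i <- F) cabs (f (P i x) y) <= nrm x * nrm y.
Proof.
(* Phases (or 0) that make every term real and nonnegative, so that the sum of moduli becomes a
   single inner product to which Cauchy-Schwarz applies. *)
pose c i := (f (P i x) y)^* / (cabs (f (P i x) y))%:C.
have cE i : c i * f (P i x) y = (cabs (f (P i x) y))%:C.
  rewrite /c mulrAC [X in X / _]mulrC -cabs_sqr expr2 realcM.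
  have [->|n0] := eqVneq (cabs (f (P i x) y)) 0; first by rewrite !mul0r.
  by rewrite mulfK // (inj_eq (@complexI _) _ 0).
have c1 i : cabs (c i) <= 1.
  rewrite /c cabsM cabs_conj.
  have [->|n0] := eqVneq (f (P i x) y) 0; first by rewrite cabs0 mul0r.
  have p0 : 0 < cabs (f (P i x) y) by rewrite lt_neqAle cabs_ge0 eq_sym cabs_eq0 n0.
  by rewrite -realcV cabs_real ?invr_ge0 ?(ltW p0) // mulfV ?gt_eqF.
have -> : \sum_(i <- F) cabs (f (P i x) y)
    = complex.Re (f (\sum_(i <- F) c i *: P i x) y).
  rewrite (ip_suml fP) Re_sum; apply: eq_bigr => i _.
  by rewrite (ipZ fP) cE.
apply: le_trans (Re_le_cabs _) _; apply: le_trans (cauchy_schwarz fP _ _) _.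
rewrite ler_wpM2r ?ipnorm_ge0 //.
by have := pf_comb_le F x ler01 c1; rewrite mul1r.
Qed.

Lemma pf_residual (F : {fset I}) x :
  n2 (x - \sum_(i <- F) P i x) = n2 x - \sum_(i <- F) n2 (P i x).
Proof.
rewrite (sqnD fP) -scaleN1r (sqnZ fP) cabsN cabs1 expr1n mul1r scaleN1r.
have -> : n2 (\sum_(i <- F) P i x) = \sum_(i <- F) n2 (P i x).
  have := pf_comb F (fun=> 1) x; under eq_bigr do rewrite scale1r.
  by move=> ->; apply: eq_bigr => i _; rewrite cabs1 expr1n mul1r.
have -> : complex.Re (f x (- \sum_(i <- F) P i x)) = - \sum_(i <- F) n2 (P i x).
  rewrite (ipNr fP) (ip_sumr fP) ReN Re_sum; congr (- _).
  by apply: eq_bigr => i _; rewrite -(pf_adj PP) pf_sqnE.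
by ring.
Qed.

Lemma pf_approx x (e : R) : 0 < e ->
  \forall F \near totally, nrm (x - \sum_(i <- (F : {fset I})) P i x) < e.
Proof.
move=> e0; have e2 : 0 < e ^+ 2 by rewrite exprn_gt0.
have /cvgrPdist_lt /(_ _ e2) := pf_sum PP x.
apply: filterS => F hF.
rewrite -(@ltr_pXn2r _ 2) // ?nnegrE ?ipnorm_ge0 ?(ltW e0) //.
rewrite (ipnorm_sqr fP) pf_residual.
by apply: le_lt_trans hF; exact: ler_norm.
Qed.

Lemma pf_sum_norm_le (F : {fset I}) x : nrm (\sum_(i <- F) P i x) <= nrm x.
Proof.
have := @pf_comb_le F (fun=> 1) x 1 ler01; rewrite mul1r cabs1.
by under eq_bigr do rewrite scale1r; apply.
Qed.

End ProjectionFamily.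

Section HilbertSums.
Context {R : realType}.

Lemma inner_hassum {H : hilbertType R} {I : choiceType} (F : I -> H) (x y : H) :
  hassum F x -> hassum (fun i => inner (F i) y : R[i]^o) (inner x y : R[i]^o).
Proof.
move=> hF; apply: (cvg_extc (f := fun S => inner (partial_sum F S) y)).
  by move=> S; rewrite /partial_sum (ip_suml hilbert_semi_inner).
exact: inner_cvg.
Qed.

Lemma inner_hassumr {H : hilbertType R} {I : choiceType} (F : I -> H) (x y : H) :
  hassum F x -> hassum (fun i => inner y (F i) : R[i]^o) (inner y x : R[i]^o).
Proof.
move=> hF; apply: (cvg_extc (f := fun S => inner y (partial_sum F S))).
  by move=> S; rewrite /partial_sum (ip_sumr hilbert_semi_inner).
exact: inner_cvgr.
Qed.

Lemma rnorm_sum_orth {H : hilbertType R} {I : choiceType} (W : I -> H)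
    (F : {fset I}) : (forall i j, i != j -> inner (W i) (W j) = 0) ->
  rnorm (\sum_(i <- F) W i) ^+ 2 = \sum_(i <- F) rnorm (W i) ^+ 2.
Proof.
move=> hW; rewrite sqr_rnorm /sqn (ip_suml hilbert_semi_inner) Re_sum.
apply: eq_big_seq => i iF; rewrite (ip_sumr hilbert_semi_inner).
rewrite (big_fsetD1 i) //= big_seq big1 ?addr0 ?sqr_rnorm // => j.
by rewrite in_fsetD1 => /andP[ji _]; rewrite hW // eq_sym.
Qed.

Lemma orth_hassum {I : choiceType} (W : I -> ell2 R) (M : R) :
  (forall i j, i != j -> inner (W i) (W j) = 0) ->
  bounded_sums (fun i => rnorm (W i) ^+ 2) M ->
  exists2 x, hassum W x & rnorm x ^+ 2 <= M.
Proof.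
move=> hW hM; have M0 : 0 <= M by have := hM fset0; rewrite big_seq_fset0.
have [|x hx] := @hassum_cauchy _ _ _ W (@cauchy_cvg (ell2 R)).
  move=> e e0; have e2 : 0 < e ^+ 2 by rewrite exprn_gt0.
  have [|F0 hF0] := tail_small _ hM e2; first by move=> i; exact: sqr_ge0.
  exists F0 => F /hF0; rewrite -rnorm_sum_orth //.
  by rewrite ltr_pXn2r ?nnegrE ?rnorm_ge0 ?(ltW e0).
exists x => //; rewrite -[M]sqr_sqrtr // ler_pXn2r ?nnegrE ?rnorm_ge0 ?sqrtr_ge0 //.
apply: (hassum_le hx) => F.
rewrite -(@ler_pXn2r _ 2) ?nnegrE ?rnorm_ge0 ?sqrtr_ge0 //.
by rewrite [X in _ <= X]sqr_sqrtr // rnorm_sum_orth.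
Qed.

End HilbertSums.

Arguments inner_hassum {R H I F x} y _.
Arguments inner_hassumr {R H I F x} y _.

(* The part of the Hilbert space L^2(M, Tr) that the proof uses: [cp_U] is the
   action of Gam * Lam, [cp_w] the class of the fundamental domain q of Lam,
   [cp_A g] left multiplication by sigma_g(q) and [cp_B s] left multiplication
   by sigma_s(p), where p is the fundamental domain of Gam. *)
Record coupling (R : realType) (Gam Lam : groupType) (V : lmodType R[i])
    (f : V -> V -> R[i]) (U A : Gam * Lam -> V -> V) (B : Gam -> V -> V)
    (w : V) : Prop := {
  cp_ip : semi_inner f;
  cp_UD : forall g x y, U g (x - y) = U g x - U g y;
  cp_UM : forall g h x, U (g * h)%g x = U g (U h x);
  cp_Uiso : forall g x y, f (U g x) (U g y) = f x y;
  cp_A : forall s, projection_family f (fun t => A (s, t));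
  cp_B : projection_family f B;
  cp_AD : forall g x y, A g (x - y) = A g x - A g y;
  cp_UB : forall s r x, U (s, 1%g) (B r x) = B (s * r)%g (U (s, 1%g) x);
  cp_A1 : A 1%g w = w;
  cp_AA : forall g h, f (A g w) (A h w) = f (A (h^-1 * g)%g (A h^-1%g w)) w;
  cp_AU : forall g, f (A g w) w = f (U g w) w;
  cp_w : 0 < sqn f w }.

Section Transfer.
Context {R : realType} {Gam Lam : groupType} {V : lmodType R[i]}.
Context {f : V -> V -> R[i]} {U A : Gam * Lam -> V -> V} {B : Gam -> V -> V}.
Context {w : V}.
Hypothesis cp : coupling f U A B w.
Hypothesis countable_Gam : countable [set: Gam].
Hypothesis countable_Lam : countable [set: Lam].
Local Notation C := R[i].
Local Notation n2 := (sqn f).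
Local Notation nrm := (ipnorm f).
Local Notation T := (sqn f w).
Let fP := cp_ip cp.
Let AP s := cp_A cp s.

(** In L^2(M, Tr) this is [Tr(sigma_(s,u)(q) q) / Tr q]: here [s] and [u] act on the same copy of
    [q], and moving [u] to the other copy would invert it. *)
Definition mass (s : Gam) (u : Lam) : R := n2 (A (s, u) w) / T.

Lemma mass_ge0 s u : 0 <= mass s u.
Proof. by rewrite divr_ge0 ?(sqn_ge0 fP). Qed.

Lemma mass_bounded s : bounded_sums (mass s) 1.
Proof.
move=> F; rewrite /mass -mulr_suml ler_pdivrMr ?(cp_w cp) // mul1r.
exact: (pf_bounded fP (AP s)).
Qed.

Lemma mass_sum s : hassum (fun u => (mass s u)%:C : C^o) (1 : C^o).
Proof.
have h : (fun F : {fset Lam} => (\sum_(u <- F) n2 (A (s, u) w)) * T^-1) @ totally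
    --> (1 : R).
  rewrite -(@mulfV _ T) ?gt_eqF ?(cp_w cp) //.
  by apply: cvgM; [exact: pf_sum (AP s) w|exact: cvg_cst].
move/real_cvg : h => h.
apply: cvg_ext h => F.
by rewrite partial_sumE /= mulr_suml realc_sum.
Qed.

(** [w] lies in the range of [A (1, 1)], which is orthogonal to the range of every other [A (1, u)].
    This is what yields [hat phi 1 = phi 1]. *)
Lemma mass_one u : mass 1%g u = (u == 1%g)%:R.
Proof.
rewrite /mass; case: eqVneq => [->|u1].
  by rewrite (cp_A1 cp) mulfV // gt_eqF // (cp_w cp).
have := pf_orth fP (AP 1%g) w w u1.
rewrite -[A (1%g, 1%g) w]/(A 1%g w) (cp_A1 cp) (pf_sqnE fP (AP 1%g)).
by move=> /complexI ->; rewrite mul0r.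
Qed.

Definition transfer (phi : Lam -> C) (s : Gam) : C :=
  sum (fun u => phi u * (mass s u)%:C : C^o).

Lemma transferP (phi : Lam -> C) (c : R) s : (forall u, cabs (phi u) <= c) ->
  hassum (fun u => phi u * (mass s u)%:C : C^o) (transfer phi s : C^o) /\
  cabs (transfer phi s) <= c.
Proof.
move=> hc; have c0 : 0 <= c by apply: le_trans (hc 1%g); exact: cabs_ge0.
have [|l hl lc] := @hassum_abs _ _ (fun u => phi u * (mass s u)%:C) c.
  move=> F; apply: (@le_trans _ _ (\sum_(u <- F) c * mass s u)).
    apply: ler_sum => u _; rewrite cabsM cabs_real ?mass_ge0 //.
    by rewrite ler_wpM2r ?mass_ge0.
  by rewrite -mulr_sumr -[X in _ <= X]mulr1 ler_wpM2l ?mass_bounded.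
suff -> : transfer phi s = l by [].
exact: cvg_lim hl.
Qed.

Lemma transfer_unique (phi : Lam -> C) s (l : C) :
  hassum (fun u => phi u * (mass s u)%:C : C^o) (l : C^o) -> transfer phi s = l.
Proof. exact: cvg_lim. Qed.

(** * The bounded functional attached to a bounded function on Lam and an element of Gam *)

Section Functional.
Variables (phi : Lam -> C) (c : R) (h : Gam).
Hypothesis phic : forall u, cabs (phi u) <= c.

(** Formally [f (S x) w] for the operator [S = sum_u phi u A (h, u)], which is never formed:
    [pf_abs] gives absolute convergence directly. *)
Lemma functional_ex x : exists2 l : C,
  hassum (fun u => phi u * f (A (h, u) x) w : C^o) (l : C^o) &
  cabs l <= c * (nrm x * nrm w).
Proof.
have c0 : 0 <= c by apply: le_trans (phic 1%g); exact: cabs_ge0.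
apply: hassum_abs => F.
apply: (@le_trans _ _ (\sum_(u <- F) c * cabs (f (A (h, u) x) w))).
  by apply: ler_sum => u _; rewrite cabsM ler_wpM2r ?cabs_ge0.
by rewrite -mulr_sumr ler_wpM2l // (pf_abs fP (AP h)).
Qed.

Definition functional x : C := sval (cid2 (functional_ex x)).

Lemma functional_hassum x :
  hassum (fun u => phi u * f (A (h, u) x) w : C^o) (functional x : C^o).
Proof. by rewrite /functional; case: cid2. Qed.

Lemma functional_le x : cabs (functional x) <= c * (nrm x * nrm w).
Proof. by rewrite /functional; case: cid2. Qed.

Lemma functionalB x y : functional (x - y) = functional x - functional y.
Proof.
apply: (hassum_uniquec (@functional_hassum (x - y))).
apply: cvg_ext (cvg_subf (@functional_hassum x) (@functional_hassum y)) => F.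
rewrite /partial_sum -sumrB; apply: eq_bigr => u _.
by rewrite (cp_AD cp) (ipB fP) mulrBr.
Qed.

Lemma functional0 : functional 0 = 0.
Proof. by rewrite -(subrr 0) functionalB subrr. Qed.

Lemma functionalD x y : functional (x + y) = functional x + functional y.
Proof.
by rewrite -[in LHS](opprK y) functionalB -(sub0r y) functionalB functional0 sub0r opprK.
Qed.

Lemma functional_w : functional w = T%:C * transfer phi h.
Proof.
apply: (hassum_uniquec (@functional_hassum w)).
have [hh _] := transferP h phic.
move/(hassumM T%:C): hh; apply: hassum_extc => u.
rewrite (pf_sqnE fP (AP h)) /mass realcM realcV mulrCA; congr (_ * _).
by rewrite mulrCA mulfV ?mulr1 // (inj_eq (@complexI _) _ 0) gt_eqF ?(cp_w cp).
Qed.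

(* Summing over a translate of the partition of unity recovers w: this is what
   replaces the invariance of the Schur multiplier under Lam. *)
Lemma functional_resolution s :
  hassum (fun r => functional (A (s, r) w) : C^o) (functional w : C^o).
Proof.
have c0 : 0 <= c by apply: le_trans (phic 1%g); exact: cabs_ge0.
apply/cvg_cabsP => e e0.
have d0 : 0 < e / (c * nrm w + 1).
  by rewrite divr_gt0 // ltr_wpDl // mulr_ge0 // ipnorm_ge0.
have := pf_approx fP (AP s) w d0; apply: filterS => F hF.
rewrite partial_sumE.
have <- : functional (\sum_(r <- F) A (s, r) w)
    = \sum_(r <- F) functional (A (s, r) w).
  by apply: (big_morph functional); [exact: functionalD|exact: functional0].
rewrite -functionalB; apply: le_lt_trans (functional_le _) _.
move: hF; rewrite ltr_pdivlMr; last by rewrite ltr_wpDl // mulr_ge0 // ipnorm_ge0.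
apply: le_lt_trans; rewrite mulrCA ler_wpM2l ?ipnorm_ge0 // lerDl //.
Qed.

End Functional.

(** The index in [bool] allows one family [X] to serve both Herz-Schur multipliers, read off between
    the two blocks, and positive definite functions, read off inside one block. *)
Lemma transfer_gram (z : bool * Lam -> ell2 R) (c : R) :
  (forall x, rnorm (z x) ^+ 2 <= c) ->
  exists2 X : bool * Gam -> ell2 R, forall x, rnorm (X x) ^+ 2 <= c &
    forall b b' (phi : Lam -> C),
      (forall t r, phi (r^-1 * t)%g = inner (z (b, t)) (z (b', r))) ->
      forall s s', inner (X (b, s)) (X (b', s')) = transfer phi (s'^-1 * s)%g.
Proof.
move=> zc; have c0 : 0 <= c by apply: le_trans (zc (true, 1%g)); exact: sqr_ge0.
have T0 : 0 < T := cp_w cp.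
have TC0 : T%:C != 0 by rewrite (inj_eq (@complexI _) _ 0) gt_eqF.
(* The Gram kernel of the tensors [T^(-1/2) z (b, t) (x) A (s, t) w]; the vectors [W] realize it in
   [ell2], and [X] sums them over [t]. *)
pose K (x y : bool * Gam * Lam) : C :=
  inner (z (x.1.1, x.2)) (z (y.1.1, y.2)) *
  ((T^-1)%:C * f (A (x.1.2, x.2) w) (A (y.1.2, y.2) w)).
have cX : countable [set: bool * Gam * Lam].
  rewrite -setXTT; apply: countableX => //; rewrite -setXTT.
  by apply: countableX => //; exact: countableP.
have K_pd : pd_kernel K.
  apply: (pd_kernelM (true, 1%g, 1%g)) => //.
    exact: (@gram_pd _ _ _ _ (fun x : bool * Gam * Lam => z (x.1.1, x.2))
      (hilbert_semi_inner)).
  move=> n s a.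
  have := @gram_pd _ _ _ _ (fun x : bool * Gam * Lam => A (x.1.2, x.2) w) fP n s a.
  have Ti0 : 0 <= (T^-1)%:C by rewrite ler0c invr_ge0 ltW.
  move=> h; have := mulr_ge0 Ti0 h; rewrite mulr_sumr.
  under eq_bigr do rewrite mulr_sumr.
  by under eq_bigr do under eq_bigr do rewrite mulrCA.
have [W WE] := feature_map (true, 1%g, 1%g) cX K_pd.
have W_orth x i j : i != j -> inner (W (x, i)) (W (x, j)) = 0.
  by move=> ij; rewrite WE /K /= (pf_orth fP (AP _)) // !mulr0.
have W_norm x t : rnorm (W (x, t)) ^+ 2 <= c * mass x.2 t.
  rewrite sqr_rnorm /sqn WE /K /= (sqnE fP) (sqnE hilbert_semi_inner).
  rewrite -realcM Re_realM /= -sqr_rnorm [_^-1 * _]mulrC -/(mass _ _).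
  by rewrite ler_wpM2r ?mass_ge0.
have X_ex x : exists2 y, hassum (fun t => W (x, t)) y & rnorm y ^+ 2 <= c.
  apply: orth_hassum; first exact: W_orth.
  move=> F; apply: (@le_trans _ _ (\sum_(t <- F) c * mass x.2 t)).
    by apply: ler_sum => t _; exact: W_norm.
  by rewrite -mulr_sumr -[X in _ <= X]mulr1 ler_wpM2l // mass_bounded.
pose X x := sval (cid2 (X_ex x)).
have X_sum x : hassum (fun t => W (x, t)) (X x) by rewrite /X; case: cid2.
have X_norm x : rnorm (X x) ^+ 2 <= c by rewrite /X; case: cid2.
exists X => // b b' phi phiE s s'.
have phic u : cabs (phi u) <= c.
  rewrite -[u]mul1g -invg1 phiE; apply: le_trans (cauchy_schwarz hilbert_semi_inner _ _) _.
  rewrite -!rnorm_inner -[c]sqr_sqrtr // expr2.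
  have sq x : rnorm (z x) <= Num.sqrt c.
    rewrite -(@ler_pXn2r _ 2) ?nnegrE ?rnorm_ge0 ?sqrtr_ge0 //.
    by rewrite [X in _ <= X]sqr_sqrtr.
  by apply: ler_pM; rewrite ?rnorm_ge0.
pose h := (s'^-1 * s)%g.
(* With [r] fixed and [t = r u], [cp_AA] rewrites the pairing of [A (s, t) w] with [A (s', r) w] as
   that of [A (h, u) (A (s'^-1, r^-1) w)] with [w]; the sum over [u] is then a value of the
   functional. *)
have step r : inner (X (b, s)) (W (b', s', r))
    = (T^-1)%:C * functional h phic (A (s'^-1, r^-1)%g w).
  apply: (hassum_uniquec (inner_hassum (W (b', s', r)) (@X_sum (b, s)))).
  have := hassum_reindex (fun t => r^-1 * t)%g (fun u => r * u)%g (mulVKg r)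
    (mulKg r) (hassumM (T^-1)%:C
      (@functional_hassum phi c h phic (A (s'^-1, r^-1)%g w))).
  apply: hassum_extc => t.
  rewrite WE /K /= -phiE (cp_AA cp) mulrCA; congr (_ * (_ * f (A _ _) _)).
(* As [r] runs over Lam so does [r^-1], so the vectors [A (s'^-1, r^-1) w] resolve [w], and the
   total is the functional at [w] divided by [T]. *)
apply: (hassum_uniquec (inner_hassumr (X (b, s)) (@X_sum (b', s')))).
have := hassum_reindex (fun r => r^-1)%g (fun r => r^-1)%g (@invgK _) (@invgK _)
  (hassumM (T^-1)%:C (@functional_resolution phi c h phic s'^-1%g)).
rewrite functional_w realcV mulKf //.
by apply: hassum_extc => r; rewrite step realcV.
Qed.

End Transfer.

(** * Bounds, finitely supported approximants and decay of transferred functions *)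

Section Approximation.
Context {R : realType} {Gam Lam : groupType} {V : lmodType R[i]}.
Context {f : V -> V -> R[i]} {U A : Gam * Lam -> V -> V} {B : Gam -> V -> V}.
Context {w : V}.
Hypothesis cp : coupling f U A B w.
Hypothesis countable_Gam : countable [set: Gam].
Hypothesis countable_Lam : countable [set: Lam].
Local Notation C := R[i].
Local Notation n2 := (sqn f).
Local Notation nrm := (ipnorm f).
Local Notation T := (sqn f w).
Local Notation hat := (@transfer R Gam Lam V f A w).
Local Notation mass := (@mass R Gam Lam V f A w).
Let fP := cp_ip cp.

Lemma transfer_schur_le (phi : Lam -> C) (c : R) :
  schur_le phi c -> schur_le (hat phi) c.
Proof.
case=> K [hK Kc KE].
have countable_bL : countable [set: bool * Lam].
  by rewrite -setXTT; apply: countableX => //; exact: countableP.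
have [z zE] := feature_map (true, 1%g) countable_bL hK.
have zc x : rnorm (z x) ^+ 2 <= c by rewrite sqr_rnorm /sqn zE.
have [X Xc XE] := transfer_gram cp countable_Gam countable_Lam zc.
exists (fun x y => inner (X x) (X y)); split.
- exact: (gram_pd _ hilbert_semi_inner).
- by move=> x; rewrite -/(sqn _ _) -sqr_rnorm.
- by move=> s t; apply: XE => u r; rewrite zE KE.
Qed.

Lemma positive_definite_schur_le {G : groupType} (phi : G -> C) :
  positive_definite phi -> phi 1%g = 1 -> schur_le phi 1.
Proof.
move=> hphi phi1; exists (fun x y => phi (y.2^-1 * x.2)%g); split=> //.
by move=> x; rewrite mulVg phi1.
Qed.

Lemma transfer_positive_definite (phi : Lam -> C) :
  positive_definite phi -> phi 1%g = 1 ->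
  positive_definite (hat phi) /\ hat phi 1%g = 1.
Proof.
move=> hphi phi1; split.
  have hK : pd_kernel (fun x y : Lam => phi (y^-1 * x)%g) by exact: hphi.
  have [z zE] := feature_map 1%g countable_Lam hK.
  have zc (x : bool * Lam) : rnorm (z x.2) ^+ 2 <= 1.
    by rewrite sqr_rnorm /sqn zE mulVg phi1.
  have [X _ XE] := transfer_gram cp countable_Gam countable_Lam zc.
  move=> n s c.
  have := @gram_pd _ _ _ _ (fun t => X (true, t)) hilbert_semi_inner n s c.
  congr (_ <= _); apply: eq_bigr => i _; apply: eq_bigr => j _; congr (_ * _).
  by apply: XE => t r; rewrite zE.
have phic u : cabs (phi u) <= 1.
  exact: (schur_le_bound countable_Lam) (positive_definite_schur_le hphi phi1).
have [h _] := transferP cp 1%g phic.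
apply: (hassum_uniquec h).
have := @hassum_finite R _ C^o (fun u => phi u * (mass 1%g u)%:C : C^o) [fset 1%g]%fset.
rewrite big_seq_fset1 (mass_one cp) eqxx mulr1 phi1; apply => u.
by rewrite inE (mass_one cp) => /negPf ->; rewrite mulr0.
Qed.

(** [U] preserves the form, so the coefficient at [t^-1 s] is the inner product of [U (s, 1) x] and
    [U (t, 1) y]. *)
Lemma coefficient_schur_le (x y : V) (c : R) : 0 < c -> nrm x * nrm y <= c ->
  schur_le (fun s => f (U (s, 1%g) x) y) c.
Proof.
move=> c0 xyc.
have [y0|yn0] := eqVneq (nrm y) 0.
  exists (fun _ _ => 0); split.
  - by move=> n s a; rewrite big1 // => i _; rewrite big1 // => j _; rewrite mulr0.
  - by move=> _; exact: ltW.
  - move=> s t; rewrite (ip_sqn0 fP) //.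
    by rewrite -(ipnorm_sqr fP) y0 expr0n.
have y0 : 0 < nrm y by rewrite lt_neqAle eq_sym yn0 ipnorm_ge0.
(* Balances the two vectors: [q y] has norm [sqrt c], and [x / q] has norm
   [nrm x * nrm y / sqrt c <= sqrt c]. *)
pose q : R := Num.sqrt c / nrm y.
have q0 : 0 < q by rewrite divr_gt0 // sqrtr_gt0.
have Uiso g z : n2 (U g z) = n2 z by rewrite /sqn (cp_Uiso cp).
pose z (v : bool * Gam) : V :=
  if v.1 then (q^-1)%:C *: U (v.2, 1%g) x else q%:C *: U (v.2, 1%g) y.
exists (fun u v => f (z u) (z v)); split.
- exact: gram_pd.
- move=> [b s]; rewrite -/(sqn _ _) /z /=; case: b;
    rewrite (sqnZ fP) Uiso cabs_real ?invr_ge0 ?(ltW q0) //.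
    rewrite -(ipnorm_sqr fP) -exprMn /q invf_div.
    rewrite -[X in _ <= X](@sqr_sqrtr _ c) ?(ltW c0) //.
    rewrite ler_pXn2r ?nnegrE ?sqrtr_ge0 ?mulr_ge0 ?invr_ge0 ?ipnorm_ge0 ?sqrtr_ge0 //.
    rewrite mulrAC ler_pdivrMr ?sqrtr_gt0 // mulrC -expr2 sqr_sqrtr ?(ltW c0) //.
  by rewrite -(ipnorm_sqr fP) -exprMn /q divfK // sqr_sqrtr // ltW.
- move=> s t; rewrite /z /= (ipZ fP) (ipZr fP) conj_real mulrA -realcM.
  rewrite mulVf ?gt_eqF // mul1r.
  have -> : (s, 1%g) = ((t, 1%g) * (t^-1 * s, 1%g))%g :> Gam * Lam.
    by congr pair; rewrite /= ?mulVKg ?mulg1.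
  by rewrite (cp_UM cp) (cp_Uiso cp).
Qed.

Lemma mass_coefficient s t :
  (mass s t)%:C = (T^-1)%:C * f (U (s, 1%g) (U (1%g, t) w)) w.
Proof.
rewrite -(cp_UM cp).
have -> : ((s, 1%g) * (1%g, t))%g = (s, t) :> Gam * Lam.
  by congr pair; rewrite /= ?mul1g ?mulg1.
by rewrite -(cp_AU cp) (pf_sqnE fP (cp_A cp s)) -realcM mulrC.
Qed.

(** [U (s, 1)] carries the range of [B b] into that of [B (s b)], which is orthogonal to the range
    of [B a] unless [s = a b^-1]. *)
Lemma truncated_coefficient_support (x y : V) (F : {fset Gam}) :
  finitely_supported (fun s => f (U (s, 1%g) (\sum_(r <- F) B r x))
    (\sum_(r <- F) B r y)).
Proof.
apply: (@sub_finite_set _ _ [set` [fset (a * b^-1)%g | a in F, b in F]%fset]);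
  last exact: finite_fset.
move=> s /= hs; apply: contrapT => sF; move/eqP: hs; apply.
have U_sum : U (s, 1%g) (\sum_(r <- F) B r x) = \sum_(r <- F) U (s, 1%g) (B r x).
  have U0 : U (s, 1%g) 0 = 0 by have := cp_UD cp (s, 1%g) 0 0; rewrite !subrr.
  have UN z : U (s, 1%g) (- z) = - U (s, 1%g) z by rewrite -sub0r (cp_UD cp) U0 sub0r.
  by apply: (big_morph (U (s, 1%g))) => // a b; rewrite -{1}[b]opprK (cp_UD cp) UN opprK.
rewrite U_sum (ip_suml fP) big_seq big1 // => b bF.
rewrite (ip_sumr fP) big_seq big1 // => a aF.
rewrite (cp_UB cp) (pf_orth fP (cp_B cp)) //.
apply: contra_notN sF => /eqP sba.
by apply/imfset2P; exists a => //; exists b => //; rewrite -sba mulgK.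
Qed.

(** The two vectors of the coefficient are truncated one at a time; each difference is again a
    coefficient, now with one short vector, hence of small Schur bound. *)
Lemma mass_approx t (e : R) : 0 < e -> exists psi : Gam -> C,
  finitely_supported psi /\ schur_le (fun s => (mass s t)%:C - psi s) e.
Proof.
move=> e0; have T0 : 0 < T := cp_w cp.
pose x := U (1%g, t) w.
(* There are two truncation errors, and the coefficient is divided by [T]. [D] exceeds the norms of
   both vectors. *)
pose d := e * T / 2.
have d0 : 0 < d by rewrite divr_gt0 // mulr_gt0.
pose D := nrm x + nrm w + 1.
have D0 : 0 < D by rewrite ltr_wpDl // addr_ge0 // ipnorm_ge0.
have dD0 : 0 < d / D by rewrite divr_gt0.
have [F [Fx Fw]] : exists F : {fset Gam},
    nrm (x - \sum_(r <- F) B r x) < d / D /\ nrm (w - \sum_(r <- F) B r w) < d / D.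
  have h1 := pf_approx fP (cp_B cp) x dD0.
  have h2 := pf_approx fP (cp_B cp) w dD0.
  exact: filter_ex (filterI h1 h2).
set x' := \sum_(r <- F) B r x in Fx *; set w' := \sum_(r <- F) B r w in Fw *.
exists (fun s => (T^-1)%:C * f (U (s, 1%g) x') w'); split.
  apply: sub_finite_set (truncated_coefficient_support x w F) => s /=.
  by apply: contra_neq => ->; rewrite mulr0.
have x'x : nrm x' <= nrm x by exact: (pf_sum_norm_le fP (cp_B cp)).
have s1 : schur_le (fun s => f (U (s, 1%g) (x - x')) w) d.
  apply: coefficient_schur_le => //; rewrite -[d](divfK (lt0r_neq0 D0)).
  apply: ler_pM; rewrite ?ipnorm_ge0 ?(ltW Fx) //.
  by rewrite /D addrAC lerDr addr_ge0 // ipnorm_ge0.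
have s2 : schur_le (fun s => f (U (s, 1%g) x') (w - w')) d.
  apply: coefficient_schur_le => //; rewrite -[d](divfK (lt0r_neq0 D0)) mulrC.
  apply: ler_pM; rewrite ?ipnorm_ge0 ?(ltW Fw) //.
  by apply: le_trans x'x _; rewrite /D -addrA lerDl addr_ge0 // ipnorm_ge0.
have := schur_leZ (T^-1)%:C (schur_leD s1 s2).
have -> : cabs (T^-1)%:C * (d + d) = e.
  rewrite cabs_real ?invr_ge0 ?(ltW T0) // /d; field.
  by rewrite gt_eqF.
congr schur_le; apply/funext => s; rewrite mass_coefficient -/x -mulrBr; congr (_ * _).
by rewrite (cp_UD cp) (ipB fP) (ipBr fP); ring.
Qed.

Lemma finitely_supported_fset {G : choiceType} (phi : G -> C) :
  finite_set [set s | phi s != 0] ->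
  exists F : {fset G}, forall s, s \notin F -> phi s = 0.
Proof.
move=> fin; exists (fset_set [set s | phi s != 0]) => s.
by rewrite in_fset_set // notin_setE /= => /negP; rewrite negbK => /eqP.
Qed.

Lemma transfer_approx (phi : Lam -> C) (e : R) : 0 < e -> finitely_supported phi ->
  exists psi : Gam -> C,
    finitely_supported psi /\ schur_le (fun s => hat phi s - psi s) e.
Proof.
move=> e0 /finitely_supported_fset[F phiF].
pose D := \sum_(t <- F) cabs (phi t) + 1.
have D0 : 0 < D by rewrite ltr_wpDl // sumr_ge0 // => t _; exact: cabs_ge0.
have eD : 0 < e / D by rewrite divr_gt0.
pose psi t := projT1 (cid (mass_approx t eD)).
have psi_fin t : finitely_supported (psi t) by rewrite /psi; case: cid => ? [].
have psi_le t : schur_le (fun s => (mass s t)%:C - psi t s) (e / D).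
  by rewrite /psi; case: cid => ? [].
exists (fun s => \sum_(t <- F) phi t * psi t s); split.
  apply: (@sub_finite_set _ _ (\bigcup_(t in [set` F]) [set s | psi t s != 0])).
    move=> s /=; apply: contraPP => hs; apply/negP; rewrite negbK; apply/eqP.
    rewrite big_seq big1 // => t tF; have [->|p0] := eqVneq (psi t s) 0.
      by rewrite mulr0.
    by case: hs; exists t.
  by apply: bigcup_finite => // t _; exact: psi_fin.
apply: (@schur_le_trans _ _ _ (\sum_(t <- F) cabs (phi t) * (e / D))); last first.
  rewrite -mulr_suml mulrA ler_pdivrMr // mulrC ler_wpM2l ?(ltW e0) //.
  by rewrite /D lerDl.
have := schur_le_sum F (fun t => schur_leZ (phi t) (psi_le t)).
congr schur_le; apply/funext => s.
rewrite (@transfer_unique _ _ _ _ _ _ _ phi s (\sum_(t <- F) phi t * (mass s t)%:C)).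
  by rewrite -sumrB; apply: eq_bigr => t _; rewrite mulrBr.
apply: (@hassum_finite _ _ C^o) => t /phiF ->.
by rewrite mul0r.
Qed.

(** Cut [phi] at height [e / 2]. The high part has finite support, so its transfer is within [e / 4]
    of a finitely supported [psi]; the low part is averaged to at most [e / 2]. Off the support of
    [psi] the sum is at most [3 e / 4]. *)
Lemma transfer_c0 (phi : Lam -> C) (c : R) :
  (forall u, cabs (phi u) <= c) -> c0 phi -> c0 (hat phi).
Proof.
move=> phic phi0 e e0.
have e2 : 0 < e / 2 by rewrite divr_gt0.
have e4 : 0 < e / 4 by rewrite divr_gt0.
pose p1 u : C := if e / 2 <= cabs (phi u) then phi u else 0.
pose p2 u : C := if e / 2 <= cabs (phi u) then 0 else phi u.
have fin1 : finitely_supported p1.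
  apply: sub_finite_set (phi0 _ e2) => u /=; rewrite /p1.
  by case: ifP => //; rewrite eqxx.
have [psi [psi_fin psi_le]] := transfer_approx e4 fin1.
apply: sub_finite_set psi_fin => s /= hs; apply/eqP => psi0.
have c0 : 0 <= c by apply: le_trans (phic 1%g); exact: cabs_ge0.
have b1 u : cabs (p1 u) <= c by rewrite /p1; case: ifP => // _; rewrite cabs0.
have b2 u : cabs (p2 u) <= e / 2.
  by rewrite /p2; case: ifPn => [_|]; [rewrite cabs0 ltW|rewrite -ltNge => /ltW].
have [h1 _] := transferP cp s b1; have [h2 le2] := transferP cp s b2.
have hE : hat phi s = hat p1 s + hat p2 s.
  apply: transfer_unique; apply: hassum_extc (hassumD h1 h2) => u.
  by rewrite -mulrDl /p1 /p2; case: ifP; rewrite ?addr0 ?add0r.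
have := schur_le_bound countable_Gam s psi_le; rewrite psi0 subr0 => le1.
have := cabsD (hat p1 s) (hat p2 s); rewrite -hE.
have hs' : e <= cabs (hat phi s) by exact: hs.
move: le1 le2 hs' e0; lra.
Qed.

End Approximation.

(** * The duality between Q and B2 *)

Section Pairing.
Context {R : realType} {G : groupType}.
Hypothesis countable_G : countable [set: G].
Local Notation C := R[i].
Implicit Types (g : G -> C) (u v : G -> C).

Lemma l1P g : l1 g <-> exists M, bounded_sums (fun s => cabs (g s)) M.
Proof.
split=> [h|[M hM]].
  exists (fine (\esum_(s in [set: G]) (cabs (g s))%:E)) => F.
  rewrite -lee_fin fineK; last first.
    by rewrite ge0_fin_numE // esum_ge0 // => s _; rewrite lee_fin cabs_ge0.
  apply: esum_ge; exists [set` F]; first by split.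
  by rewrite fsbig_finite //= set_fsetK sumEFin.
apply: (@le_lt_trans _ _ M%:E); last exact: ltry.
apply: ge_ereal_sup => _ [A [finA _] <-].
by rewrite fsbig_finite //= sumEFin lee_fin; exact: hM.
Qed.

Lemma l1B g g' : l1 g -> l1 g' -> l1 (g \- g').
Proof.
move=> /l1P[M hM] /l1P[M' hM']; apply/l1P.
exists (M + M') => S; apply: le_trans (lerD (hM S) (hM' S)).
rewrite -big_split /=; apply: ler_sum => s _.
by apply: le_trans (cabsD _ _) _; rewrite cabsN.
Qed.

Lemma pairingP g u (M c : R) : bounded_sums (fun s => cabs (g s)) M ->
  (forall s, cabs (u s) <= c) ->
  hassum (fun s => g s * u s : C^o) (pairing g u : C^o) /\
  cabs (pairing g u) <= M * c.
Proof.
move=> gM uc; have c0 : 0 <= c by apply: le_trans (uc 1%g); exact: cabs_ge0.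
have [|l hl lc] := @hassum_abs _ _ (fun s => g s * u s) (M * c).
  move=> F; apply: (@le_trans _ _ (\sum_(s <- F) cabs (g s) * c)).
    by apply: ler_sum => s _; rewrite cabsM ler_wpM2l ?cabs_ge0.
  by rewrite -mulr_suml ler_wpM2r.
suff -> : pairing g u = l by [].
exact: cvg_lim hl.
Qed.

Lemma pairing_unique g u (l : C) :
  hassum (fun s => g s * u s : C^o) (l : C^o) -> pairing g u = l.
Proof. exact: cvg_lim. Qed.

Lemma pairingZ g u c (k : C) : l1 g -> (forall s, cabs (u s) <= c) ->
  pairing g (fun s => k * u s) = k * pairing g u.
Proof.
move=> /l1P[M gM] uc; have [h _] := pairingP gM uc.
apply: pairing_unique; move/(hassumM k) : h; apply: hassum_extc => s.
by rewrite mulrCA.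
Qed.

Lemma pairingBr g u v c c' : l1 g ->
  (forall s, cabs (u s) <= c) -> (forall s, cabs (v s) <= c') ->
  pairing g (fun s => u s - v s) = pairing g u - pairing g v.
Proof.
move=> /l1P[M gM] uc vc; have [h _] := pairingP gM uc; have [h' _] := pairingP gM vc.
apply: pairing_unique; have := hassumD h (hassumM (-1) h').
rewrite mulN1r; apply: hassum_extc => s; rewrite mulrBr; ring.
Qed.

Lemma pairingB g g' u c : l1 g -> l1 g' -> (forall s, cabs (u s) <= c) ->
  pairing (g \- g') u = pairing g u - pairing g' u.
Proof.
move=> /l1P[M gM] /l1P[M' gM'] uc.
have [h _] := pairingP gM uc; have [h' _] := pairingP gM' uc.
apply: pairing_unique; have := hassumD h (hassumM (-1) h').
rewrite mulN1r; apply: hassum_extc => s /=; ring.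
Qed.

(** The slack [e] is there because the norm is an infimum and [norm_schur_le] asks for a strict
    inequality. *)
Lemma B2_ball_schur_le u e : B2 u -> (B2_norm u <= 1)%E -> 0 < e -> schur_le u (1 + e).
Proof.
move=> _ u1 e0; apply: norm_schur_le => //; apply: le_lt_trans u1 _.
by rewrite lte_fin ltrDl.
Qed.

Lemma Q_norm_ge0 g : (0 <= Q_norm g)%E.
Proof.
have h0 : schur_le (fun _ : G => 0 : C) 0.
  exists (fun _ _ => 0); split => //.
  by move=> n s a; rewrite big1 // => i _; rewrite big1 // => j _; rewrite mulr0.
apply: (@le_trans _ _ (cabs (pairing g (fun=> 0)))%:E).
  by rewrite lee_fin cabs_ge0.
apply: ereal_sup_ubound; exists (fun=> 0) => //; split.
  exact: (schur_le_B2 countable_G h0).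
by apply: le_trans (schur_le_norm countable_G h0) _; rewrite lee_fin.
Qed.

Lemma Q_norm_fin g : l1 g -> exists q : R, Q_norm g = q%:E.
Proof.
move=> /l1P[M gM]; exists (fine (Q_norm g)); rewrite fineK //.
(* [1 + 1] is the bound on the unit ball of B2 with slack 1; only finiteness matters. *)
rewrite ge0_fin_numE ?Q_norm_ge0 //; apply: (@le_lt_trans _ _ (M * (1 + 1))%:E).
  apply: ge_ereal_sup => _ [u [u2 u1] <-]; rewrite lee_fin.
  have h := B2_ball_schur_le u2 u1 ltr01.
  by have [] := pairingP gM (fun s => schur_le_bound countable_G s h).
exact: ltry.
Qed.

Lemma pairing_le_Q_norm g u (e q : R) : l1 g -> 0 < e -> schur_le u e ->
  (Q_norm g <= q%:E)%E -> cabs (pairing g u) <= q * e.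
Proof.
move=> hg e0 hu hq.
have he : schur_le (fun s => (e^-1)%:C * u s) 1.
  have := schur_leZ (e^-1)%:C hu.
  by rewrite cabs_real ?invr_ge0 ?(ltW e0) // mulVf ?gt_eqF.
rewrite -ler_pdivrMr // mulrC -lee_fin; apply: le_trans hq.
apply: ereal_sup_ubound; exists (fun s => (e^-1)%:C * u s).
  split; first exact: (schur_le_B2 countable_G he).
  exact: (schur_le_norm countable_G he).
rewrite (pairingZ _ hg (fun s => schur_le_bound countable_G s hu)).
by rewrite -/(cabs _) cabsM cabs_real ?invr_ge0 ?(ltW e0).
Qed.

Section QPairing.
Variable F : nat -> G -> C.
Hypothesis FQ : Q_cauchy F.

Lemma Q_pairing_cvg u (e : R) : 0 < e -> schur_le u e ->
  (fun n => pairing (F n) u : C^o) @ \oo --> (Q_pairing F u : C^o).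
Proof.
move=> e0 hu; have [F1 Fc] := FQ.
have [|l hl] := @complex_cauchy_cvg R _ \oo _ (fun n => pairing (F n) u).
  move=> d d0; have [N hN] := Fc _ (divr_gt0 (divr_gt0 d0 (ltr0n _ 2)) e0).
  exists [set n | (N <= n)%N]; first by exists N.
  move=> m n hm hn.
  have uc s := schur_le_bound countable_G s hu.
  rewrite -(pairingB (F1 m) (F1 n) uc).
  apply: le_lt_trans (pairing_le_Q_norm (l1B (F1 m) (F1 n)) e0 hu (hN m n hm hn)) _.
  by rewrite divfK ?gt_eqF // gtr_pMr // invf_lt1 ?ltr1n.
by rewrite /Q_pairing (cvg_lim _ hl).
Qed.

(** Beyond some [N] all terms are within Q-norm 1 of [F N], so the Q-norm of [F N] plus 1 serves.
    Uniformity in [u] is what allows a multiplier to be perturbed along a net. *)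
Lemma Q_pairing_bound : exists2 M : R, 0 <= M &
  forall u (e : R), 0 < e -> schur_le u e -> cabs (Q_pairing F u) <= M * e.
Proof.
have [F1 Fc] := FQ; have [N hN] := Fc 1 ltr01.
have [q qE] := Q_norm_fin (F1 N).
have q0 : 0 <= q by rewrite -lee_fin -qE Q_norm_ge0.
exists (q + 1); first by rewrite addr_ge0.
move=> u e e0 hu; rewrite -rnormo.
apply: (cvg_le_rnorm (Q_pairing_cvg e0 hu)); exists N => // n /= Nn.
have uc s := schur_le_bound countable_G s hu.
rewrite rnormo -[pairing (F n) u](subrK (pairing (F N) u)).
apply: le_trans (cabsD _ _) _; rewrite addrC mulrDl lerD //.
  by apply: pairing_le_Q_norm => //; rewrite qE.
rewrite -(pairingB (F1 n) (F1 N) uc).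
by apply: pairing_le_Q_norm (l1B (F1 n) (F1 N)) e0 hu _; exact: hN.
Qed.

Lemma Q_pairingB u v (e e' : R) : 0 < e -> 0 < e' -> schur_le u e -> schur_le v e' ->
  Q_pairing F (fun s => u s - v s) = Q_pairing F u - Q_pairing F v.
Proof.
move=> e0 e'0 hu hv; apply: (cvg_lim (@norm_hausdorff _ C^o)).
apply: cvg_ext (cvg_subf (Q_pairing_cvg e0 hu) (Q_pairing_cvg e'0 hv)) => n /=.
have [F1 _] := FQ; rewrite (pairingBr (F1 n) (c := e) (c' := e')) //.
  by move=> s; exact: schur_le_bound hu.
by move=> s; exact: schur_le_bound hv.
Qed.

End QPairing.
End Pairing.

(** * Transfer of the approximation properties *)

Section Nets.
Context {R : realType}.
Local Notation C := R[i].

#[export] Instance tails_filter (I : directedSet) : Filter (tails I).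
Proof.
case: (dir_inhabited I) => i0.
apply: filter_fromT_filter; first by exists i0.
move=> i j; have [k [ik jk]] := dir_upper i j.
by exists k => l /= kl; split; [exact: dir_trans ik kl|exact: dir_trans jk kl].
Qed.

Section ProductWithNat.
Variable I : directedSet.

Definition net_le (x y : I * nat) := dir_le x.1 y.1 /\ (x.2 <= y.2)%N.

Lemma net_inhabited : inhabited (I * nat).
Proof. by case: (dir_inhabited I) => i; constructor; exact: (i, 0%N). Qed.

Lemma net_refl x : net_le x x.
Proof. by split => //; exact: dir_refl. Qed.

Lemma net_trans x y z : net_le x y -> net_le y z -> net_le x z.
Proof.
by move=> [xy xy'] [yz yz']; split; [exact: dir_trans xy yz|exact: leq_trans xy' yz'].
Qed.

Lemma net_upper x y : exists z, net_le x z /\ net_le y z.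
Proof.
have [k [xk yk]] := dir_upper x.1 y.1.
by exists (k, maxn x.2 y.2); do 2?split => //=; rewrite ?leq_maxl ?leq_maxr.
Qed.

(** The first coordinate selects a multiplier on Lam, the second the precision [1/(n+1)] of a
    finitely supported approximant of its transfer. *)
Definition net_prod : directedSet :=
  DirectedSet net_inhabited net_refl net_trans net_upper.

Lemma net_perturb (x : I -> C) (y : I * nat -> C) (l : C) (M : R) :
  (x : I -> C^o) @ tails I --> (l : C^o) ->
  (forall i n, cabs (x i - y (i, n)) <= M * n.+1%:R^-1) ->
  (y : net_prod -> C^o) @ tails net_prod --> (l : C^o).
Proof.
move=> /cvg_cabsP xl xy; apply/cvg_cabsP => e e0.
have e2 : 0 < e / 2 by rewrite divr_gt0.
have [i0 _ hi0] := xl _ e2.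
(* Large enough for [M / (n + 1) <= e / 2] whenever [n >= n0]. *)
pose n0 := Num.bound `|M / (e / 2)|.
exists ((i0, n0) : net_prod) => //= -[i n] [/= i0i n0n].
rewrite -[X in cabs X](subrKA (x i)); apply: le_lt_trans (cabsD _ _) _.
rewrite [e]splitr ltr_leD //; first exact: hi0.
apply: le_trans (xy i n) _; rewrite ler_pdivrMr ?ltr0n //.
rewrite mulrC -ler_pdivrMr //; apply: le_trans (ler_norm _) _.
apply: ltW; apply: lt_le_trans (archi_boundP _) _ => //.
by rewrite ler_nat (leq_trans n0n).
Qed.

End ProductWithNat.
End Nets.

Section TransferProperties.
Context {R : realType} {Gam Lam : groupType} {V : lmodType R[i]}.
Context {f : V -> V -> R[i]} {U A : Gam * Lam -> V -> V} {B : Gam -> V -> V}.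
Context {w : V}.
Hypothesis cp : coupling f U A B w.
Hypothesis countable_Gam : countable [set: Gam].
Hypothesis countable_Lam : countable [set: Lam].
Local Notation C := R[i].
Local Notation hat := (@transfer R Gam Lam V f A w).
Local Notation mass := (@mass R Gam Lam V f A w).

Lemma mass_cabs_bounded s : bounded_sums (fun u => cabs (mass s u)%:C) 1.
Proof.
move=> F; under eq_bigr do rewrite cabs_real ?(mass_ge0 cp) //.
exact: (mass_bounded cp).
Qed.

Lemma transfer_one s : hat (cst 1) s = 1.
Proof.
apply: transfer_unique; apply: hassum_extc (mass_sum cp s) => u.
by rewrite mul1r.
Qed.

Lemma transfer_pointwise (I : directedSet) (phi : I -> Lam -> C) (c : R) :
  (forall i u, cabs (phi i u) <= c) -> pointwise_cvg phi (cst 1) ->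
  pointwise_cvg (fun i => hat (phi i)) (cst 1).
Proof.
move=> phic phi1 s /=.
(* The common bound must also cover the limit function 1. *)
have phic' i u : cabs (phi i u) <= Num.max c 1 by rewrite le_max phic.
apply: (hassum_dominated (mass_cabs_bounded s) phic' (psi := cst 1)) => //.
- by move=> u /=; rewrite cabs1 le_max lexx orbT.
- by move=> i; have [] := transferP cp s (phic i).
- by apply: hassum_extc (mass_sum cp s) => u; rewrite mul1r.
Qed.

Lemma haagerup_transfer : haagerup R Lam -> haagerup R Gam.
Proof.
case=> I [phi [phiP phi1]]; exists I, (fun i => hat (phi i)).
have bound i u : cabs (phi i u) <= 1.
  have [pd p1 _] := phiP i.
  exact: (schur_le_bound countable_Lam) (positive_definite_schur_le pd p1).
split; last exact: transfer_pointwise bound phi1.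
move=> i; have [pd p1 p0] := phiP i.
have [hpd h1] := transfer_positive_definite cp countable_Gam countable_Lam pd p1.
split => //; exact: (transfer_c0 cp countable_Gam (bound i)).
Qed.

(** The properties only ask for some finite constant, so the slack of the infimum is fixed to be
    1. *)
Lemma B2_norm_schur_le {G : groupType} (phi : G -> C) (c : R) :
  (B2_norm phi <= c%:E)%E -> schur_le phi (c + 1).
Proof.
by move=> h; apply: norm_schur_le; apply: le_lt_trans h _; rewrite lte_fin ltrDl.
Qed.

Lemma weak_haagerup_transfer : weak_haagerup R Lam -> weak_haagerup R Gam.
Proof.
case=> c [I [phi [phiP phi1 phic]]]; exists (c + 1), I, (fun i => hat (phi i)).
have hs i := B2_norm_schur_le (phic i).
have hat_s i := transfer_schur_le cp countable_Gam countable_Lam (hs i).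
have bound i u := schur_le_bound countable_Lam u (hs i).
split.
- move=> i; split; first exact: schur_le_B2 (hat_s i).
  by apply: (transfer_c0 cp countable_Gam (bound i)); case: (phiP i).
- exact: transfer_pointwise bound phi1.
- by move=> i; exact: schur_le_norm (hat_s i).
Qed.

Lemma approximants (phi : Lam -> C) : finitely_supported phi ->
  exists psi : nat -> Gam -> C, forall n,
    finitely_supported (psi n) /\
    schur_le (fun s => hat phi s - psi n s) n.+1%:R^-1.
Proof.
move=> phi_fin.
have pos n : (0 : R) < n.+1%:R^-1 by rewrite invr_gt0 ltr0n.
pose ex n := transfer_approx cp (pos n) phi_fin.
by exists (fun n => projT1 (cid (ex n))) => n; case: cid.
Qed.

Lemma weakly_amenable_transfer : weakly_amenable R Lam -> weakly_amenable R Gam.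
Proof.
case=> c [I [phi [phi_fin phi1 phic]]].
have hs i := B2_norm_schur_le (phic i).
have hat_s i := transfer_schur_le cp countable_Gam countable_Lam (hs i).
have bound i u := schur_le_bound countable_Lam u (hs i).
pose psi i := projT1 (cid (approximants (phi_fin i))).
have psiP i n : finitely_supported (psi i n) /\
    schur_le (fun s => hat (phi i) s - psi i n s) n.+1%:R^-1.
  by rewrite /psi; case: cid.
(* One unit for the slack of the infimum, one for the approximation error [1/(n+1) <= 1]. *)
exists (c + 1 + 1), (net_prod I), (fun x => psi x.1 x.2); split.
- by move=> x; case: (psiP x.1 x.2).
- move=> s; apply: (@net_perturb _ _ (fun i => hat (phi i) s) _ _ 1).
    exact: transfer_pointwise bound phi1 s.
  move=> i n; rewrite mul1r; have [_ h] := psiP i n.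
  exact: (schur_le_bound countable_Gam s h).
- move=> [i n]; apply: (schur_le_norm countable_Gam).
  have [_ h] := psiP i n.
  have := schur_leD (hat_s i) (schur_leZ (-1) h).
  rewrite cabsN cabs1 mul1r => h'.
  have : schur_le (psi i n) (c + 1 + n.+1%:R^-1).
    by congr schur_le : h'; apply/funext => s /=; rewrite mulN1r subKr.
  move=> /schur_le_trans; apply; rewrite lerD2l invf_le1 ?ltr0n //.
  by rewrite ler1n.
Qed.

(* The map Q(Gam) -> Q(Lam) whose adjoint is phi |-> hat phi. *)
Definition cotransfer (g : Gam -> C) (u : Lam) : C :=
  pairing g (fun s => (mass s u)%:C).

Lemma mass_le1 s u : cabs (mass s u)%:C <= 1.
Proof.
by have := mass_cabs_bounded s [fset u]%fset; rewrite big_seq_fset1.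
Qed.

(** Each [mass s] has total at most 1, so averaging against these measures does not increase the l1
    norm. The sum over [u] is kept finite so that the limit over [s] can be taken outside it. *)
Lemma cotransfer_l1 g : l1 g -> l1 (cotransfer g).
Proof.
move=> /l1P[M gM]; apply/l1P; exists M => F.
have h u : hassum (fun s => g s * (mass s u)%:C : C^o) (cotransfer g u : C^o).
  by have [] := pairingP gM (fun s => mass_le1 s u).
have lim : (fun S : {fset Gam} => \sum_(u <- F)
    cabs (partial_sum (fun s => g s * (mass s u)%:C : C^o) S)) @ totally -->
    \sum_(u <- F) cabs (cotransfer g u).
  by apply: (@cvg_sumf _ R^o) => u; apply: (@cvg_rnorm _ C^o); exact: h.
rewrite -(cvg_lim _ lim) //; apply: limr_le.
  by apply/cvg_ex; eexists; exact: lim.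
near=> S; apply: (@le_trans _ _ (\sum_(u <- F) \sum_(s <- S)
    cabs (g s) * mass s u)).
  apply: ler_sum => u _; rewrite partial_sumE.
  apply: le_trans (cabs_sum _ _ _) _; apply: ler_sum => s _.
  by rewrite cabsM [X in _ * X]cabs_real ?(mass_ge0 cp).
rewrite exchange_big /=; apply: le_trans (gM S); apply: ler_sum => s _.
by rewrite -mulr_sumr -[X in _ <= X]mulr1 ler_wpM2l ?cabs_ge0 // (mass_bounded cp).
Unshelve. all: by end_near. Qed.

(** Exchange of the two sums, dominated by [|g s| c] times the probability weights [mass s]. *)
Lemma cotransfer_pairing g (phi : Lam -> C) (c : R) : l1 g ->
  (forall u, cabs (phi u) <= c) ->
  pairing (cotransfer g) phi = pairing g (hat phi).
Proof.
move=> /l1P[M gM] phic.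
have c0 : 0 <= c by apply: le_trans (phic 1%g); exact: cabs_ge0.
have [|||s u|||l hr hc] := @hassum_fubini R Gam Lam
  (fun s u => g s * (phi u * (mass s u)%:C)) (fun s => cabs (g s) * c)
  mass (M * c) (fun s => g s * hat phi s) (fun u => cotransfer g u * phi u).
- by move=> s; rewrite mulr_ge0 ?cabs_ge0.
- by move=> F; rewrite -mulr_suml ler_wpM2r.
- by move=> s; exact: (mass_bounded cp).
- rewrite !cabsM [X in _ * (_ * X)]cabs_real ?(mass_ge0 cp) // mulrA.
  by rewrite ler_wpM2r ?(mass_ge0 cp) // ler_wpM2l ?cabs_ge0.
- by move=> s; apply: hassumM; have [] := transferP cp s phic.
- move=> u; have [h _] := pairingP gM (fun s => mass_le1 s u).
  rewrite mulrC; move/(hassumM (phi u)) : h; apply: hassum_extc => s.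
  by rewrite mulrCA.
by rewrite (pairing_unique hr) (pairing_unique hc).
Qed.

Lemma cotransferB g g' : l1 g -> l1 g' ->
  cotransfer g \- cotransfer g' = cotransfer (g \- g').
Proof.
move=> hg hg'; apply/funext => u.
by rewrite /cotransfer (pairingB hg hg' (fun s => mass_le1 s u)).
Qed.

(** Dual to the contractivity of [hat]. Here [hat u] must lie in the closed unit ball itself, hence
    the bound [1 + e] for every [e > 0]. *)
Lemma cotransfer_Q_norm g : l1 g -> (Q_norm (cotransfer g) <= Q_norm g)%E.
Proof.
move=> hg; apply: ge_ereal_sup => _ [u [u2 u1] <-].
have h e : 0 < e -> schur_le u (1 + e) by exact: B2_ball_schur_le.
have hat_h e (e0 : 0 < e) := transfer_schur_le cp countable_Gam countable_Lam (h e e0).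
rewrite (cotransfer_pairing hg (fun s => schur_le_bound countable_Lam s (h 1 ltr01))).
apply: ereal_sup_ubound; exists (hat u) => //; split.
  exact: schur_le_B2 (hat_h 1 ltr01).
apply/lee_addgt0Pr => e e0; rewrite -EFinD.
exact: (schur_le_norm countable_Gam (hat_h e e0)).
Qed.

Lemma cotransfer_cauchy (F : nat -> Gam -> C) :
  Q_cauchy F -> Q_cauchy (fun n => cotransfer (F n)).
Proof.
move=> [F1 Fc]; split=> [n|e /Fc[N hN]]; first exact: cotransfer_l1.
exists N => m n hm hn; rewrite (cotransferB (F1 m) (F1 n)).
by apply: le_trans (cotransfer_Q_norm (l1B (F1 m) (F1 n))) _; exact: hN.
Qed.

Lemma cotransfer_Q_pairing (F : nat -> Gam -> C) (phi : Lam -> C) (c : R) :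
  Q_cauchy F -> (forall u, cabs (phi u) <= c) ->
  Q_pairing (fun n => cotransfer (F n)) phi = Q_pairing F (hat phi).
Proof.
move=> [F1 _] phic; rewrite /Q_pairing.
by under eq_fun do rewrite (cotransfer_pairing (F1 _) phic).
Qed.

Lemma finitely_supported_bounded {G : choiceType} (phi : G -> C) :
  finite_set [set s | phi s != 0] -> exists c, forall u, cabs (phi u) <= c.
Proof.
move=> /finitely_supported_fset[F hF]; exists (\sum_(u <- F) cabs (phi u)) => u.
have pos : 0 <= \sum_(u <- F) cabs (phi u) by apply: sumr_ge0 => v _; exact: cabs_ge0.
have [uF|/hF ->] := boolP (u \in F); last by rewrite cabs0.
rewrite (big_fsetD1 u) //= lerDl; apply: sumr_ge0 => v _; exact: cabs_ge0.
Qed.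

(** In (AP) no norm bound on the net is given, but the transfer of a finitely supported function is
    a finite combination of coefficients of [U], so it has some Schur bound. This gives access to
    the additivity of [Q_pairing]. *)
Lemma finitely_supported_coefficient_sum (phi : Lam -> C) :
  finitely_supported phi -> exists2 c : R, 0 < c & schur_le (hat phi) c.
Proof.
move=> /finitely_supported_fset[F phiF]; have fP := cp_ip cp.
pose d u := ipnorm f (U (1%g, u) w) * ipnorm f w + 1.
have d0 u : 0 < d u by rewrite ltr_wpDl // mulr_ge0 // ipnorm_ge0.
have mass_schur u : schur_le (fun s => (mass s u)%:C) (cabs ((sqn f w)^-1)%:C * d u).
  have h : schur_le (fun s => f (U (s, 1%g) (U (1%g, u) w)) w) (d u).
    by apply: (coefficient_schur_le cp) => //; rewrite lerDl.
  have := schur_leZ ((sqn f w)^-1)%:C h; congr schur_le.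
  by apply/funext => s; rewrite (mass_coefficient cp).
have := schur_le_sum F (fun u => schur_leZ (phi u) (mass_schur u)).
set c := \sum_(u <- F) _ => h.
exists (c + 1); first by rewrite ltr_wpDl // (schur_le_ge0 h).
apply: schur_le_trans (_ : c <= c + 1); last by rewrite lerDl.
move: h; congr schur_le; apply/funext => s; apply/esym/transfer_unique.
by apply: (@hassum_finite _ _ C^o) => u /phiF ->; rewrite mul0r.
Qed.

Lemma approximation_property_transfer :
  approximation_property R Lam -> approximation_property R Gam.
Proof.
case=> I [phi [phi_fin phi1]].
pose psi i := projT1 (cid (approximants (phi_fin i))).
have psiP i n : finitely_supported (psi i n) /\
    schur_le (fun s => hat (phi i) s - psi i n s) n.+1%:R^-1.
  by rewrite /psi; case: cid.
exists (net_prod I), (fun x => psi x.1 x.2); split.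
  by move=> x; case: (psiP x.1 x.2).
move=> F FQ; have [M M0 FM] := Q_pairing_bound countable_Gam FQ.
apply: (@net_perturb _ _ (fun i => Q_pairing F (hat (phi i))) _ _ M).
  have := phi1 _ (cotransfer_cauchy FQ).
  have one : forall u : Lam, cabs (cst 1 u : C) <= 1 by move=> u; rewrite cabs1.
  rewrite (cotransfer_Q_pairing FQ one).
  have -> : hat (cst 1) = cst 1 by apply/funext => s; rewrite transfer_one.
  apply: cvg_extc => i; have [c phic] := finitely_supported_bounded (phi_fin i).
  by rewrite (cotransfer_Q_pairing FQ phic).
move=> i n; have [_ h] := psiP i n.
have n0 : (0 : R) < n.+1%:R^-1 by rewrite invr_gt0 ltr0n.
have [c c0 hc] := finitely_supported_coefficient_sum (phi_fin i).
have -> : Q_pairing F (hat (phi i)) - Q_pairing F (psi i n)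
    = Q_pairing F (fun s => hat (phi i) s - psi i n s).
  (* Additivity is applied to [hat (phi i)] and to the error, whose Schur bounds are known;
     [psi i n] reappears as their difference. *)
  have := Q_pairingB countable_Gam FQ c0 n0 hc h.
  under eq_fun do rewrite subKr.
  by move=> ->; rewrite subKr.
exact: FM.
Qed.

End TransferProperties.

(** * The space of square-integrable operators *)

Section Polarization.
Context {R : realType} {V : lmodType R[i]}.
Variable N : V -> R.
Local Notation C := R[i].
Local Notation i := ('i%C : C).

Definition polar (x y : V) : C :=
  (4^-1)%:C * ((N (x + y) - N (x - y))%:C + i * (N (x + i *: y) - N (x - i *: y))%:C).

(** [quadD] and [quadr] are additivity and positive homogeneity in [x] of [N (x + y) - N (x - y)],
    with negative terms moved across so that both sides are nonnegative combinations of squares, as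
    a trace on the positive cone can handle. Negative scalars are added by [polarN]. *)
Record quadratic : Prop := {
  quad_ge0 : forall x, 0 <= N x;
  quadZ : forall a x, N (a *: x) = cabs a ^+ 2 * N x;
  quadD : forall x x' y, N (x + x' + y) + N (x - y) + N (x' - y) =
    N (x + x' - y) + N (x + y) + N (x' + y);
  quadr : forall (r : R) x y, 0 <= r ->
    N (r%:C *: x + y) + r * N (x - y) = N (r%:C *: x - y) + r * N (x + y) }.

Hypothesis NP : quadratic.

Lemma cabs_i : cabs i = 1.
Proof. by apply: complexI; rewrite -cabsE normc_def /= expr0n expr1n add0r sqrtr1. Qed.

Lemma mulii : i * i = -1.
Proof. by rewrite -expr2 sqr_i. Qed.

Lemma conj_cartesian (k a b : R) :
  (k%:C * (a%:C + i * b%:C))^* = k%:C * (a%:C + i * (- b)%:C).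
Proof.
have ci : i^* = - i by apply/eqP; rewrite eq_complex /= oppr0 !eqxx.
by rewrite rmorphM rmorphD rmorphM /= !conj_real ci realcN mulNr mulrN.
Qed.

Lemma quadi x : N (i *: x) = N x.
Proof. by rewrite (quadZ NP) cabs_i expr1n mul1r. Qed.

Lemma quadN x : N (- x) = N x.
Proof. by rewrite -scaleN1r (quadZ NP) cabsN cabs1 expr1n mul1r. Qed.

Lemma polar_self x : polar x x = (N x)%:C.
Proof.
rewrite /polar subrr -[X in N (X + X)]scale1r -scalerDl (quadZ NP).
rewrite -[X in N (X + i *: _)]scale1r -[X in N (X - i *: _)]scale1r.
rewrite -scalerDl -scalerBl !(quadZ NP) -(scale0r x) (quadZ NP) cabs0.
have -> : cabs (1 + 1 : C) ^+ 2 = 4.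
  by rewrite cabs_sqrE /= addr0 expr0n /= addr0; ring.
have -> : cabs (1 + i) ^+ 2 = cabs (1 - i) ^+ 2.
  by rewrite !cabs_sqrE /= !add0r oppr0 !addr0 sqrrN.
rewrite subrr mulr0 addr0 expr0n /= mul0r subr0 -realcM mulrA mulVf ?mul1r //.
Qed.

Lemma polarD x x' y : polar (x + x') y = polar x y + polar x' y.
Proof.
have h1 := quadD NP x x' y; have h2 := quadD NP x x' (i *: y).
rewrite /polar -mulrDr addrACA -mulrDr -!realcD; congr (_ * (_%:C + _ * _%:C)); lra.
Qed.

Lemma polarN x y : polar (- x) y = - polar x y.
Proof.
have e z : N (- x + z) = N (x - z) by rewrite -quadN opprD opprK.
have e' z : N (- x - z) = N (x + z) by rewrite -quadN opprD !opprK.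
by rewrite /polar !e' !e -[N _ - N (x + y)]opprB -[N _ - N (x + i *: y)]opprB
  !realcN mulrN -opprD mulrN.
Qed.

Lemma polari x y : polar (i *: x) y = i * polar x y.
Proof.
have e z : N (i *: x + i *: z) = N (x + z) by rewrite -scalerDr quadi.
have e' z : N (i *: x - i *: z) = N (x - z) by rewrite -scalerBr quadi.
have e1 : N (i *: x + y) = N (x - i *: y).
  by rewrite -[in RHS]quadi scalerBr scalerA mulii scaleN1r opprK.
have e2 : N (i *: x - y) = N (x + i *: y).
  by rewrite -[in RHS]quadi scalerDr scalerA mulii scaleN1r.
rewrite /polar e e' e1 e2 mulrCA; congr (_ * _).
by rewrite mulrDr mulrA mulii mulN1r addrC -realcN opprB.
Qed.

Lemma polar_realM (r : R) x y : 0 <= r -> polar (r%:C *: x) y = r%:C * polar x y.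
Proof.
move=> r0; have h1 := quadr NP x y r0; have h2 := quadr NP x (i *: y) r0.
rewrite /polar mulrCA; congr (_ * _); rewrite mulrDr mulrCA -!realcM.
congr (_%:C + _ * _%:C); lra.
Qed.

Lemma polar_semi_inner : semi_inner polar.
Proof.
split.
- exact: polarD.
- have real (r : R) x y : polar (r%:C *: x) y = r%:C * polar x y.
    have [r0|/ltW r0] := leP 0 r; first exact: polar_realM.
    rewrite -[r]opprK realcN scaleNr polarN polar_realM ?oppr_ge0 //.
    by rewrite mulNr.
  move=> a x z; rewrite [a]complexE scalerDl polarD -scalerA polari !real.
  by rewrite mulrDl mulrA.
- move=> x y; rewrite /polar conj_cartesian; congr (_ * _).
  rewrite [y + x]addrC -[y - x]opprB quadN; congr (_ + _).
  have -> : N (y + i *: x) = N (x - i *: y).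
    by rewrite -[in RHS]quadi scalerBr scalerA mulii scaleN1r opprK addrC.
  have -> : N (y - i *: x) = N (x + i *: y).
    by rewrite -quadN opprB -[in RHS]quadi scalerDr scalerA mulii scaleN1r.
  by rewrite opprB.
- by move=> x; rewrite polar_self ler0c (quad_ge0 NP).
Qed.

Lemma sqn_polar x : sqn polar x = N x.
Proof. by rewrite /sqn polar_self. Qed.

Lemma polar_adjoint (P : V -> V) : (forall y, P (i *: y) = i *: P y) ->
  (forall x y, N (P x + y) + N (x - P y) = N (P x - y) + N (x + P y)) ->
  forall x y, polar (P x) y = polar x (P y).
Proof.
move=> Pi h x y; have h1 := h x y; have h2 := h x (i *: y).
rewrite /polar -!Pi; congr (_ * (_%:C + _ * _%:C)); lra.
Qed.

Lemma polar_isometry (P : V -> V) : (forall y, P (i *: y) = i *: P y) ->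
  (forall x y, P (x + y) = P x + P y) -> (forall x y, P (x - y) = P x - P y) ->
  (forall x, N (P x) = N x) -> forall x y, polar (P x) (P y) = polar x y.
Proof.
by move=> Pi PD PB PN x y; rewrite /polar -Pi -!PD -!PB !PN.
Qed.

(** For a conjugate-linear [P], such as the adjoint, the two terms forming the imaginary part are
    exchanged, so the form is conjugated. *)
Lemma polar_anti_isometry (P : V -> V) : (forall y, P (i *: y) = - (i *: P y)) ->
  (forall x y, P (x + y) = P x + P y) -> (forall x y, P (x - y) = P x - P y) ->
  (forall x, N (P x) = N x) -> forall x y, polar (P x) (P y) = polar y x.
Proof.
move=> Pi PD PB PN x y.
rewrite (ipC polar_semi_inner x y) /polar conj_cartesian.
by rewrite -[i *: P y]opprK -Pi opprK -!PD -!PB !PN opprB.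
Qed.

End Polarization.

(** * Adjoints in the algebra and traces of sums of squares *)

Section OperatorAlgebra.
Context {R : realType} {H : hilbertType R}.
Variables (M : set (H -> H)) (Tr : (H -> H) -> \bar R).
Hypothesis vM : von_neumann_algebra M.
Hypothesis tM : faithful_normal_semifinite_trace M Tr.
Local Notation C := R[i].
Local Notation hP := (@hilbert_semi_inner R H).
Implicit Types (x y e : H -> H).

Lemma inner_eq (u v : H) : (forall z, inner u z = inner v z) -> u = v.
Proof.
move=> h; apply/eqP; rewrite -subr_eq0 -normr_eq0 -sqrf_eq0 inner_norm.
by rewrite (ipB hP) h subrr.
Qed.

Lemma adjoint_unique x y y' : is_adjoint x y -> is_adjoint x y' -> y = y'.
Proof.
move=> h h'; apply/funext => v; apply: inner_eq => z.
by rewrite (ipC hP) -h h' -(ipC hP).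
Qed.

Lemma is_adjointC x y : is_adjoint x y -> is_adjoint y x.
Proof. by move=> h u v; rewrite (ipC hP) -h -(ipC hP). Qed.

(** Operators being bare functions, the adjoint is selected inside [M]; when there is none the value
    is the junk [cst 0]. *)
Definition adj x : H -> H := xget (cst 0) [set y | M y /\ is_adjoint x y].

Lemma adjP x : M x -> M (adj x) /\ is_adjoint x (adj x).
Proof.
by move=> /(vna_adjoint vM)[y My xy]; apply: (@xgetPex _ (cst 0) [set y | M y /\ is_adjoint x y]); exists y.
Qed.

Lemma adj_mem x : M x -> M (adj x).
Proof. by move=> /adjP[]. Qed.

Lemma adj_inner x u v : M x -> inner (x u) v = inner u (adj x v).
Proof. by move=> /adjP[_]; apply. Qed.

Lemma adj_innerl x u v : M x -> inner (adj x u) v = inner u (x v).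
Proof. by move=> /adjP[_ /is_adjointC]; apply. Qed.

Lemma adj_unique x y : M x -> is_adjoint x y -> adj x = y.
Proof. by move=> /adjP[_ h] h'; exact: adjoint_unique h h'. Qed.

Lemma adjK x : M x -> adj (adj x) = x.
Proof.
by move=> Mx; apply: adj_unique; [exact: adj_mem|apply/is_adjointC; case: (adjP Mx)].
Qed.

Lemma M_linear x (a : C) u v : M x -> x (a *: u + v) = a *: x u + x v.
Proof. by move=> /(vna_bounded vM)[h _]; exact: h. Qed.

Lemma M0 : M 0.
Proof.
have := vna_scale vM 0 (vna_id vM); congr (M _).
by apply/funext => v /=; rewrite scale0r.
Qed.

Lemma MD x y : M x -> M y -> M (x + y).
Proof. exact: vna_add. Qed.

Lemma MZ (a : C) x : M x -> M (a *: x).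
Proof. exact: vna_scale. Qed.

Lemma MB x y : M x -> M y -> M (x - y).
Proof. by move=> Mx My; rewrite -scaleN1r; apply: MD => //; exact: MZ. Qed.

(** The squared L^2 norm, possibly infinite. *)
Definition trN x : \bar R := Tr (adj x \o x).

Lemma square_positive x : M x -> positive_part M (adj x \o x).
Proof.
move=> Mx; split; first by apply: (vna_mul vM) => //; exact: adj_mem.
by move=> v /=; rewrite adj_innerl // (ip_ge0 hP).
Qed.

Lemma trN_ge0 x : M x -> (0 <= trN x)%E.
Proof. by move=> Mx; apply: (trace_ge0 tM); exact: square_positive. Qed.

Definition weighted (l : seq (R * (H -> H))) : Prop :=
  forall p, p \in l -> 0 <= p.1 /\ M p.2.

Definition sum_squares (l : seq (R * (H -> H))) : H -> H :=
  \sum_(p <- l) p.1%:C *: (adj p.2 \o p.2).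

Lemma sum_squares_cons p l :
  sum_squares (p :: l) = p.1%:C *: (adj p.2 \o p.2) + sum_squares l.
Proof. by rewrite /sum_squares big_cons. Qed.

Lemma sum_squares_positive l : weighted l -> positive_part M (sum_squares l).
Proof.
elim: l => [_|p l IHl hl].
  rewrite /sum_squares big_nil; split; first exact: M0.
  by move=> v; rewrite /= (ip0l hP).
have [p0 Mp] := hl p (mem_head _ _).
have [M1 P1] := square_positive Mp.
have [|M2 P2] := IHl; first by move=> q ql; apply: hl; rewrite inE ql orbT.
rewrite sum_squares_cons; split; first by apply: MD => //; exact: MZ.
move=> v; rewrite -[(_ + _) v]/(p.1%:C *: (adj p.2 \o p.2) v + sum_squares l v).
by rewrite (ipD hP) (ipZ hP) addr_ge0 // mulr_ge0 // ler0c.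
Qed.

Lemma sum_squares_inner l v w : weighted l ->
  inner (sum_squares l v) w = \sum_(p <- l) p.1%:C * inner (p.2 v) (p.2 w).
Proof.
elim: l => [_|p l IHl hl].
  by rewrite /sum_squares !big_nil /= (ip0l hP).
have [p0 Mp] := hl p (mem_head _ _).
rewrite sum_squares_cons big_cons -IHl; last first.
  by move=> q ql; apply: hl; rewrite inE ql orbT.
rewrite -[(_ + _) v]/(p.1%:C *: (adj p.2 \o p.2) v + sum_squares l v).
by rewrite (ipD hP) (ipZ hP) /= adj_innerl.
Qed.

Lemma Tr0 : Tr 0 = 0%E.
Proof.
have p0 : positive_part M 0.
  by split; [exact: M0|move=> v; rewrite /= (ip0l hP)].
have := trace_scale tM (lexx 0) p0; rewrite mul0e; congr (Tr _ = _).
by apply/funext => v /=; rewrite scale0r.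
Qed.

Lemma sum_squares_trace l : weighted l ->
  Tr (sum_squares l) = (\sum_(p <- l) p.1%:E * trN p.2)%E.
Proof.
elim: l => [_|p l IHl hl].
  by rewrite /sum_squares !big_nil Tr0.
have [p0 Mp] := hl p (mem_head _ _).
have hl' : weighted l by move=> q ql; apply: hl; rewrite inE ql orbT.
rewrite sum_squares_cons big_cons -IHl // -(trace_scale tM p0 (square_positive Mp)).
apply: (trace_add tM); last exact: sum_squares_positive.
have [M1 P1] := square_positive Mp; split; first exact: MZ.
move=> v; rewrite -[(_ *: _) v]/(p.1%:C *: (adj p.2 \o p.2) v).
by rewrite (ipZ hP) mulr_ge0 // ler0c.
Qed.

(* The trace is only additive on the positive cone. All the identities that make
   L^2(M, Tr) a semi-inner product space are therefore arranged so that both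
   sides are sums of squares with nonnegative weights. *)
Lemma trN_identity l l' : weighted l -> weighted l' ->
  (forall v w, \sum_(p <- l) p.1%:C * inner (p.2 v) (p.2 w) =
               \sum_(p <- l') p.1%:C * inner (p.2 v) (p.2 w)) ->
  (\sum_(p <- l) p.1%:E * trN p.2 = \sum_(p <- l') p.1%:E * trN p.2)%E.
Proof.
move=> hl hl' h; rewrite -!sum_squares_trace //; congr Tr.
by apply/funext => v; apply: inner_eq => w; rewrite !sum_squares_inner.
Qed.

Lemma trN_adj x : M x -> trN (adj x) = trN x.
Proof.
move=> Mx; rewrite /trN adjK //; apply: (trace_tracial tM) => //.
  exact: adj_mem.
by apply/is_adjointC; case: (adjP Mx).
Qed.

Lemma trN_faithful x : M x -> trN x = 0%E -> x = 0.
Proof.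
move=> Mx /(trace_faithful tM (square_positive Mx)) h.
apply/funext => v; apply/eqP; rewrite -normr_eq0 -sqrf_eq0 inner_norm adj_inner //.
by rewrite -[adj x (x v)]/((adj x \o x) v) h (ip0r hP).
Qed.

Lemma projection_inner e u v : projection e -> inner (e u) (e v) = inner (e u) v.
Proof.
by move=> [ee ea]; rewrite -ea -[e (e u)]/((e \o e) u) ee.
Qed.

Lemma adj_projection e : M e -> projection e -> adj e = e.
Proof. by move=> Me [_ ea]; exact: adj_unique. Qed.

Lemma weighted2 (r s : R) x y : 0 <= r -> 0 <= s -> M x -> M y ->
  weighted [:: (r, x); (s, y)].
Proof. by move=> r0 s0 Mx My p; rewrite !inE => /orP[] /eqP ->. Qed.

(** Pythagoras at the level of operators: the squares of [e x] and of [x - e x] add up to the square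
    of [x]. *)
Lemma trN_projection_le e x : M e -> projection e -> M x ->
  (trN (e \o x) <= trN x)%E.
Proof.
move=> Me Pe Mx.
have Mex : M (e \o x) by exact: vna_mul.
have Mxe : M (x - (e \o x)) by exact: MB.
(* The second list is padded with a term of weight 0 so that [weighted2] applies. *)
have := trN_identity (weighted2 ler01 ler01 Mex Mxe)
  (weighted2 ler01 (lexx 0) Mx Mx).
rewrite !big_cons !big_nil /= !mul1e mul0e !adde0 => <-.
  by rewrite leeDl // trN_ge0.
move=> v w; rewrite !big_cons !big_nil /= !mul1r mul0r !addr0.
rewrite -[(x - (e \o x)) v]/(x v - e (x v)) -[(x - (e \o x)) w]/(x w - e (x w)).
rewrite (ipB hP) !(ipBr hP) (projection_inner _ _ Pe).
have -> : inner (x v) (e (x w)) = inner (e (x v)) (x w).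
  by case: Pe => _ ->.
ring.
Qed.

Lemma trN_D x y : M x -> M y ->
  (trN (x + y)%R + trN (x - y)%R = 2%:E * trN x + 2%:E * trN y)%E.
Proof.
move=> Mx My; have MDxy := MD Mx My; have MBxy := MB Mx My.
have := trN_identity (weighted2 ler01 ler01 MDxy MBxy)
  (weighted2 (ler0n _ 2) (ler0n _ 2) Mx My).
rewrite !big_cons !big_nil /= !mul1e !adde0; apply => v w.
rewrite !big_cons !big_nil /= !addr0 !mul1r.
rewrite -[(x + y) v]/(x v + y v) -[(x + y) w]/(x w + y w).
rewrite -[(x - y) v]/(x v - y v) -[(x - y) w]/(x w - y w).
rewrite (ipB hP) !(ipBr hP) (ipD hP) !(ipDr hP).
have -> : (2 : R)%:C = 2 :> C by rewrite rmorph_nat.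
ring.
Qed.

Lemma trN_Z (a : C) x : M x -> (trN (a *: x) = (cabs a ^+ 2)%:E * trN x)%E.
Proof.
move=> Mx; have MZx := MZ a Mx.
have := trN_identity (weighted2 ler01 (lexx 0) MZx MZx)
  (weighted2 (sqr_ge0 (cabs a)) (lexx 0) Mx Mx).
rewrite !big_cons !big_nil /= !mul0e mul1e !adde0; apply => v w.
rewrite !big_cons !big_nil /= !addr0 !mul0r !addr0 mul1r.
rewrite -[(a *: x) v]/(a *: x v) -[(a *: x) w]/(a *: x w).
by rewrite (ipZ hP) (ipZr hP) cabs_sqr mulrA.
Qed.

End OperatorAlgebra.

(** Bundled so that the type [L2] below depends on a single parameter and can carry a module
    structure. *)
Record tracial_algebra (R : realType) (H : hilbertType R) := TracialAlgebra {
  ta_M : set (H -> H);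
  ta_Tr : (H -> H) -> \bar R;
  ta_vna : von_neumann_algebra ta_M;
  ta_trace : faithful_normal_semifinite_trace ta_M ta_Tr }.

Section SquareIntegrable.
Context {R : realType} {H : hilbertType R}.
Variable D : tracial_algebra H.
Local Notation C := R[i].
Local Notation M := (ta_M D).
Local Notation trN := (trN M (ta_Tr D)).
Let vM := ta_vna D.
Let tM := ta_trace D.
Local Notation hP := (@hilbert_semi_inner R H).

Definition square_integrable : {pred (H -> H)} :=
  fun x => `[< M x /\ (trN x < +oo)%E >].

Lemma square_integrable_submod : submod_closed square_integrable.
Proof.
split=> [|a x y].
  apply/asboolP; split; first exact: (M0 vM).
  by have := trN_Z vM tM 0 (M0 vM); rewrite scaler0 cabs0 expr0n /= mul0e => ->.
move=> /asboolP[Mx Nx] /asboolP[My Ny]; have MaX := MZ vM a Mx.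
apply/asboolP; split; first exact: MD.
have NaX : (trN (a *: x)%R < +oo)%E.
  rewrite (trN_Z vM tM) // lte_mul_pinfty ?lee_fin ?sqr_ge0 //.
have := trN_D vM tM MaX My.
have := trN_ge0 vM tM (MB vM MaX My) => h1 h2.
apply: (@le_lt_trans _ _ (2%:E * trN (a *: x)%R + 2%:E * trN y)%E).
  by rewrite -h2 leeDl.
by rewrite lte_add_pinfty // lte_mul_pinfty ?lee_fin.
Qed.

HB.instance Definition _ :=
  GRing.isSubmodClosed.Build C (H -> H) square_integrable
    square_integrable_submod.

Record L2 := L2Elem { L2_val : H -> H; L2P : L2_val \in square_integrable }.

HB.instance Definition _ := [isSub for L2_val].
HB.instance Definition _ := [Choice of L2 by <:].
HB.instance Definition _ := [SubChoice_isSubLmodule of L2 by <:].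

Implicit Types (x y z : L2).

Lemma L2_M x : M (val x).
Proof. by have /asboolP[] := L2P x. Qed.

Definition L2_sqn x : R := fine (trN (val x)).

Lemma L2_sqnE x : trN (val x) = (L2_sqn x)%:E.
Proof.
have /asboolP[Mx Nx] := L2P x.
by rewrite /L2_sqn fineK // ge0_fin_numE // (trN_ge0 vM tM).
Qed.

Lemma L2_sqn_ge0 x : 0 <= L2_sqn x.
Proof. by rewrite -lee_fin -L2_sqnE (trN_ge0 vM tM) //; exact: L2_M. Qed.

Lemma L2_identity (l l' : seq (R * L2)) :
  (forall p, p \in l -> 0 <= p.1) -> (forall p, p \in l' -> 0 <= p.1) ->
  (forall v w, \sum_(p <- l) p.1%:C * inner (val p.2 v) (val p.2 w) =
               \sum_(p <- l') p.1%:C * inner (val p.2 v) (val p.2 w)) ->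
  \sum_(p <- l) p.1 * L2_sqn p.2 = \sum_(p <- l') p.1 * L2_sqn p.2.
Proof.
move=> hl hl' h.
have sum_fin (s : seq (R * L2)) : (\sum_(p <- s) p.1 * L2_sqn p.2)%:E
    = (\sum_(p <- [seq (p.1, val p.2) | p <- s]) p.1%:E * trN p.2)%E.
  rewrite big_map -sumEFin; apply: eq_bigr => p _ /=.
  by rewrite L2_sqnE EFinM.
have wt (s : seq (R * L2)) : (forall p, p \in s -> 0 <= p.1) ->
    weighted M [seq (p.1, val p.2) | p <- s].
  by move=> hs _ /mapP[p ps ->] /=; split; [exact: hs|exact: L2_M].
have : (\sum_(p <- l) p.1 * L2_sqn p.2)%:E = (\sum_(p <- l') p.1 * L2_sqn p.2)%:E.
  rewrite !sum_fin; apply: (trN_identity vM tM); [exact: wt|exact: wt|].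
  by move=> v w; rewrite !big_map /=; exact: h.
by case.
Qed.

Lemma L2_quadratic : quadratic L2_sqn.
Proof.
split.
- exact: L2_sqn_ge0.
- move=> a x; apply: EFin_inj; rewrite -L2_sqnE EFinM -L2_sqnE.
  by rewrite (trN_Z vM tM) //; exact: L2_M.
- move=> x x' y.
  have := @L2_identity [:: (1, x + x' + y); (1, x - y); (1, x' - y)]
    [:: (1, x + x' - y); (1, x + y); (1, x' + y)].
  rewrite !big_cons !big_nil /= !mul1r !addr0 !addrA; apply.
  + by move=> p; rewrite !inE => /or3P[] /eqP ->.
  + by move=> p; rewrite !inE => /or3P[] /eqP ->.
  + move=> v w; rewrite !big_cons !big_nil /= !mul1r !addr0.
    rewrite !(ipD hP) !(ipDr hP) !(ipN hP) !(ipNr hP); ring.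
- move=> r x y r0.
  have := @L2_identity [:: (1, r%:C *: x + y); (r, x - y)]
    [:: (1, r%:C *: x - y); (r, x + y)].
  rewrite !big_cons !big_nil /= !mul1r !addr0; apply.
  + by move=> p; rewrite !inE => /orP[] /eqP ->.
  + by move=> p; rewrite !inE => /orP[] /eqP ->.
  + move=> v w; rewrite !big_cons !big_nil /= !mul1r !addr0.
    rewrite !(ipD hP) !(ipDr hP) !(ipN hP) !(ipNr hP) !(ipZ hP) !(ipZr hP).
    rewrite conj_real; ring.
Qed.

Definition L2_inner : L2 -> L2 -> C := polar L2_sqn.

Lemma L2_semi_inner : semi_inner L2_inner.
Proof. exact: polar_semi_inner L2_quadratic. Qed.

Lemma sqn_L2_inner x : sqn L2_inner x = L2_sqn x.
Proof. exact: sqn_polar L2_quadratic x. Qed.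

(* Junk value: 0 when y is not square integrable. *)
Definition to_L2 (y : H -> H) : L2 := insubd (0 : L2) y.

Lemma val_to_L2 (y : H -> H) : M y -> (trN y < +oo)%E -> val (to_L2 y) = y.
Proof. by move=> My Ny; rewrite val_insubd ifT //; apply/asboolP. Qed.

Definition lmul (e : H -> H) x : L2 := to_L2 (e \o val x).

Section LeftMultiplication.
Variable e : H -> H.
Hypothesis (Me : M e) (Pe : projection e).

Lemma val_lmul x : val (lmul e x) = e \o val x.
Proof.
apply: val_to_L2; first by apply: (vna_mul vM) => //; exact: L2_M.
apply: le_lt_trans (trN_projection_le vM tM Me Pe (L2_M x)) _.
by rewrite L2_sqnE ltry.
Qed.

Lemma lmul_linear a x y : lmul e (a *: x + y) = a *: lmul e x + lmul e y.
Proof.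
apply: val_inj; rewrite /= !val_lmul; apply/funext => v /=.
exact: (M_linear vM).
Qed.

Lemma lmulD x y : lmul e (x + y) = lmul e x + lmul e y.
Proof. by rewrite -[x]scale1r lmul_linear !scale1r. Qed.

Lemma lmulZ a x : lmul e (a *: x) = a *: lmul e x.
Proof.
have e0 : lmul e 0 = 0.
  by apply: (addrI (lmul e 0)); rewrite -lmulD !addr0.
by rewrite -[a *: x]addr0 lmul_linear e0 addr0.
Qed.

Lemma lmulB x y : lmul e (x - y) = lmul e x - lmul e y.
Proof. by rewrite -scaleN1r lmulD lmulZ scaleN1r. Qed.

Lemma lmul_idem x : lmul e (lmul e x) = lmul e x.
Proof.
apply: val_inj; rewrite !val_lmul compA; congr (_ \o _); by case: Pe.
Qed.

(** Again an equality between sums of squares: the cross terms agree because [e] is self-adjoint,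
    the squares of [e x] and [e y] cancel. *)
Lemma lmul_adj x y : L2_inner (lmul e x) y = L2_inner x (lmul e y).
Proof.
apply: (polar_adjoint (P := lmul e)) => [z|{}x {}y]; first exact: lmulZ.
have := @L2_identity [:: (1, lmul e x + y); (1, x - lmul e y)]
  [:: (1, lmul e x - y); (1, x + lmul e y)].
rewrite !big_cons !big_nil /= !mul1r !addr0; apply.
- by move=> p; rewrite !inE => /orP[] /eqP ->.
- by move=> p; rewrite !inE => /orP[] /eqP ->.
- move=> v w; rewrite !big_cons !big_nil /= !mul1r !addr0.
  rewrite !(ipD hP) !(ipDr hP) !(ipN hP) !(ipNr hP).
  rewrite -![L2_val (lmul e _)]/(val (lmul e _)) !val_lmul /=.
  have ea a b : inner (e a) b = inner a (e b) by case: Pe => _ ->.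
  rewrite !ea -![e (e _)]/((e \o e) _) (proj1 Pe); ring.
Qed.

End LeftMultiplication.

Lemma adjDM x y : adj M (val x + val y) = adj M (val x) + adj M (val y).
Proof.
apply: (adj_unique vM); first by apply: MD => //; exact: L2_M.
move=> u v; rewrite -[(_ + _) u]/(val x u + val y u).
rewrite -[(adj M _ + adj M _) v]/(adj M (val x) v + adj M (val y) v).
by rewrite (ipD hP) (ipDr hP) !(adj_inner vM) //; exact: L2_M.
Qed.

Definition involution x : L2 := to_L2 (adj M (val x)).

Lemma val_involution x : val (involution x) = adj M (val x).
Proof.
have Mx := L2_M x; apply: val_to_L2; first exact: adj_mem.
by rewrite (trN_adj vM tM) // L2_sqnE ltry.
Qed.

Lemma involutionK x : involution (involution x) = x.
Proof. by apply: val_inj; rewrite !val_involution (adjK vM) //; exact: L2_M. Qed.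

Lemma involutionD x y : involution (x + y) = involution x + involution y.
Proof. by apply: val_inj; rewrite /= !val_involution adjDM. Qed.

Lemma involutionZ a x : involution (a *: x) = a^* *: involution x.
Proof.
apply: val_inj; rewrite /= !val_involution.
apply: (adj_unique vM); first by apply: MZ => //; exact: L2_M.
move=> u v; rewrite -[val (a *: x) u]/(a *: val x u).
rewrite -[(_ *: adj M _) v]/(a^* *: adj M (val x) v).
by rewrite (ipZ hP) (ipZr hP) conjCK (adj_inner vM) //; exact: L2_M.
Qed.

(** The trace property, through [trN_adj], makes the adjoint an isometry for the L^2 norm;
    polarization does the rest. *)
Lemma involution_inner x y :
  L2_inner (involution x) (involution y) = L2_inner y x.
Proof.
have N1 z : involution (- z) = - involution z.
  by rewrite -scaleN1r involutionZ rmorphN rmorph1 scaleN1r.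
apply: (polar_anti_isometry L2_quadratic) => {x y}.
- move=> y; rewrite involutionZ -scaleNr; congr (_ *: _).
  by apply/eqP; rewrite eq_complex /= oppr0 !eqxx.
- exact: involutionD.
- by move=> x y; rewrite involutionD N1.
- move=> x; apply: EFin_inj; rewrite -!L2_sqnE val_involution (trN_adj vM tM) //.
  exact: L2_M.
Qed.

(** Defined through the adjoint, so that square integrability of [x e] and self-adjointness of right
    multiplication are inherited from left multiplication and the trace property. *)
Definition rmul (e : H -> H) x : L2 := involution (lmul e (involution x)).

Lemma val_rmul e x : M e -> projection e -> val (rmul e x) = val x \o e.
Proof.
move=> Me Pe; rewrite val_involution val_lmul // val_involution.
have Mx := L2_M x; apply: (adj_unique vM).
  by apply: (vna_mul vM) => //; exact: adj_mem.
by move=> u v /=; case: Pe => _ ->; rewrite (adj_innerl vM).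
Qed.

Lemma rmul_adj e x y : M e -> projection e ->
  L2_inner (rmul e x) y = L2_inner x (rmul e y).
Proof.
move=> Me Pe; rewrite -[in LHS](involutionK y) involution_inner.
by rewrite -[in RHS](involutionK x) involution_inner lmul_adj.
Qed.

End SquareIntegrable.

(** * Partitions of unity and normality of the trace *)

Section PartitionOfUnity.
Context {R : realType} {H : hilbertType R}.
Variable D : tracial_algebra H.
Local Notation C := R[i].
Local Notation M := (ta_M D).
Local Notation trN := (trN M (ta_Tr D)).
Let vM := ta_vna D.
Let tM := ta_trace D.
Local Notation hP := (@hilbert_semi_inner R H).
Context {I : choiceType}.
Variable e : I -> H -> H.
Hypothesis eM : forall i, M (e i).
Hypothesis eP : forall i, projection (e i).
Hypothesis e_sum : forall v, partial_sum (fun i => e i v) @ totally --> v.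

(** Normality of the trace is formulated for directed sets; the finite subsets of [I] are packaged
    as one. *)
Definition fset_directed : directedSet.
Proof.
refine (@DirectedSet {fset I} (fun F F' => (F `<=` F')%fset) _ _ _ _).
- by constructor; exact: fset0.
- by move=> F; exact: fsubset_refl.
- by move=> F F' F''; exact: fsubset_trans.
- by move=> F F'; exists (F `|` F')%fset; rewrite fsubsetUl fsubsetUr.
Defined.

Lemma partition_sqn v :
  (fun F : {fset I} => \sum_(i <- F) rnorm (e i v) ^+ 2) @ totally -->
  rnorm v ^+ 2.
Proof.
have h : (fun F => complex.Re (inner (partial_sum (fun i => e i v) F) v)) @ totally
    --> complex.Re (inner v v).
  by apply: Re_cvg; apply: inner_cvg.
rewrite sqr_rnorm /sqn; apply: cvg_ext h => F.
rewrite partial_sumE (ip_suml hP) Re_sum; apply: eq_bigr => i _.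
by rewrite sqr_rnorm /sqn -(projection_inner _ _ (eP i)).
Qed.

Lemma partition_sqn_le v (F : {fset I}) :
  \sum_(i <- F) rnorm (e i v) ^+ 2 <= rnorm v ^+ 2.
Proof.
have h := @partition_sqn v; rewrite -(cvg_lim _ h) //.
apply: limr_ge; first by apply/cvg_ex; eexists; exact: h.
exists F => //= F' FF'; rewrite (fset_sum_split _ FF') lerDl.
by apply: sumr_ge0 => i _; exact: sqr_ge0.
Qed.

(** This is [x^* e_F x] with [e_F] the sum of [e i] over [F], written as a sum of squares so that
    its trace can be computed. *)
Definition truncated_square x (F : fset_directed) : H -> H :=
  sum_squares M [seq (1, e i \o x) | i <- (F : {fset I})].

Lemma truncated_weighted x (F : {fset I}) : M x ->
  weighted M [seq (1, e i \o x) | i <- F].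
Proof.
by move=> Mx _ /mapP[i _ ->] /=; split => //; exact: (vna_mul vM).
Qed.

Lemma truncated_inner x (F : {fset I}) v : M x ->
  inner (truncated_square x F v) v = (\sum_(i <- F) rnorm (e i (x v)) ^+ 2)%:C.
Proof.
move=> Mx; rewrite (sum_squares_inner vM) ?big_map; last exact: truncated_weighted.
rewrite realc_sum; apply: eq_bigr => i _ /=.
by rewrite mul1r sqr_rnorm (sqnE hP).
Qed.

Lemma square_inner x v : M x -> inner ((adj M x \o x) v) v = (rnorm (x v) ^+ 2)%:C.
Proof. by move=> Mx; rewrite /= (adj_innerl vM) // sqr_rnorm (sqnE hP). Qed.

(** The operators [x^* e_F x] increase to [x^* x], so normality gives the trace as a supremum; the
    order relations are checked on vectors by [partition_sqn]. *)
Lemma partition_trace x : M x ->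
  trN x = ereal_sup (range (fun F : {fset I} => \sum_(i <- F) trN (e i \o x))%E).
Proof.
move=> Mx.
have -> : (fun F : {fset I} => \sum_(i <- F) trN (e i \o x))%E
    = (fun F => ta_Tr D (truncated_square x F)).
  apply/funext => F; rewrite (sum_squares_trace vM tM); last exact: truncated_weighted.
  by rewrite big_map; apply: eq_bigr => i _ /=; rewrite mul1e.
apply: (trace_normal tM (I := fset_directed)).
- by move=> F; apply: (sum_squares_positive vM); exact: truncated_weighted.
- move=> F F' /= FF' v.
  rewrite -[(_ \- _) v]/(truncated_square x F' v - truncated_square x F v).
  rewrite (ipB hP) !truncated_inner // -realcB ler0c subr_ge0.
  rewrite (fset_sum_split _ FF') lerDl.
  by apply: sumr_ge0 => i _; exact: sqr_ge0.
- exact: (square_positive vM).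
- move=> F v; rewrite -[(_ \- _) v]/((adj M x \o x) v - truncated_square x F v).
  rewrite (ipB hP) square_inner // truncated_inner // -realcB ler0c subr_ge0.
  exact: partition_sqn_le.
(* Least upper bound: at each vector the bound by [z] survives the limit over finite sets. *)
- move=> z [_ zp] hz v; rewrite -[(_ \- _) v]/(z v - (adj M x \o x) v).
  rewrite (ipB hP) square_inner // (ge0_complexE (zp v)) -realcB ler0c subr_ge0.
  have h := @partition_sqn (x v); rewrite -(cvg_lim _ h) //.
  apply: limr_le; first by apply/cvg_ex; eexists; exact: h.
  near=> F; have := hz F v.
  rewrite -[(_ \- _) v]/(z v - truncated_square x F v) (ipB hP) truncated_inner //.
  by rewrite (ge0_complexE (zp v)) -realcB ler0c subr_ge0.
Unshelve. all: by end_near. Qed.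

Lemma partition_L2 (x : L2 D) :
  (fun F : {fset I} => \sum_(i <- F) L2_sqn (lmul (e i) x)) @ totally --> L2_sqn x.
Proof.
have := partition_trace (L2_M x).
have -> : (fun F : {fset I} => \sum_(i <- F) trN (e i \o val x))%E
    = (fun F : {fset I} => (\sum_(i <- F) L2_sqn (lmul (e i) x))%:E).
  apply/funext => F; rewrite -sumEFin; apply: eq_bigr => i _.
  by rewrite -L2_sqnE val_lmul.
rewrite L2_sqnE => hsup.
have le (F : {fset I}) : \sum_(i <- F) L2_sqn (lmul (e i) x) <= L2_sqn x.
  by rewrite -lee_fin hsup; apply: ereal_sup_ubound; exists F.
apply/cvgrPdist_lt => d d0.
have : ((L2_sqn x - d)%:E < ereal_sup (range (fun F : {fset I} =>
    (\sum_(i <- F) L2_sqn (lmul (e i) x))%:E)))%E.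
  by rewrite -hsup lte_fin ltrBlDr ltrDl.
move=> /ereal_sup_gt[_ [F0 _ <-]]; rewrite lte_fin => hF0.
exists F0 => //= F FF0; rewrite ger0_norm ?subr_ge0 //.
have : \sum_(i <- F0) L2_sqn (lmul (e i) x) <= \sum_(i <- F) L2_sqn (lmul (e i) x).
  rewrite (fset_sum_split _ FF0) lerDl.
  by apply: sumr_ge0 => i _; exact: L2_sqn_ge0.
move: hF0; lra.
Qed.

Lemma partition_family :
  projection_family (@L2_inner _ _ D) (fun i => lmul (e i)).
Proof.
split.
- by move=> i x; exact: lmul_idem.
- by move=> i x y; exact: lmul_adj.
- move=> x; rewrite (sqn_L2_inner x); apply: cvg_ext (@partition_L2 x) => F.
  by apply: eq_bigr => i _; rewrite sqn_L2_inner.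
Qed.

End PartitionOfUnity.

(** * The isometric action on square-integrable operators *)

Section Action.
Context {R : realType} {H : hilbertType R}.
Variable D : tracial_algebra H.
Local Notation C := R[i].
Local Notation M := (ta_M D).
Local Notation trN := (trN M (ta_Tr D)).
Let vM := ta_vna D.
Let tM := ta_trace D.
Context {G : groupType}.
Variable sigma : G -> (H -> H) -> (H -> H).
Hypothesis sA : action_on M sigma.
Hypothesis sT : trace_preserving M (ta_Tr D) sigma.
Local Notation L2 := (L2 D).
Implicit Types (x y : L2) (g h : G).

Lemma act_mem g (a : H -> H) : M a -> M (sigma g a).
Proof.
by have [b _ _ _ _] := action_aut sA g => Ma; exact: (set_bij_homo b).
Qed.

Lemma act_comp g (a b : H -> H) : M a -> M b ->
  sigma g (a \o b) = sigma g a \o sigma g b.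
Proof. exact: (staut_mul (action_aut sA g)). Qed.

Lemma act_projection g (a : H -> H) : M a -> projection a -> projection (sigma g a).
Proof.
move=> Ma [aa ap]; split; first by rewrite -act_comp // aa.
exact: (staut_adjoint (action_aut sA g)).
Qed.

Lemma act_adj g (a : H -> H) : M a -> adj M (sigma g a) = sigma g (adj M a).
Proof.
move=> Ma; apply: (adj_unique vM); first exact: act_mem.
by have [Ma' aa'] := adjP vM Ma; exact: (staut_adjoint (action_aut sA g)).
Qed.

Lemma act_trN g (a : H -> H) : M a -> trN (sigma g a) = trN a.
Proof.
move=> Ma; rewrite /trN act_adj // -act_comp //; last exact: adj_mem.
by apply: sT; exact: (square_positive vM).
Qed.

Definition act g x : L2 := to_L2 D (sigma g (val x)).

Lemma val_act g x : val (act g x) = sigma g (val x).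
Proof.
have Mx := L2_M x; apply: val_to_L2; first exact: act_mem.
by rewrite act_trN // L2_sqnE ltry.
Qed.

Lemma actD g x y : act g (x + y) = act g x + act g y.
Proof.
apply: val_inj; rewrite /= !val_act.
by rewrite -[RHS](staut_add (action_aut sA g)) //; exact: L2_M.
Qed.

Lemma actZ g a x : act g (a *: x) = a *: act g x.
Proof.
apply: val_inj; rewrite /= !val_act.
by rewrite -[RHS](staut_scale (action_aut sA g)) //; exact: L2_M.
Qed.

Lemma actB g x y : act g (x - y) = act g x - act g y.
Proof. by rewrite -scaleN1r actD actZ scaleN1r. Qed.

Lemma actM g h x : act (g * h)%g x = act g (act h x).
Proof. by apply: val_inj; rewrite !val_act (action_mul sA) //; exact: L2_M. Qed.

Lemma act1 x : act 1%g x = x.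
Proof. by apply: val_inj; rewrite !val_act (action_one sA) //; exact: L2_M. Qed.

Lemma act_sqn g x : L2_sqn (act g x) = L2_sqn x.
Proof. by apply: EFin_inj; rewrite -!L2_sqnE val_act act_trN //; exact: L2_M. Qed.

Lemma act_inner g x y : L2_inner (act g x) (act g y) = L2_inner x y.
Proof.
apply: (polar_isometry (P := act g)) => [z|{}x {}y|{}x {}y|{}x].
- exact: actZ.
- exact: actD.
- exact: actB.
- exact: act_sqn.
Qed.

Lemma act_lmul g (a : H -> H) x : M a -> projection a ->
  act g (lmul a x) = lmul (sigma g a) (act g x).
Proof.
move=> Ma Pa; apply: val_inj; rewrite val_act val_lmul // val_lmul.
- by rewrite val_act act_comp //; exact: L2_M.
- exact: act_mem.
- exact: act_projection.
Qed.

End Action.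

(** * From von Neumann equivalence to a coupling *)

Section Coupling.
Context {R : realType} {H : hilbertType R} {Gam Lam : groupType}.
Variable D : tracial_algebra H.
Local Notation M := (ta_M D).
Local Notation Tr := (ta_Tr D).
Let vM := ta_vna D.
Let tM := ta_trace D.
Variable sigma : Gam * Lam -> (H -> H) -> (H -> H).
Hypothesis sA : action_on M sigma.
Hypothesis sT : trace_preserving M Tr sigma.
Variables p q : H -> H.
Hypothesis pD : fundamental_domain M (fun s => sigma (s, 1%g)) p.
Hypothesis qD : fundamental_domain M (fun t => sigma (1%g, t)) q.
Hypothesis q_fin : (Tr q < +oo)%E.
Hypothesis H_nonzero : exists v : H, v != 0.

Let Mp : M p. Proof. by case: pD. Qed.
Let Pp : projection p. Proof. by case: pD. Qed.
Let Mq : M q. Proof. by case: qD. Qed.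
Let Pq : projection q. Proof. by case: qD. Qed.
Let Ms (a : H -> H) g : M a -> M (sigma g a). Proof. exact: act_mem. Qed.
Let Ps (a : H -> H) g : M a -> projection a -> projection (sigma g a).
Proof. exact: act_projection. Qed.

Let U := @act R H D _ sigma.
Let A g := @lmul R H D (sigma g q).
Let B s := @lmul R H D (sigma (s, 1%g) p).
Let w : L2 D := to_L2 D q.

Lemma trN_domain : trN M Tr q = Tr q.
Proof. by rewrite /trN (adj_projection vM Mq Pq) (proj1 Pq). Qed.

Lemma val_domain : val w = q.
Proof. by apply: val_to_L2 => //; rewrite trN_domain. Qed.

Lemma val_A g x : val (A g x) = sigma g q \o val x.
Proof. by rewrite val_lmul //; [exact: Ms|exact: Ps]. Qed.

Lemma val_U g x : val (U g x) = sigma g (val x).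
Proof. exact: val_act. Qed.

Lemma actK g x : U g (U g^-1%g x) = x.
Proof. by rewrite /U -(actM sA sT) mulgV (act1 sA sT). Qed.

(** The hypothesis on [q] concerns the slice [s = 1]. The slice at [s] is its image under the
    automorphism of [(s, 1)], so the statement at [x] is the one at [U (s, 1)^-1 x] carried over by
    an isometry. *)
Lemma coupling_A s :
  projection_family (@L2_inner _ _ D) (fun t => A (s, t)).
Proof.
split.
- by move=> t x; apply: lmul_idem; [exact: Ms|exact: Ps].
- by move=> t x y; apply: lmul_adj; [exact: Ms|exact: Ps].
- move=> x; pose g : Gam * Lam := (s, 1%g).
  have [_ _ qsum] := qD.
  have h := @partition_L2 _ _ D _ (fun t => sigma (1%g, t) q)
    (fun t => Ms _ Mq) (fun t => Ps _ Mq Pq) qsum (U g^-1%g x).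
  rewrite (sqn_L2_inner x) -(act_sqn sA sT g^-1%g x).
  apply: cvg_ext h => F; apply: eq_bigr => t _.
  rewrite sqn_L2_inner -(act_sqn sA sT g (lmul _ _)).
  rewrite (act_lmul sA sT); [|exact: Ms|exact: Ps].
  rewrite -(action_mul sA) //; congr (L2_sqn (lmul (sigma _ _) _)).
    by congr pair; rewrite /= ?mulg1 ?mul1g.
  exact: actK.
Qed.

Lemma coupling_B : projection_family (@L2_inner _ _ D) B.
Proof.
have [_ _ psum] := pD.
exact: (partition_family (fun s => Ms _ Mp) (fun s => Ps _ Mp Pp) psum).
Qed.

(** With [k = h^-1], [l = k g] and [X = sigma_l(q) sigma_k(q)], both sides equal the inner product
    of [X] with [q]. On the left, after translation by [k], a spare right factor [sigma_k(q)] is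
    moved onto [X], which absorbs it; on the right, a spare right factor [q] is moved onto [w]. *)
Lemma coupling_AA g h :
  L2_inner (A g w) (A h w) = L2_inner (A (h^-1 * g)%g (A h^-1%g w)) w.
Proof.
set k := h^-1%g; set l := (k * g)%g.
pose X := A l (U k w).
have Xk : rmul (sigma k q) X = X.
  apply: val_inj; rewrite val_rmul ?val_A ?val_U //; [|exact: Ms|exact: Ps].
  by rewrite val_domain -compA -(act_comp sA) // (proj1 Pq).
have e1 : U k (A g w) = X.
  apply: val_inj; rewrite val_U // !val_A val_U // val_domain.
  by rewrite (act_comp sA) //; [rewrite -(action_mul sA)|exact: Ms].
have e2 : U k (A h w) = rmul (sigma k q) w.
  apply: val_inj; rewrite val_U // val_A val_rmul; [|exact: Ms|exact: Ps].
  rewrite val_domain (act_comp sA) //; last exact: Ms.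
  by rewrite -(action_mul sA) // /k mulVg (action_one sA).
have e3 : A l (A k w) = rmul q X.
  apply: val_inj; rewrite val_rmul // !val_A val_U // val_domain.
  by rewrite compA.
have e4 : rmul q w = w.
  by apply: val_inj; rewrite val_rmul // val_domain (proj1 Pq).
rewrite -(act_inner sA sT k) -/U e1 e2 -rmul_adj; [|exact: Ms|exact: Ps].
by rewrite Xk e3 rmul_adj // e4.
Qed.

(** [A g w] is [U g w] multiplied by [q] on the right, and right multiplication by [q] moves across
    to [w], which it fixes. *)
Lemma coupling_AU g : L2_inner (A g w) w = L2_inner (U g w) w.
Proof.
have e1 : A g w = rmul q (U g w).
  by apply: val_inj; rewrite val_rmul // val_A val_U // val_domain.
have e4 : rmul q w = w.
  by apply: val_inj; rewrite val_rmul // val_domain (proj1 Pq).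
by rewrite e1 rmul_adj // e4.
Qed.

(** Otherwise faithfulness gives [q = 0]; all translates of [q] then vanish, yet they sum to the
    identity of a nonzero space. *)
Lemma domain_gt0 : 0 < L2_sqn w.
Proof.
rewrite lt_neqAle L2_sqn_ge0 andbT eq_sym; apply/negP => /eqP w0.
have q0 : q = 0.
  by apply: (trN_faithful vM tM Mq); rewrite -val_domain L2_sqnE w0.
have s0 g : sigma g (0 : H -> H) = 0.
  have := staut_scale (action_aut sA g) 0 (M0 vM).
  have z0 (a : H -> H) : 0 \*: a = 0 by apply/funext => v /=; rewrite scale0r.
  by rewrite !z0.
have [v v0] := H_nonzero; have [_ _ /(_ v) qsum] := qD.
move/eqP: v0; apply; apply: (hassum_unique qsum).
have -> : (fun t => sigma (1%g, t) q v) = (fun=> 0).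
  by apply/funext => t; rewrite q0 s0.
have := @hassum_finite R Lam H (fun=> 0) fset0 (fun _ _ => erefl).
by rewrite big_seq_fset0.
Qed.

Lemma coupling_L2 : coupling (@L2_inner _ _ D) U A B w.
Proof.
split.
- exact: L2_semi_inner.
- exact: actB.
- exact: actM.
- exact: act_inner.
- exact: coupling_A.
- exact: coupling_B.
- by move=> g x y; apply: lmulB; [exact: Ms|exact: Ps].
- move=> s r x; rewrite /U /B (act_lmul sA sT); [|exact: Ms|exact: Ps].
  rewrite -(action_mul sA) //; congr (lmul (sigma _ _) _).
  by congr pair; rewrite /= mulg1.
- by apply: val_inj; rewrite val_A val_domain (action_one sA) // (proj1 Pq).
- exact: coupling_AA.
- exact: coupling_AU.
- by rewrite sqn_L2_inner; exact: domain_gt0.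
Qed.

End Coupling.

Lemma von_neumann_equivalent_sym (R : realType) (Gam Lam : groupType) :
  von_neumann_equivalent R Gam Lam -> von_neumann_equivalent R Lam Gam.
Proof.
case=> H [M [Tr [sigma [vM tM [sA sT] pD qD]]]].
exists H, M, Tr, (fun g => sigma (g.2, g.1)); split => //; split.
  split.
  - by move=> g; exact: (action_aut sA).
  - by move=> x Mx; exact: (action_one sA Mx).
  - by move=> g h x Mx; exact: (action_mul sA (g.2, g.1) (h.2, h.1) Mx).
by move=> g x; exact: sT.
Qed.

Lemma von_neumann_equivalent_coupling (R : realType) (Gam Lam : groupType) :
  von_neumann_equivalent R Gam Lam ->
  exists (V : lmodType R[i]) (f : V -> V -> R[i]) (U A : Gam * Lam -> V -> V)
    (B : Gam -> V -> V) (w : V), coupling f U A B w.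
Proof.
case=> H [M [Tr [sigma [[vM Hn] tM [sA sT] [p pD _] [q qD q_fin]]]]].
pose D := TracialAlgebra vM tM.
by do 6!eexists; exact: (@coupling_L2 R H Gam Lam D sigma sA sT p q pD qD q_fin Hn).
Qed.

Theorem theorem1p1 (R : realType) (Gam Lam : groupType)
    (countable_Gam : countable [set: Gam]) (countable_Lam : countable [set: Lam])
    (vne : von_neumann_equivalent R Gam Lam) :
  [/\ weakly_amenable R Gam <-> weakly_amenable R Lam,
      weak_haagerup R Gam <-> weak_haagerup R Lam,
      approximation_property R Gam <-> approximation_property R Lam
    & haagerup R Gam <-> haagerup R Lam].
Proof.
have [V [f [U [A [B [w cp]]]]]] := von_neumann_equivalent_coupling vne.
have [V' [f' [U' [A' [B' [w' cp']]]]]] :=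
  von_neumann_equivalent_coupling (von_neumann_equivalent_sym vne).
split; split.
- exact: (weakly_amenable_transfer cp').
- exact: (weakly_amenable_transfer cp).
- exact: (weak_haagerup_transfer cp').
- exact: (weak_haagerup_transfer cp).
- exact: (approximation_property_transfer cp').
- exact: (approximation_property_transfer cp).
- exact: (haagerup_transfer cp').
- exact: (haagerup_transfer cp).
Qed.
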